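(* Let $\rho:\Gamma_0(2)\to \mathrm{GL}_2(\mathbf{C})$ be an irreducible representation. Let $k_0$ denote the integer for which $M_{k_0}(\rho)\neq 0$ and $M_k(\rho)=0$ for all $k<k_0$. Let $F$ be a nonzero element of $M_{k_0}(\rho)$. Then $F$ and $D_{k_0}F:=\frac{1}{2\pi i}\frac{dF}{d\tau}-\frac{k_0}{12}E_2F$ form a basis of $M(\rho)$ as a module over $M(\Gamma_0(2))$.
   Context: $\Gamma=\mathrm{SL}_2(\mathbf{Z})$, $\Gamma_0(2)=\{\begin{pmatrix}a&b\\c&d\end{pmatrix}\in\Gamma: c\equiv 0 \pmod 2\}$, $T=\begin{pmatrix}1&1\\0&1\end{pmatrix}$. $\mathfrak{H}$ is the upper half-plane, $q=e^{2\pi i\tau}$. For $k\in\mathbf{Z}$, $\gamma=\begin{pmatrix}a&b\\c&d\end{pmatrix}\in\Gamma$ and $F:\mathfrak{H}\to\mathbf{C}^n$, $(F|_k\gamma)(\tau):=(c\tau+d)^{-k}F(\frac{a\tau+b}{c\tau+d})$. For a representation $\rho$ of $\Gamma_0(2)$ on $\mathbf{C}^n$, $M_k(\rho)$ is the complex vector space of vector-valued modular forms of weight $k$ for $\rho$: holomorphic $F:\mathfrak{H}\to\mathbf{C}^n$ with $F|_k\gamma=\rho(\gamma)F$ for all $\gamma\in\Gamma_0(2)$ that are holomorphic at all cusps, meaning: for each $\gamma\in\Gamma$, with $N$ the least positive integer such that $T^N$ lies in every $\Gamma$-conjugate of $\Gamma_0(2)$ and $h\in\Gamma_0(2)$ with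 $\gamma T^N=h\gamma$, and $P$ a matrix putting $\rho(h)$ in Jordan form, the components of $P(F|_k\gamma)$ are polynomials in $\tau$ whose coefficient functions have expansions $\sum_{n\in\mathbf{Z}}a_n e^{2\pi i(n+\mu)\tau/N}$ ($e^{2\pi i\mu}$ an eigenvalue of $\rho(h)$) with $a_n=0$ whenever $\mathrm{Re}(n+\mu)<0$. $M_k(\Gamma_0(2))$ denotes the usual holomorphic weight-$k$ modular forms on $\Gamma_0(2)$, $M(\Gamma_0(2))=\bigoplus_k M_k(\Gamma_0(2))$, and $M(\rho)=\bigoplus_{k\in\mathbf{Z}}M_k(\rho)$ is a graded $M(\Gamma_0(2))$-module via multiplication. $E_2(\tau)=1-24\sum_{n\ge1}\sigma(n)q^n$. *)

(* Defs.v *)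
From HB Require Import structures.
From mathcomp Require Import all_boot all_order all_algebra.
From mathcomp Require Import all_classical all_reals all_analysis.
From mathcomp Require Import ring.
From mathcomp Require Import complex.
Set Implicit Arguments.
Unset Strict Implicit.
Unset Printing Implicit Defensive.
Import Order.TTheory GRing.Theory Num.Theory.
Import numFieldNormedType.Exports.
Local Open Scope classical_set_scope.
Local Open Scope ring_scope.

(* R[i] with its usual topology, as a normed space over itself; the library
   only declares this structure on the alias R[i]^o. *)
HB.instance Definition _ (R : realType) := NormedModule.copy R[i] R[i]^o.

Definition SL2Z : set 'M[int]_2 := [set g | \det g = 1].

Definition Gamma0_2 : set 'M[int]_2 :=
  [set g | SL2Z g /\ (2 %| g 1%R 0%R)%Z].

(* The matrix with rows (1, 1) and (0, 1). *)
Definition Tmx : 'M[int]_2 := 1 + delta_mx 0 1.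

Definition T_power_in_conjugates (N : nat) : Prop :=
  (0 < N)%N /\
  forall g, SL2Z g -> Gamma0_2 (g * Tmx ^+ N * g^-1).

Definition is_cusp_period (N : nat) : Prop :=
  T_power_in_conjugates N /\
  forall M, T_power_in_conjugates M -> (N <= M)%N.

Section UpperHalfPlane.
Variable R : realType.
Local Notation C := R[i].

Definition uhp : Type := {z : C | 0 < complex.Im z}.

(* The default value tau of insubd is never used for g in SL2Z: see mobiusE. *)
Definition mobius (g : 'M[int]_2) (tau : uhp) : uhp :=
  insubd tau (((g 0 0)%:~R * val tau + (g 0 1)%:~R) /
              ((g 1 0)%:~R * val tau + (g 1 1)%:~R)).

Lemma mobiusE g tau : SL2Z g ->
  val (mobius g tau) = ((g 0 0)%:~R * val tau + (g 0 1)%:~R) /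
                       ((g 1 0)%:~R * val tau + (g 1 1)%:~R).
Proof.
move=> /= detg; rewrite /mobius val_insubd.
case: ifP => // /negP []; case: tau => -[x y] /= y0.
have intC (m : int) : m%:~R = Complex (m%:~R : R) 0.
  by rewrite -[LHS](rmorph_int (real_complex R)).
have detgR : (g 0 0)%:~R * (g 1 1)%:~R - (g 0 1)%:~R * (g 1 0)%:~R = 1 :> R.
  rewrite -!intrM -intrB -[RHS]/(1%:~R) -detg (expand_det_row _ 0); congr (intmul _ _).
  rewrite big_ord_recl big_ord1 /cofactor !det_mx11 !mxE /=.
  rewrite expr0 mul1r expr1 mulN1r mulrN.
  by congr (_ * g _ _ - g _ _ * g _ _); apply/val_inj.
rewrite !intC; move: detgR.
move: ((g 0 0)%:~R) ((g 0 1)%:~R) ((g 1 0)%:~R) ((g 1 1)%:~R) => a b c d ad1.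
rewrite /= !(mul0r, mulr0, subr0, add0r, addr0).
set D := _ ^+ 2 + _.
rewrite [ltRHS](_ : _ = y * (a * d - b * c) / D); last by ring.
rewrite ad1 mulr1 divr_gt0 // /D.
have [c0|c0] := eqVneq c 0.
  rewrite c0 !mul0r expr0n /= addr0 add0r exprn_even_gt0 //=.
  by apply: contra_eqT ad1 => /negPn/eqP ->; rewrite c0 !mulr0 subr0 eq_sym oner_eq0.
rewrite ltr_wpDl ?sqr_ge0 // exprn_even_gt0 //= mulf_neq0 //.
by rewrite gt_eqF.
Qed.

Definition slash (V : lmodType C) (k : int) (g : 'M[int]_2) (F : uhp -> V) :
    uhp -> V :=
  fun tau => ((g 1 0)%:~R * val tau + (g 1 1)%:~R) ^ (- k) *: F (mobius g tau).

(* Extension by 0, so that the library's derivative on C applies; uhp is open,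
   so the values outside of it do not matter. *)
Definition ext0 (f : uhp -> C) : C -> C := fun z => oapp f 0 (insub z).

Definition holomorphic (f : uhp -> C) : Prop :=
  forall tau : uhp, derivable (ext0 f) (val tau : C) 1.

Definition cexp (z : C) : C :=
  Complex (expR (complex.Re z) * cos (complex.Im z))
          (expR (complex.Re z) * sin (complex.Im z)).

Definition two_pi_i : C := Complex 0 (2 * pi).

Definition sums_over_int (u : int -> C) (l : C) : Prop :=
  exists l1 l2 : C,
  [/\ series (fun n : nat => u n%:Z) @ \oo --> l1,
      series (fun n : nat => u (- n.+1%:Z)) @ \oo --> l2 &
      l = l1 + l2].

Definition has_expansion (N : nat) (mu : C) (f : uhp -> C) : Prop :=
  exists a : int -> C,
  (forall n : int, complex.Re (n%:~R + mu) < 0 -> a n = 0) /\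
  forall tau : uhp,
    sums_over_int
      (fun n => a n * cexp (two_pi_i * (n%:~R + mu) * val tau / N%:R))
      (f tau).

Definition modular_form (k : int) (f : uhp -> C) : Prop :=
  [/\ holomorphic f,
      forall g, Gamma0_2 g -> slash k g f = f &
      forall g N, SL2Z g -> is_cusp_period N -> has_expansion N 0 (slash k g f)].

Definition is_jordan_form (n : nat) (J : 'M[C]_n) : Prop :=
  (forall i j : 'I_n, j != i -> j != i.+1 :> nat -> J i j = 0) /\
  (forall i j : 'I_n, j = i.+1 :> nat ->
     J i j = 0 \/ (J i j = 1 /\ J i i = J j j)).

Definition representation (n : nat) (rho : 'M[int]_2 -> 'M[C]_n) : Prop :=
  [/\ rho 1 = 1%:M,
      forall g, Gamma0_2 g -> rho g \in unitmx &
      forall g h, Gamma0_2 g -> Gamma0_2 h -> rho (g * h) = rho g *m rho h].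

Definition irreducible (n : nat) (rho : 'M[int]_2 -> 'M[C]_n) : Prop :=
  (0 < n)%N /\
  forall W : {vspace 'cV[C]_n},
    (forall g v, Gamma0_2 g -> v \in W -> rho g *m v \in W) ->
    W = 0%VS \/ W = fullv.

(* The i-th component of P (F |_k g) belongs to a Jordan block of rho h whose
   eigenvalue is the i-th diagonal entry. *)
Definition holomorphic_at_cusps (n : nat) (rho : 'M[int]_2 -> 'M[C]_n)
    (k : int) (F : uhp -> 'cV[C]_n) : Prop :=
  forall (g h : 'M[int]_2) (N : nat) (P : 'M[C]_n),
    SL2Z g -> is_cusp_period N -> Gamma0_2 h -> g * Tmx ^+ N = h * g ->
    P \in unitmx -> is_jordan_form (P *m rho h *m invmx P) ->
  forall i : 'I_n, exists (mu : C) (d : nat) (c : 'I_d -> uhp -> C),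
  [/\ cexp (two_pi_i * mu) = (P *m rho h *m invmx P) i i,
      forall j, has_expansion N mu (c j) &
      forall tau, (P *m slash k g F tau) i 0 =
                  \sum_(j < d) c j tau * val tau ^+ j].

Definition vv_modular_form (n : nat) (rho : 'M[int]_2 -> 'M[C]_n)
    (k : int) (F : uhp -> 'cV[C]_n) : Prop :=
  [/\ forall i, holomorphic (fun tau => F tau i 0),
      forall g, Gamma0_2 g -> slash k g F = (fun tau => rho g *m F tau) &
      holomorphic_at_cusps rho k F].

(* The external direct sum over k of the M k, as finitely supported families. *)
Definition direct_sum (V : zmodType) (M : int -> V -> Prop) : set (int -> V) :=
  [set f | (forall k, M k (f k)) /\ finite_set [set k | f k <> 0]].

Definition homogeneous (V : zmodType) (k : int) (F : V) : int -> V :=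
  fun j => if j == k then F else 0.

Definition graded_modular_forms : set (int -> uhp -> C) :=
  direct_sum modular_form.

Definition graded_vv_modular_forms (n : nat) (rho : 'M[int]_2 -> 'M[C]_n) :
    set (int -> uhp -> 'cV[C]_n) :=
  direct_sum (vv_modular_form rho).

Definition graded_scale (V : lmodType C) (f : int -> uhp -> C)
    (G : int -> uhp -> V) : int -> uhp -> V :=
  fun k tau => \sum_(i \in [set: int]) f i tau *: G (k - i) tau.

Definition is_basis (n : nat) (rho : 'M[int]_2 -> 'M[C]_n) (m : nat)
    (B : m.-tuple (int -> uhp -> 'cV[C]_n)) : Prop :=
  [/\ forall i, graded_vv_modular_forms rho (tnth B i),
      forall G, graded_vv_modular_forms rho G ->
        exists c : 'I_m -> int -> uhp -> C,
          (forall i, graded_modular_forms (c i)) /\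
          G = \sum_(i < m) graded_scale (c i) (tnth B i) &
      forall c : 'I_m -> int -> uhp -> C,
        (forall i, graded_modular_forms (c i)) ->
        \sum_(i < m) graded_scale (c i) (tnth B i) = 0 ->
        forall i, c i = 0].

Definition sigma (n : nat) : nat := \sum_(d <- divisors n) d.

Definition E2 (tau : uhp) : C :=
  1 - 24 * limn (series (fun n : nat =>
    (sigma n.+1)%:R * cexp (two_pi_i * val tau) ^+ n.+1)).

Definition modular_derivative (n : nat) (k : int) (F : uhp -> 'cV[C]_n) :
    uhp -> 'cV[C]_n :=
  fun tau =>
    two_pi_i^-1 *: (\col_i derive1 (ext0 (fun t => F t i 0)) (val tau : C))
    - (k%:~R / 12 * E2 tau) *: F tau.

End UpperHalfPlane.

(* Main.v *)
(* Let A be the Eisenstein series of weight 2 on Gamma_0(2), and D the form of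
   weight 4 without zeros except a simple one at the cusp 0; both are
   constructed from E2, whose behaviour under t |-> -1/t is proved by comparing
   row and column sums of a double series.  A form for rho vanishing at the cusp
   0 is divisible by D, and since the leading coefficients of forms at the cusp 0
   are determined by two scalars, any three forms of equal weight have a
   nontrivial linear combination divisible by D.  An equation D_k X = c A X with
   X <> 0 would make X a scalar function times a constant vector spanning an
   invariant line, so irreducibility makes A F and D_k0 F linearly independent
   modulo D, forms of weight k0 being multiples of F.  All weights of nonzero
   forms have the parity of k0, as rho(-1) is a scalar, and hence G in
   M_(k0 + 2m)(rho) differs from a combination of A^m F and A^(m-1) D_k0 F by D
   times a form of weight k0 + 2m - 4: induction on the weight shows that F and
   D_k0 F generate.  If x F + y D_k0 F = 0 then x and y vanish at the cusp 0, and
   dividing by D repeatedly they vanish there to infinite order, so x = y = 0. *)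

(* The representation is arbitrary: the image of a parabolic element need not be diagonalizable nor
   have eigenvalues of modulus 1, so components at a cusp are polynomials in t with complex
   exponents. Vanishing at a cusp is therefore measured by growth on vertical lines ([grow], [van]),
   which does not depend on a Jordan basis. The weights fit as follows. D has weight 4, while A and
   the derivative raise the weight by 2 only; so a form of weight k0 + 2 vanishing at the cusp 0 has
   a quotient by D of weight k0 - 2 and is zero by minimality. Relations modulo D in weight k0 + 2
   are thus identities. That the forms of weight k0 are a line needs one more argument: if D_k0 F =
   A X with X of weight k0 outside the line of F, then A^-1 D_k0 preserves the span of F and X and
   has an eigenvector there, which irreducibility forbids. No valence formula or Cauchy theory
   enters. Rigidity comes from first-order linear equations, whose solutions are unique up to a
   constant: they give the invariance of D and the constant vector behind an eigenform. *)
Require Import Defs.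
From HB Require Import structures.
From mathcomp Require Import all_boot all_order all_algebra.
From mathcomp Require Import all_classical all_reals all_analysis.
From mathcomp Require Import ring lra zify.
From mathcomp Require Import complex.
Set Implicit Arguments.
Unset Strict Implicit.
Unset Printing Implicit Defensive.
Import Order.TTheory GRing.Theory Num.Theory.
Import numFieldNormedType.Exports.
Import Normc.
Local Open Scope classical_set_scope.
Local Open Scope ring_scope.
Local Open Scope complex_scope.

(** * Complex numbers and series *)

Section ComplexNorm.
Variable R : realType.
Local Notation C := R[i].
Implicit Types (z w : C).

Lemma normrcE z : `|z| = (normc z)%:C.
Proof. by []. Qed.

Lemma normc_ge0 z : 0 <= normc z.
Proof. by case: z => a b; rewrite sqrtr_ge0. Qed.

Lemma normc_gt0 z : (0 < normc z) = (z != 0).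
Proof. by rewrite -ltcR -normrcE normr_gt0. Qed.

Lemma normc_real (x : R) : normc x%:C = `|x|.
Proof. by rewrite /= expr0n /= addr0 sqrtr_sqr. Qed.

Lemma normcX z n : normc (z ^+ n) = normc z ^+ n.
Proof. by apply: (@complexI R); rewrite rmorphXn /= -!normrcE normrX. Qed.

Lemma normc_nat n : normc (n%:R : C) = n%:R.
Proof. by apply: (@complexI R); rewrite -normrcE normr_nat rmorph_nat. Qed.

Lemma normc_int (m : int) : normc (m%:~R : C) = `|m%:~R|.
Proof. by rewrite -(rmorph_int (real_complex R)) normc_real. Qed.

Lemma normc_div z w : normc (z / w) = normc z / normc w.
Proof. by rewrite normcM normcV. Qed.

Lemma normcB z w : normc (z - w) = normc (w - z).
Proof. by rewrite -normcN opprB. Qed.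

Lemma le_normcB z w : normc (z - w) <= normc z + normc w.
Proof. by rewrite -(normcN w) le_normcD. Qed.

Lemma lB_normcD z w : normc z - normc w <= normc (z + w).
Proof. by rewrite lerBlDr -{1}(addrK w z) -(normcN w) le_normcD. Qed.

Lemma lB_normcB z w : normc z - normc w <= normc (z - w).
Proof. by rewrite -(normcN w) lB_normcD. Qed.

Lemma le_normc_sum I (r : seq I) (P : pred I) (F : I -> C) :
  normc (\sum_(i <- r | P i) F i) <= \sum_(i <- r | P i) normc (F i).
Proof.
elim/big_rec2: _ => [|i a b _ h]; first by rewrite normc0.
by rewrite (le_trans (le_normcD _ _)) // lerD2l.
Qed.

Lemma ler_normRe z : `|complex.Re z| <= normc z.
Proof. by case: z => a b /=; rewrite -sqrtr_sqr ler_wsqrtr // lerDl sqr_ge0. Qed.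

Lemma ler_normIm z : `|complex.Im z| <= normc z.
Proof. by case: z => a b /=; rewrite -sqrtr_sqr ler_wsqrtr // lerDr sqr_ge0. Qed.

Lemma ler_normc_ReIm z : normc z <= `|complex.Re z| + `|complex.Im z|.
Proof.
have -> : z = (complex.Re z)%:C + 'i * (complex.Im z)%:C by exact: complexE.
rewrite (le_trans (le_normcD _ _)) // normcM !normc_real.
case: z => a b /=; simpc.
by rewrite expr0n /= add0r expr1n sqrtr1 mul1r lexx.
Qed.

Lemma sqr_normcE z : normc z ^+ 2 = complex.Re z ^+ 2 + complex.Im z ^+ 2.
Proof. by case: z => a b /=; rewrite sqr_sqrtr // addr_ge0 // sqr_ge0. Qed.

Section Cvg.
Context {T : Type} {F : set_system T} {FF : Filter F}.

(** A positive element of [C] is a positive real, so a real tolerance is enough. *)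
Lemma cvgcP (f : T -> C) (l : C) :
  (f x @[x --> F] --> l) <->
  (forall e : R, 0 < e -> \forall x \near F, normc (l - f x) < e).
Proof.
split=> [/cvgrPdist_lt h e e0|h].
  have := h e%:C; rewrite ltcR => /(_ e0).
  by apply: filterS => x; rewrite normrcE ltcR.
apply/cvgrPdist_lt => -[e e'] /= /[!ltcE] /= /andP[/eqP -> e0].
by apply: filterS (h e e0) => x; rewrite normrcE -ltcR.
Qed.

Lemma cvgc_squeeze (f : T -> C) (l : C) (g : T -> R) :
  (\forall x \near F, normc (l - f x) <= g x) -> g x @[x --> F] --> (0 : R) ->
  f x @[x --> F] --> l.
Proof.
move=> fg /cvgrPdist_lt g0; apply/cvgcP => e e0.
have := g0 e e0; apply: filterS2 fg => x h; rewrite sub0r normrN => k.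
by rewrite (le_lt_trans h) // (le_lt_trans _ k) // ler_norm.
Qed.

Lemma cvgc_normc (f : T -> C) (l : C) :
  f x @[x --> F] --> l -> normc (f x) @[x --> F] --> normc l.
Proof.
move=> /cvgcP h; apply/cvgrPdist_lt => e e0.
apply: filterS (h e e0) => x; apply: le_lt_trans.
by rewrite ler_norml lB_normcB andbT lerNl opprB normcB lB_normcB.
Qed.

Lemma cvg_complex (f g : T -> R) (a b : R) :
  f x @[x --> F] --> a -> g x @[x --> F] --> b ->
  (Complex (f x) (g x) : C) @[x --> F] --> (Complex a b : C).
Proof.
move=> fa gb; apply: (@cvgc_squeeze (fun x => Complex (f x) (g x)) (Complex a b) (fun x => `|a - f x| + `|b - g x|)).
  by apply: nearW => x; apply: (le_trans (ler_normc_ReIm _)).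
rewrite -[0 : R]addr0; apply: cvgD; rewrite -(@normr0 _ R); apply: cvg_norm.
  by rewrite -[0](subrr a); apply: cvgB => //; exact: cvg_cst.
by rewrite -[0](subrr b); apply: cvgB => //; exact: cvg_cst.
Qed.

End Cvg.

Lemma normc_cvg_series (u : nat -> C) :
  cvgn (series (fun n => normc (u n))) -> cvgn (series u).
Proof.
move=> cu.
have cmp (v : nat -> R) : (forall n, `|v n| <= normc (u n)) -> cvgn (series v).
  move=> vu; apply: normed_cvg; apply: (series_le_cvg _ _ _ cu) => n /=; [exact: normr_ge0|exact: normc_ge0|exact: vu].
have cR : cvgn (series (fun n => complex.Re (u n))) by apply: cmp => n; exact: ler_normRe.
have cI : cvgn (series (fun n => complex.Im (u n))) by apply: cmp => n; exact: ler_normIm.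
have := cvg_complex cR cI; set f := (X in X @ _ --> _) => h.
rewrite (_ : series u = f); first exact: cvgP (h _).
apply/funext => n; rewrite /f /series /=.
have -> : \sum_(0 <= k < n) complex.Re (u k) = complex.Re (\sum_(0 <= k < n) u k).
  by elim/big_rec2: _ => // i a b _ ->; rewrite -raddfD.
have -> : \sum_(0 <= k < n) complex.Im (u k) = complex.Im (\sum_(0 <= k < n) u k).
  by elim/big_rec2: _ => // i a b _ ->; rewrite -raddfD.
by move: (\sum_(0 <= k < n) u k) => -[].
Qed.

Lemma le_normc_lim {T : Type} {F : set_system T} {FF : ProperFilter F}
    (f : T -> C) (l : C) (b : R) :
  f x @[x --> F] --> l -> (\forall x \near F, normc (f x) <= b) -> normc l <= b.
Proof. by move=> /cvgc_normc h k; rewrite -(cvg_lim _ h) //; apply: limr_le => //; apply: cvgP h. Qed.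

End ComplexNorm.

(** * Dominated convergence for series *)

Section Tannery.
Variable R : realType.
Local Notation C := R[i].

Lemma cvg_series_stop (V : normedModType C) (u : nat -> V) n :
  (forall k, (n <= k)%N -> u k = 0) -> series u @ \oo --> \sum_(0 <= k < n) u k.
Proof.
move=> u0; apply: cvg_near_cst; near=> m.
have nm : (n <= m)%N by near: m; exact: nbhs_infty_ge.
rewrite /series /= (big_cat_nat (leq0n n) nm) /= [X in _ + X]big_nat_cond [X in _ + X]big1 ?addr0 //.
by move=> k /andP[/andP[nk _] _]; exact: u0.
Unshelve. all: by end_near. Qed.

Lemma series_tail_lt (g : nat -> R) (e : R) :
  cvgn (series g) -> 0 < e ->
  \forall K \near \oo, forall n, (K <= n)%N -> \sum_(K <= k < n) g k < e.
Proof.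
move=> cg e0; have e20 : 0 < e / 2 by rewrite divr_gt0.
move/cvgrPdist_lt : cg => /(_ _ e20) [K _ hK].
near=> K' => n K'n.
have KK' : (K <= K')%N by near: K'; exact: nbhs_infty_ge.
have h1 := hK _ KK'; have h2 := hK _ (leq_trans KK' K'n).
rewrite -sub_series_geq // (le_lt_trans (ler_norm _)) //.
rewrite (_ : series g n - _ = (limn (series g) - series g K') - (limn (series g) - series g n)); last by ring.
by rewrite (le_lt_trans (ler_normB _ _)) // (splitr e) ltrD.
Unshelve. all: by end_near. Qed.

Lemma le_normc_series_tail (f : nat -> C) (g : nat -> R) (l : C) K (e : R) :
  series f @ \oo --> l -> (forall k, (K <= k)%N -> normc (f k) <= g k) ->
  (forall n, (K <= n)%N -> \sum_(K <= k < n) g k < e) ->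
  normc (l - \sum_(0 <= k < K) f k) <= e.
Proof.
move=> fl fg ge.
have h : (series f n - series f K) @[n --> \oo] --> l - series f K.
  by apply: cvgB; [exact: fl|exact: cvg_cst].
apply: (le_normc_lim h); near=> n.
have Kn : (K <= n)%N by near: n; exact: nbhs_infty_ge.
rewrite sub_series_geq // (le_trans (le_normc_sum _ _ _)) //.
rewrite (le_trans _ (ltW (ge _ Kn))) // ler_sum_nat // => k /andP[Kk _].
exact: fg.
Unshelve. all: by end_near. Qed.

(** All later exchanges of a limit with a sum rest on this: Cauchy products, Lambert series, partial
    fractions and double series. The majorant is asked only from [k0] on, since finitely many terms
    converge one by one. *)
Lemma tannery (f : nat -> nat -> C) (g : nat -> R) (h s : nat -> C) (l : C) (k0 : nat) :
  (forall k, f N k @[N --> \oo] --> h k) ->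
  (\forall N \near \oo, forall k, (k0 <= k)%N -> normc (f N k) <= g k) ->
  cvgn (series g) ->
  (forall N, series (f N) @ \oo --> s N) -> series h @ \oo --> l ->
  s N @[N --> \oo] --> l.
Proof.
move=> fh fg cg fs hl; apply/cvgcP => e e0.
have e30 : 0 < e / 4 by rewrite divr_gt0.
have [K1 _ hK1] := series_tail_lt cg e30.
pose K := maxn k0 K1; have {hK1}hK := hK1 K (leq_maxr _ _).
have hg k : (k0 <= k)%N -> normc (h k) <= g k.
  move=> k0k; apply: (le_normc_lim (fh k)); apply: filterS fg => N; exact.
have h1 : normc (l - \sum_(0 <= k < K) h k) <= e / 4.
  apply: (le_normc_series_tail hl) hK => k Kk; apply: hg.
  by rewrite (leq_trans (leq_maxl _ _) Kk).
have h2 : \forall N \near \oo, normc (s N - \sum_(0 <= k < K) f N k) <= e / 4.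
  apply: filterS fg => N fgN; apply: (le_normc_series_tail (fs N)) hK => k Kk.
  by apply: fgN; rewrite (leq_trans (leq_maxl _ _) Kk).
have h3 : (\sum_(0 <= k < K) f N k) @[N --> \oo] --> \sum_(0 <= k < K) h k.
  elim: (K) => [|m IHm].
    rewrite (_ : (fun N => _) = cst 0); first by rewrite big_geq ?leqnn; [apply: cvg_cst|].
    by apply/funext => N; rewrite big_geq.
  rewrite (_ : (fun N => _) = (fun N => \sum_(0 <= k < m) f N k + f N m)); last first.
    by apply/funext => N; rewrite big_nat_recr.
  rewrite [X in _ --> X](big_nat_recr _ _ _ (leq0n m)) /=.
  by apply: cvgD; [exact: IHm|exact: fh].
move/cvgcP : h3 => /(_ _ e30) h3.
apply: filterS2 h2 h3 => N h2 h3.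
set S := \sum_(_ <= _ < _) f N _ in h2 h3; set H := \sum_(_ <= _ < _) h _ in h1 h3.
(* Two tails and one finite part, each at most e / 4. *)
rewrite (_ : l - s N = (l - H) + (H - S) - (s N - S)); last by ring.
rewrite (le_lt_trans (le_normcB _ _)) //.
have := le_normcD (l - H) (H - S); lra.
Qed.

Lemma cvg_series_dominated (f : nat -> C) (g : nat -> R) :
  cvgn (series g) -> (forall k, normc (f k) <= g k) -> cvgn (series f).
Proof.
move=> cg fg; apply: normc_cvg_series.
apply: (series_le_cvg _ _ _ cg) => n //; first exact: normc_ge0.
by rewrite (le_trans (normc_ge0 _) (fg _)).
Qed.

Lemma cvg_geometric_bound (M r : R) : 0 <= r -> r < 1 ->
  cvgn (series (fun n => M * r ^+ n)).
Proof. by move=> r0 r1; apply: is_cvg_geometric_series; rewrite ger0_norm. Qed.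

Lemma cvg_series_shift (V : normedModType C) (u : nat -> V) (l : V) :
  series u @ \oo --> l <-> series (fun n => u n.+1) @ \oo --> l - u 0%N.
Proof.
have E n : series (fun n => u n.+1) n = series u n.+1 - u 0%N.
  by rewrite /series /= [in RHS]big_nat_recl //= addrAC subrr add0r.
split=> h.
  rewrite (_ : series _ = (fun n => series u n.+1 - u 0%N)); last exact/funext.
  by apply: cvgB; [rewrite (cvg_shiftS (series u)); exact: h|exact: cvg_cst].
rewrite -(cvg_shiftS (series u)) -[l](subrK (u 0%N)).
rewrite (_ : (fun n => _) = (fun n => series (fun n => u n.+1) n + u 0%N)).
  by apply: cvgD; [exact: h|exact: cvg_cst].
by apply/funext => n; rewrite E subrK.
Qed.

End Tannery.

(** * Power series *)

Section PowerSeries.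
Variable R : realType.
Local Notation C := R[i].
Implicit Types (a b : nat -> C) (z w : C).

Lemma is_derive_of_quadratic (f : C -> C) (z l : C) (K d : R) : 0 < d ->
  (forall h, normc h < d -> normc (f (z + h) - f z - h * l) <= K * normc h ^+ 2) ->
  is_derive z 1 f l.
Proof.
move=> d0 H.
(* The sign of [K] follows from the hypothesis itself, tested at h = d / 2. *)
have K0 : 0 <= K.
  have d2 : normc (d / 2)%:C = d / 2 by rewrite normc_real ger0_norm // divr_ge0 ?ltW.
  have h := H (d / 2)%:C; rewrite d2 in h.
  have {}h := h ltac:(lra).
  have : 0 <= K * (d / 2) ^+ 2 by rewrite (le_trans _ h) // normc_ge0.
  by rewrite pmulr_lge0 // exprn_gt0 // divr_gt0.
have lim : h^-1 *: (f (h *: (1 : C) + z) - f z) @[h --> (0 : C)^'] --> l.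
  apply/cvgcP => e e0.
  have dd : 0 < Num.min d (e / (K + 1)).
    by rewrite lt_min d0 divr_gt0 // ltr_wpDl.
  exists ((Num.min d (e / (K + 1)))%:C); first by rewrite /= ltcR.
  move=> h /= hd h0; have {}hd : normc h < Num.min d (e / (K + 1)).
    by rewrite -ltcR -normrcE -(normrN h) -[- h]sub0r.
  move: hd; rewrite lt_min => /andP[hd he].
  have := H h hd; rewrite [h *: 1]mulr1 [h + z]addrC.
  rewrite (_ : l - _ = - (h^-1 * (f (z + h) - f z - h * l))); last first.
    by rewrite /GRing.scale /=; field.
  rewrite normcN normcM normcV.
  have nh : 0 < normc h by rewrite normc_gt0.
  move=> Hh; rewrite -ltr_pdivlMl ?invr_gt0 // invrK (le_lt_trans Hh) //.
  rewrite expr2 mulrA [normc h * e]mulrC ltr_pM2r //.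
  rewrite ltr_pdivlMr ?ltr_wpDl // in he.
  rewrite (le_lt_trans _ he) // mulrC ler_wpM2l ?normc_ge0 // lerDl //.
have dv : derivable f z 1 by apply/cvg_ex; exists l.
by apply: (DeriveDef dv); apply: cvg_lim lim.
Qed.

(* Equivalently, the power series with coefficients [a] converges in the open
   unit disc. *)
Definition slow (a : nat -> C) : Prop :=
  forall r : R, 0 < r -> r < 1 -> exists M, forall n, normc (a n) * r ^+ n <= M.

Definition psum (a : nat -> C) (z : C) : C :=
  limn (series (fun n => a n * z ^+ n)).

Lemma slow_geometric a (r : R) : slow a -> 0 <= r -> r < 1 ->
  exists M p : R, [/\ 0 <= M, 0 < p, p < 1 & forall n, normc (a n) * r ^+ n <= M * p ^+ n].
Proof.
move=> sa r0 r1; pose s := (r + 1) / 2.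
have s1 : s < 1 by rewrite /s; lra.
have s0 : 0 < s by rewrite /s; lra.
have [M hM] := sa s s0 s1.
have M0 : 0 <= M by rewrite (le_trans _ (hM 0%N)) // mulr_ge0 ?normc_ge0 ?exprn_ge0 ?ltW.
have rs : r < s by rewrite /s; lra.
(* The ratio is r / s; the maximum with 1 / 2 keeps it positive when r = 0. *)
pose p := Num.max (r / s) (1 / 2).
have rp : r <= s * p by rewrite -ler_pdivrMl // mulrC /p le_max lexx.
exists M, p; split=> //.
- by rewrite /p lt_max; apply/orP; right; lra.
- by rewrite /p gt_max ltr_pdivrMr // mul1r; apply/andP; split; lra.
move=> n; rewrite (le_trans (y := normc (a n) * (s ^+ n * p ^+ n))) //.
  by rewrite ler_wpM2l ?normc_ge0 // -exprMn lerXn2r // nnegrE // (le_trans r0 rp).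
rewrite mulrA ler_wpM2r // exprn_ge0 // /p le_max; apply/orP; right; lra.
Qed.

Lemma cvg_psum_term a (r : R) : slow a -> 0 <= r -> r < 1 ->
  cvgn (series (fun n => normc (a n) * r ^+ n)).
Proof.
move=> sa r0 r1; have [M [p [M0 p0 p1 h]]] := slow_geometric sa r0 r1.
have c := @cvg_geometric_bound R M p (ltW p0) p1.
apply: (series_le_cvg _ _ h c) => n /=.
  by rewrite mulr_ge0 ?normc_ge0 ?exprn_ge0.
by rewrite mulr_ge0 // exprn_ge0 // ltW.
Qed.

Lemma cvg_psum a z : slow a -> normc z < 1 ->
  series (fun n => a n * z ^+ n) @ \oo --> psum a z.
Proof.
move=> sa z1; apply: (cvg_series_dominated (cvg_psum_term sa (normc_ge0 z) z1)).
by move=> k; rewrite normcM normcX.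
Qed.

Lemma psum_unique a z l : series (fun n => a n * z ^+ n) @ \oo --> l -> psum a z = l.
Proof. by move=> h; apply: (cvg_lim _ h); exact: norm_hausdorff. Qed.

(** Abel's lemma: the terms of a series converging at z are bounded. Points of modulus close to 1
    suffice, which is all that an expansion on the upper half-plane provides. *)
Lemma slow_of_cvg a :
  (forall r : R, r < 1 -> exists z : C, [/\ r <= normc z, normc z <= 1 &
     cvgn (series (fun n => a n * z ^+ n))]) -> slow a.
Proof.
move=> H r r0 r1; have [z [rz z1 cz]] := H r r1.
have /cvgcP/(_ _ ltr01)[N _ hN] := cvg_series_cvg_0 cz.
exists (1 + \sum_(k < N) normc (a k)) => n.
have hr : normc (a n) * r ^+ n <= normc (a n * z ^+ n).
  rewrite normcM normcX ler_wpM2l ?normc_ge0 // lerXn2r ?nnegrE ?normc_ge0 //.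
  exact: ltW.
have [nN|Nn] := ltnP n N.
  rewrite (le_trans (y := normc (a n))) //.
    by rewrite ler_piMr ?normc_ge0 // exprn_ile1 // ltW.
  rewrite (bigD1 (Ordinal nN)) //= addrCA lerDl addr_ge0 // sumr_ge0 // => i _.
  exact: normc_ge0.
rewrite (le_trans hr) // (le_trans (y := 1)) //; last first.
  by rewrite lerDl sumr_ge0 // => i _; exact: normc_ge0.
by have := hN n Nn; rewrite sub0r normcN => /ltW.
Qed.

Lemma slowD a b : slow a -> slow b -> slow (fun n => a n + b n).
Proof.
move=> sa sb r r0 r1; have [M hM] := sa r r0 r1; have [M' hM'] := sb r r0 r1.
exists (M + M') => n; rewrite (le_trans _ (lerD (hM n) (hM' n))) //.
by rewrite -mulrDl ler_wpM2r ?le_normcD // exprn_ge0 // ltW.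
Qed.

Lemma slowZ (c : C) a : slow a -> slow (fun n => c * a n).
Proof.
move=> sa r r0 r1; have [M hM] := sa r r0 r1.
exists (normc c * M) => n; rewrite normcM -mulrA ler_wpM2l ?normc_ge0 //.
Qed.

(** Each of the n copies of p^n is at most one of 1, p, ..., p^(n-1), whose sum is below 1 / (1 -
    p). *)
Lemma mulr_nat_expr_bound (p : R) : 0 < p -> p < 1 ->
  exists M, forall n, n%:R * p ^+ n <= M.
Proof.
move=> p0 p1; exists (1 - p)^-1 => n.
rewrite -[leRHS]mul1r ler_pdivlMr ?subr_gt0 //.
have -> : n%:R * p ^+ n = \sum_(k < n) p ^+ n by rewrite sumr_const card_ord mulr_natl.
rewrite (le_trans (y := (\sum_(k < n) p ^+ k) * (1 - p))) //.
  apply: ler_wpM2r; first by rewrite subr_ge0 ltW.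
  apply: ler_sum => k _.
  by rewrite ler_wiXn2l // ?ltW // ltnW.
have := subrX1 p n; have : 0 <= p ^+ n by rewrite exprn_ge0 // ltW.
by set S := \sum_(_ < _) _; nra.
Qed.

Lemma slow_le a (b : nat -> C) : slow a -> (forall n, normc (b n) <= normc (a n)) -> slow b.
Proof.
move=> sa ba r r0 r1; have [M hM] := sa r r0 r1; exists M => n.
by rewrite (le_trans _ (hM n)) // ler_wpM2r // exprn_ge0 // ltW.
Qed.

Lemma slowMn a : slow a -> slow (fun n => n%:R * a n).
Proof.
move=> sa r r0 r1; have [M [p [M0 p0 p1 h]]] := slow_geometric sa (ltW r0) r1.
have [K hK] := mulr_nat_expr_bound p0 p1.
exists (M * K) => n; rewrite normcM normc_nat -mulrA.
rewrite (le_trans (ler_wpM2l (ler0n _ n) (h n))) // mulrCA ler_wpM2l //.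
Qed.

Lemma slow_shift a : slow a -> slow (fun n => a n.+1).
Proof.
move=> sa r r0 r1; have [M hM] := sa r r0 r1; exists (M / r) => n.
by rewrite ler_pdivlMr // -mulrA -exprSr.
Qed.

Lemma slow_unshift a : slow (fun n => a n.+1) -> slow a.
Proof.
move=> sa r r0 r1; have [M hM] := sa r r0 r1; exists (Num.max (normc (a 0%N)) M) => -[|n].
  by rewrite expr0 mulr1 le_max lexx.
rewrite le_max; apply/orP; right; rewrite (le_trans _ (hM n)) //.
by rewrite ler_wpM2l ?normc_ge0 // ler_wiXn2l // ltW.
Qed.

Definition cauchy_prod (a b : nat -> C) (n : nat) : C := \sum_(i < n.+1) a i * b (n - i)%N.

Lemma slow_cauchy_prod a b : slow a -> slow b -> slow (cauchy_prod a b).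
Proof.
move=> sa sb r r0 r1.
have [M [p [M0 p0 p1 h]]] := slow_geometric sa (ltW r0) r1.
have [M' [p' [M'0 p'0 p'1 h']]] := slow_geometric sb (ltW r0) r1.
pose s := Num.max p p'.
have s0 : 0 < s by rewrite /s lt_max p0.
have s1 : s < 1 by rewrite /s gt_max p1.
have [K hK] := mulr_nat_expr_bound s0 s1.
exists (M * M' * (K + 1)) => n.
rewrite (le_trans (y := \sum_(i < n.+1) M * M' * s ^+ n)) //.
  rewrite (le_trans (ler_wpM2r _ (le_normc_sum _ _ _))) ?exprn_ge0 ?(ltW r0) //.
  rewrite mulr_suml; apply: ler_sum => i _.
  have ni : (i <= n)%N by rewrite -ltnS.
  have E (x : R) : x ^+ n = x ^+ i * x ^+ (n - i) by rewrite -exprD subnKC.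
  rewrite normcM E mulrACA.
  rewrite (le_trans (ler_pM _ _ (h i) (h' (n - i)%N))) ?mulr_ge0 ?normc_ge0 ?exprn_ge0 ?(ltW r0) //.
  rewrite mulrACA E ler_wpM2l ?mulr_ge0 //.
  by rewrite ler_pM ?exprn_ge0 ?(ltW p0) ?(ltW p'0) // lerXn2r ?nnegrE ?(ltW p0) ?(ltW p'0) ?(ltW s0) // /s le_max lexx ?orbT.
rewrite sumr_const card_ord -mulrnAr ler_wpM2l ?mulr_ge0 // -mulr_natl.
rewrite -addn1 natrD mulrDl mul1r lerD // exprn_ile1 ?ltW //.
Qed.

Lemma psumD a b z : slow a -> slow b -> normc z < 1 ->
  psum (fun n => a n + b n) z = psum a z + psum b z.
Proof.
move=> sa sb z1; apply: psum_unique.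
rewrite (_ : series _ = (fun n => series (fun n => a n * z ^+ n) n + series (fun n => b n * z ^+ n) n)).
  by apply: cvgD; exact: cvg_psum.
by apply/funext => n; rewrite /series /= -big_split /=; apply: eq_bigr => i _; rewrite mulrDl.
Qed.

Lemma psumZ (c : C) a z : slow a -> normc z < 1 ->
  psum (fun n => c * a n) z = c * psum a z.
Proof.
move=> sa z1; apply: psum_unique.
rewrite (_ : series _ = (fun n => c * series (fun n => a n * z ^+ n) n)).
  by apply: cvgMl_tmp; exact: cvg_psum.
by apply/funext => n; rewrite /series /= mulr_sumr; apply: eq_bigr => i _; rewrite mulrA.
Qed.

Lemma psum_shift a z : slow a -> normc z < 1 ->
  psum a z = a 0%N + z * psum (fun n => a n.+1) z.
Proof.
move=> sa z1; apply: psum_unique; apply/cvg_series_shift.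
rewrite expr0 mulr1 addrAC subrr add0r.
rewrite (_ : series _ = (fun n => z * series (fun n => a n.+1 * z ^+ n) n)).
  by apply: cvgMl_tmp; apply: cvg_psum => //; exact: slow_shift.
apply/funext => n; rewrite /series /= mulr_sumr; apply: eq_bigr => i _.
by rewrite exprS mulrCA.
Qed.

Lemma psum_bounded a (r : R) : slow a -> r < 1 ->
  exists K, forall z, normc z <= r -> normc (psum a z) <= K.
Proof.
move=> sa r1; pose s := Num.max r 0.
have s0 : 0 <= s by rewrite /s le_max lexx orbT.
have s1 : s < 1 by rewrite /s gt_max r1 ltr01.
have c := cvg_psum_term sa s0 s1.
exists (limn (series (fun n => normc (a n) * s ^+ n))) => z zr.
have zs : normc z <= s by rewrite /s le_max zr.
apply: (le_normc_lim (cvg_psum sa (le_lt_trans zs s1))).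
apply: nearW => n; rewrite (le_trans (le_normc_sum _ _ _)) //.
rewrite (le_trans (y := series (fun n => normc (a n) * s ^+ n) n)) //.
  apply: ler_sum => k _; rewrite normcM normcX ler_wpM2l ?normc_ge0 //.
  by rewrite lerXn2r ?nnegrE ?normc_ge0.
apply: nondecreasing_cvgn_le => //; apply: nondecreasing_series => k _ _.
by rewrite mulr_ge0 ?normc_ge0 ?exprn_ge0.
Qed.

Lemma psumM a b z : slow a -> slow b -> normc z < 1 ->
  psum (cauchy_prod a b) z = psum a z * psum b z.
Proof.
move=> sa sb z1; apply: psum_unique.
pose B n := \sum_(0 <= j < n) b j * z ^+ j.
(* The partial sum of length N of the Cauchy product, grouped by the index of [a]: the k-th group
   contains a partial sum of [b] of length N - k. *)
pose f (N k : nat) := if (k < N)%N then a k * z ^+ k * B (N - k)%N else 0.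
have cb := cvg_psum sb z1.
have [K hK] : exists K, forall n, normc (B n) <= K.
  have c := cvg_psum_term sb (normc_ge0 z) z1.
  exists (limn (series (fun n => normc (b n) * normc z ^+ n))) => n.
  rewrite (le_trans (le_normc_sum _ _ _)) //.
  rewrite (le_trans (y := series (fun n => normc (b n) * normc z ^+ n) n)) //.
    by apply: ler_sum => k _; rewrite normcM normcX.
  apply: nondecreasing_cvgn_le => //; apply: nondecreasing_series => k _ _.
  by rewrite mulr_ge0 ?normc_ge0 ?exprn_ge0 ?normc_ge0.
apply: (@tannery R f (fun k => normc (a k) * normc z ^+ k * K) (fun k => a k * z ^+ k * psum b z) _ _ 0%N).
- move=> k; have : (a k * z ^+ k * B (N - k)%N) @[N --> \oo] --> a k * z ^+ k * psum b z.
    apply: cvgMl_tmp; rewrite -(cvg_shiftn k) /=.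
    by under eq_cvg do rewrite addnK; exact: cb.
  apply: cvg_trans; apply: near_eq_cvg; near=> N.
  by rewrite /f ifT //; near: N; exact: nbhs_infty_gt.
- apply: nearW => N k _; rewrite /f; case: ifP => _; last first.
    rewrite normc0 mulr_ge0 ?mulr_ge0 ?exprn_ge0 ?normc_ge0 //.
    by rewrite (le_trans (normc_ge0 _) (hK 0%N)).
  by rewrite !normcM normcX ler_wpM2l // mulr_ge0 ?exprn_ge0 ?normc_ge0.
- rewrite (_ : (fun k => _) = (fun k => K * (normc (a k) * normc z ^+ k))); last by apply/funext => k; rewrite mulrC.
  by apply: is_cvg_seriesZ; exact: (cvg_psum_term sa (normc_ge0 z) z1).
- move=> N; rewrite (_ : \sum_(0 <= k < N) cauchy_prod a b k * z ^+ k = \sum_(0 <= k < N) f N k).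
    by apply: cvg_series_stop => k Nk; rewrite /f ltnNge Nk.
  rewrite !big_mkord.
  under eq_bigr do rewrite /cauchy_prod mulr_suml.
  under [RHS]eq_bigr => i _ do rewrite /f ltn_ord /B big_mkord mulr_sumr.
  rewrite (eq_bigr (fun n : 'I_N => \sum_(i < N | (i <= n)%N) a i * b (n - i)%N * z ^+ n)); last first.
    move=> n _; rewrite (big_ord_widen N (fun i => a i * b (n - i)%N * z ^+ n)) //.
  rewrite (exchange_big_dep predT) //=; apply: eq_bigr => i _.
  rewrite -(big_mkord (fun j => i <= j)%N (fun j => a i * b (j - i)%N * z ^+ j)).
  rewrite -(big_mkord predT (fun j => a i * z ^+ i * (b j * z ^+ j))).
  rewrite (big_cat_nat (leq0n i) (ltnW (ltn_ord i))) /= [X in X + _]big_nat_cond [X in X + _]big1 ?add0r; last first.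
    by move=> j /andP[/andP[_ ji] /=]; rewrite leqNgt ji.
  rewrite -{1}[nat_of_ord i]add0n big_addn.
  rewrite big_mkcond /= big_mkord [RHS]big_mkord; apply: eq_bigr => j _.
  by rewrite leq_addl addnK exprD; ring.
- rewrite (_ : series _ = (fun n => series (fun n => a n * z ^+ n) n * psum b z)).
    by apply: cvgMr_tmp; exact: cvg_psum.
  by apply/funext => n; rewrite /series /= mulr_suml.
Unshelve. all: by end_near. Qed.

(** The remainders satisfy R_(n+1) = (z + h) R_n + n z^(n-1) h^2; the factor n^2 closes the
    induction because n^2 + n <= (n + 1)^2. *)
Lemma expr_taylor_bound (z h : C) (r : R) n : 0 < r -> normc z <= r -> normc (z + h) <= r ->
  normc ((z + h) ^+ n - z ^+ n - n%:R * z ^+ n.-1 * h) <=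
  n%:R ^+ 2 * r ^+ n * (normc h / r) ^+ 2.
Proof.
move=> r0 zr wr; elim: n => [|n IHn].
  by rewrite !expr0 subrr !mul0r subrr normc0 expr0n /= !mul0r.
have -> : (z + h) ^+ n.+1 - z ^+ n.+1 - n.+1%:R * z ^+ n.+1.-1 * h =
   (z + h) * ((z + h) ^+ n - z ^+ n - n%:R * z ^+ n.-1 * h) + n%:R * z ^+ n.-1 * h ^+ 2.
  case: n {IHn} => [|n] /=; first by rewrite !expr0 !expr1; ring.
  by rewrite !exprS -addn1 natrD; ring.
rewrite (le_trans (le_normcD _ _)) //.
have h1 : normc (n%:R * z ^+ n.-1 * h ^+ 2) <= n%:R * r ^+ n.+1 * (normc h / r) ^+ 2.
  case: n {IHn} => [|n]; first by rewrite !mul0r normc0.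
  have -> : n.+1%:R * r ^+ n.+2 * (normc h / r) ^+ 2 = n.+1%:R * (r ^+ n * normc h ^+ 2).
    by rewrite (exprS _ n.+1) (exprS _ n); field; rewrite gt_eqF.
  rewrite [n.+1.-1]/= !normcM !normcX normc_nat -mulrA -expr2 ler_wpM2l //.
  by rewrite ler_wpM2r ?exprn_ge0 ?normc_ge0 // lerXn2r ?nnegrE ?normc_ge0 ?(ltW r0).
rewrite -natr1 (le_trans (lerD (_ : _ <= r * (n%:R ^+ 2 * r ^+ n * (normc h / r) ^+ 2)) h1)) //.
  by rewrite normcM ler_pM ?normc_ge0.
rewrite (exprS r n); have : 0 <= r * r ^+ n * (normc h / r) ^+ 2.
  by rewrite mulr_ge0 ?sqr_ge0 // mulr_ge0 ?exprn_ge0 // ltW.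
have : 0 <= n%:R :> R by [].
set x := n%:R; set y := r ^+ n; set t := (_ / r) ^+ 2; nra.
Qed.

Lemma le_normc_limn (u : nat -> C) (l : C) (b : R) :
  u @ \oo --> l -> (forall n, normc (u n) <= b) -> normc l <= b.
Proof. by move=> ul ub; apply: (le_normc_lim ul); apply: nearW. Qed.

Lemma slow_deriv a : slow a -> slow (fun n => n.+1%:R * a n.+1).
Proof. by move=> sa; apply: slow_shift (slowMn sa). Qed.

Lemma cvgB_series (u v : nat -> C) (l m : C) :
  series u @ \oo --> l -> series v @ \oo --> m ->
  series (fun n => u n - v n) @ \oo --> l - m.
Proof.
move=> ul vm; rewrite (_ : series _ = (fun n => series u n - series v n)).
  by apply: cvgB; [exact: ul|exact: vm].
by apply/funext => n; rewrite /series /= sumrB.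
Qed.

Lemma is_derive_psum a z : slow a -> normc z < 1 ->
  is_derive z 1 (psum a) (psum (fun n => n.+1%:R * a n.+1) z).
Proof.
(* Halfway between |z| and 1, so that |h| < (1 - |z|) / 2 keeps z + h in the disc of radius r. *)
move=> sa z1; pose r := (normc z + 1) / 2.
have r1 : r < 1 by rewrite /r; lra.
have z0 := normc_ge0 z.
have r0 : 0 < r by rewrite /r; lra.
have c : cvgn (series (fun n => normc (n%:R * (n%:R * a n)) * r ^+ n)).
  by apply: cvg_psum_term => //; [do 2 apply: slowMn|exact: ltW].
set K := limn _ in c.
apply: (@is_derive_of_quadratic _ _ _ (K / r ^+ 2) ((1 - normc z) / 2)); first lra.
move=> h hd.
have zr : normc z <= r by rewrite /r; lra.
have wr : normc (z + h) <= r by rewrite (le_trans (le_normcD _ _)) // /r; lra.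
have w1 := le_lt_trans wr r1.
have d1 : series (fun n => n%:R * a n * z ^+ n.-1) @ \oo --> psum (fun n => n.+1%:R * a n.+1) z.
  apply/cvg_series_shift; rewrite !mul0r subr0 /=.
  by apply: cvg_psum => //; exact: slow_deriv.
have d2 : series (fun n => h * (n%:R * a n * z ^+ n.-1)) @ \oo --> h * psum (fun n => n.+1%:R * a n.+1) z.
  rewrite (_ : series _ = (fun n => h * series (fun n => n%:R * a n * z ^+ n.-1) n)).
    by apply: cvgMl_tmp; exact: d1.
  by apply/funext => n; rewrite /series /= mulr_sumr.
have d3 := cvgB_series (cvgB_series (cvg_psum sa w1) (cvg_psum sa z1)) d2.
apply: (le_normc_limn d3) => n.
rewrite (le_trans (le_normc_sum _ _ _)) //.
rewrite (le_trans (y := series (fun n => normc (n%:R * (n%:R * a n)) * r ^+ n) n * (normc h / r) ^+ 2)) //.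
  rewrite mulr_suml; apply: ler_sum => k _.
  rewrite (_ : _ - _ - _ = a k * ((z + h) ^+ k - z ^+ k - k%:R * z ^+ k.-1 * h)); last by ring.
  rewrite normcM !normcM !normc_nat.
  rewrite (le_trans (ler_wpM2l (normc_ge0 _) (expr_taylor_bound k r0 zr wr))) //.
  by rewrite le_eqVlt; apply/orP; left; apply/eqP; ring.
rewrite expr_div_n (_ : K / _ * _ = K * (normc h ^+ 2 / r ^+ 2)); last by ring.
rewrite ler_wpM2r ?mulr_ge0 ?invr_ge0 ?exprn_ge0 ?normc_ge0 ?(ltW r0) //.
apply: nondecreasing_cvgn_le => //; apply: nondecreasing_series => k _ _.
by rewrite mulr_ge0 ?normc_ge0 ?exprn_ge0 // ltW.
Qed.

(** Substitution of z^m for z on coefficients; it brings expansions at t, 2t and t/2 to the common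
    parameter exp(pi i t). *)
Definition spread (m : nat) a (n : nat) : C := if (m %| n)%N then a (n %/ m)%N else 0.

Lemma slow_spread m a : (0 < m)%N -> slow a -> slow (spread m a).
Proof.
move=> m0 sa r r0 r1.
have rm0 : 0 < r ^+ m by rewrite exprn_gt0.
have rm1 : r ^+ m < 1 by rewrite exprn_ilt1 // ?ltW // -lt0n.
have [M hM] := sa _ rm0 rm1; exists M => n; rewrite /spread; case: ifP => [|_].
  by move=> /divnK {2}<-; rewrite mulnC exprM.
by rewrite normc0 mul0r (le_trans _ (hM 0%N)) // mulr_ge0 ?normc_ge0 ?exprn_ge0 // ltW.
Qed.

Lemma psum_spread m a z : (0 < m)%N -> slow a -> normc z < 1 ->
  psum (spread m a) z = psum a (z ^+ m).
Proof.
move=> m0 sa z1.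
have zm : normc (z ^+ m) < 1 by rewrite normcX exprn_ilt1 ?normc_ge0 // -lt0n.
apply/esym/psum_unique.
have h := cvg_psum (slow_spread m0 sa) z1.
have := cvg_comp _ _ (cvg_mulnl _ m0) h; apply: cvg_trans; apply: near_eq_cvg; apply: nearW => n.
rewrite /series /=; elim: n => [|n IHn]; first by rewrite muln0 !big_geq.
rewrite mulnS addnC big_nat_recr //= -IHn (big_cat_nat (leq0n _) (leq_addr m (m * n)%N)) /=; congr (_ + _).
rewrite big_ltn; last by rewrite -[X in (X < _)%N]addn0 ltn_add2l.
rewrite {1}/spread dvdn_mulr // mulKn // exprM big_nat_cond big1 ?addr0 // => i.
move=> /andP[/andP[h1 h2] _]; rewrite /spread ifF ?mul0r //; apply/negP => /dvdnP[k ki].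
by have [kn|nk] := leqP k n; nia.
Qed.

End PowerSeries.

(** * The complex exponential and derivatives *)

Section Calculus.
Variable R : realType.
Local Notation C := R[i].
Implicit Types (z w : C).

(** Free of quotients, so that h = 0 is allowed and composition needs no case distinction. *)
Lemma is_derive_epsP (f : C -> C) z l :
  is_derive z 1 f l <-> forall e : R, 0 < e -> exists2 d : R, 0 < d &
    forall h, normc h < d -> normc (f (z + h) - f z - h * l) <= e * normc h.
Proof.
pose q (h : C) := h^-1 *: (f (h *: (1 : C) + z) - f z).
have E (h m : C) : h != 0 -> normc (f (z + h) - f z - h * m) = normc h * normc (m - q h).
  move=> h0; rewrite -normcM -normcN; congr normc.
  by rewrite /q /GRing.scale /= mulr1 [h + z]addrC; field.
split=> [[df <-] e e0|H].
  have lim : q h @[h --> (0 : C)^'] --> 'D_1 f z by exact: df.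
  move/cvgcP : lim => /(_ e e0) [d /= d0 hd].
  have [dI dR] : complex.Im d = 0 /\ 0 < complex.Re d.
    by move: d0; rewrite ltcE => /andP[/eqP].
  exists (complex.Re d) => // h hh; have [->|h0] := eqVneq h 0.
    by rewrite addr0 subrr mul0r subrr normc0 mulr0.
  rewrite E // mulrC ler_wpM2r ?normc_ge0 // ltW //; apply: hd => //=.
  by rewrite sub0r normrN normrcE ltcE /= dI eqxx.
have lim : q h @[h --> (0 : C)^'] --> l.
  apply/cvgcP => e e0; have [d d0 hd] := H (e / 2) (divr_gt0 e0 (ltr0Sn _ 1)).
  exists (d%:C); first by rewrite /= ltcR.
  move=> h /= hh h0.
  have {}hh : normc h < d by rewrite -ltcR -normrcE -(normrN h) -[- h]sub0r.
  have nh : 0 < normc h by rewrite normc_gt0.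
  have := hd h hh; rewrite E // mulrC ler_pM2r // => /le_lt_trans; apply; lra.
have dv : derivable f z 1 by apply/cvg_ex; exists l.
by apply: (DeriveDef dv); apply: cvg_lim lim.
Qed.

Lemma is_derive_compc (f g : C -> C) z l m :
  is_derive z 1 f l -> is_derive (f z) 1 g m -> is_derive z 1 (g \o f) (m * l).
Proof.
move=> /is_derive_epsP hf /is_derive_epsP hg; apply/is_derive_epsP => e e0.
have l0 := normc_ge0 l; have m0 := normc_ge0 m.
have a0 : 0 < e / 2 / (normc l + 1) by rewrite !divr_gt0 // ltr_wpDl.
have b0 : 0 < Num.min 1 (e / 2 / (normc m + 1)) by rewrite lt_min ltr01 !divr_gt0 // ltr_wpDl.
have [d1 d10 h1] := hg _ a0; have [d2 d20 h2] := hf _ b0.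
exists (Num.min d2 (d1 / (normc l + 1))); first by rewrite lt_min d20 divr_gt0 // ltr_wpDl.
move=> h; rewrite lt_min => /andP[hd2 hd1]; have nh := normc_ge0 h.
pose k := f (z + h) - f z; have k2 := h2 h hd2; rewrite -/k in k2.
have kb : normc k <= (normc l + 1) * normc h.
  rewrite -[k](subrK (h * l)) (le_trans (le_normcD _ _)) // normcM addrC mulrDl mul1r [normc l * _]mulrC lerD2l.
  by rewrite (le_trans k2) // ler_piMl // ge_min lexx.
have kd : normc k < d1.
  by rewrite (le_lt_trans kb) // -ltr_pdivlMl ?ltr_wpDl // mulrC.
have Ek : f z + k = f (z + h) by rewrite /k addrC subrK.
have := h1 k kd; rewrite Ek => k1.
rewrite /= (_ : _ - _ - _ = (g (f (z + h)) - g (f z) - k * m) + (k - h * l) * m); last by ring.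
rewrite (le_trans (le_normcD _ _)) // [normc (_ * m)]normcM [in leRHS](splitr e) [leRHS]mulrDl lerD //.
  rewrite (le_trans k1) // (le_trans (ler_wpM2l (ltW a0) kb)) // mulrA divfK //.
  by rewrite gt_eqF // ltr_wpDl.
rewrite (le_trans (ler_wpM2r m0 k2)) // mulrAC ler_wpM2r //.
rewrite (le_trans (y := e / 2 / (normc m + 1) * normc m)) //.
  by rewrite ler_wpM2r // ge_min lexx orbT.
rewrite mulrAC ler_pdivrMr ?ltr_wpDl // ler_wpM2l ?divr_ge0 ?(ltW e0) //.
by rewrite lerDl.
Qed.

Lemma is_derive_invc z : z != 0 -> is_derive z 1 (fun w => w^-1) (- z^-2).
Proof.
move=> z0; have nz : 0 < normc z by rewrite normc_gt0.
apply: (@is_derive_of_quadratic _ _ _ _ (2 / normc z ^+ 3) (normc z / 2)); first by rewrite divr_gt0.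
move=> h hz; have zh : normc z / 2 <= normc (z + h).
  by have := lB_normcD z h; lra.
have zh0 : z + h != 0 by rewrite -normc_gt0 (lt_le_trans _ zh) // divr_gt0.
rewrite (_ : _ - _ - _ = h ^+ 2 / (z ^+ 2 * (z + h))); last by field; rewrite z0 zh0.
rewrite normc_div (normcX h) (normcM (z ^+ 2)) (normcX z) mulrC ler_wpM2r ?exprn_ge0 ?normc_ge0 //.
rewrite (_ : 2 / _ = (normc z ^+ 2 * (normc z / 2))^-1); last by field; rewrite gt_eqF.
rewrite lef_pV2 ?posrE ?mulr_gt0 ?exprn_gt0 ?divr_gt0 ?normc_gt0 //.
by rewrite ler_wpM2l // exprn_ge0 // ltW.
Qed.

(** The real mean value theorem along the segment, applied to the real and the imaginary part; [p]
    below stands for either. *)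
Lemma is_derive0_segment (f : C -> C) z w :
  (forall t : R, 0 <= t <= 1 -> is_derive (z + t%:C * (w - z)) 1 f 0) -> f z = f w.
Proof.
move=> H.
have main (p : C -> R) : (forall u v : C, p (u - v) = p u - p v) ->
    (forall u, `|p u| <= normc u) -> p (f z) = p (f w).
  move=> pB pn; pose g (t : R) : R := p (f (z + t%:C * (w - z))).
  have dg (t : R) : 0 <= t <= 1 -> is_derive t (1 : R) g 0.
    move=> /H /is_derive_epsP ht.
    have lim : h^-1 *: (g (h *: (1 : R) + t) - g t) @[h --> (0 : R)^'] --> (0 : R).
      apply/cvgrPdist_lt => e e0.
      have n0 : 0 < normc (w - z) + 1 by rewrite ltr_wpDl // normc_ge0.
      have [d d0 hd] := ht (e / (normc (w - z) + 1)) (divr_gt0 e0 n0).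
      exists (d / (normc (w - z) + 1)); first by rewrite /= divr_gt0.
      move=> h /=; rewrite sub0r normrN => hh h0; rewrite sub0r normrN.
      have nh : 0 < `|h| by rewrite normr_gt0.
      have k0 : normc (h%:C * (w - z)) <= `|h| * (normc (w - z) + 1).
        by rewrite normcM normc_real ler_wpM2l // lerDl.
      have kd : normc (h%:C * (w - z)) < d.
        by rewrite (le_lt_trans k0) // -ltr_pdivlMr.
      rewrite /GRing.scale /= mulr1 normrM normfV -ltr_pdivlMl ?invr_gt0 // invrK.
      rewrite /g -pB (le_lt_trans (pn _)) //.
      have := hd _ kd; rewrite mulr0 subr0.
      have -> : z + t%:C * (w - z) + h%:C * (w - z) = z + (h + t)%:C * (w - z).
        by rewrite rmorphD /=; ring.
      move=> /le_lt_trans; apply.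
      rewrite normcM normc_real mulrCA ltr_pM2l // mulrAC ltr_pdivrMr // ltr_pM2l //.
      by rewrite ltrDl.
    have dv : derivable g t 1 by apply/cvg_ex; exists 0.
    by apply: (DeriveDef dv); apply: cvg_lim lim.
  have cg : {within `[(0 : R), 1], continuous g}.
    apply: derivable_within_continuous => t; rewrite in_itv /= => t01.
    by have [] := dg t t01.
  have [c _] := @MVT_segment R g (fun=> 0) 0 1 ler01 (fun t t01 => dg t ltac:(by move: t01; rewrite in_itv /= => /andP[/ltW -> /ltW ->])) cg.
  rewrite mul0r /g mul1r mul0r addr0 => /eqP; rewrite subr_eq0 => /eqP <-.
  by congr (p (f _)); rewrite addrC subrK.
apply/eqP; rewrite eq_complex; apply/andP; split; apply/eqP.
  by apply: main => [u v|u]; [rewrite raddfB|exact: ler_normRe].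
by apply: main => [u v|u]; [rewrite raddfB|exact: ler_normIm].
Qed.

Implicit Types x y : R.

Lemma cexpD z w : cexp (z + w) = cexp z * cexp w.
Proof.
case: z w => [a b] [c d]; rewrite /cexp /= expRD cosD sinD; simpc.
by congr (_ +i* _); ring.
Qed.

Lemma cexp0 : cexp 0 = 1 :> C.
Proof. by rewrite /cexp /= expR0 cos0 sin0 mulr1 mulr0. Qed.

Lemma normc_cexp z : normc (cexp z) = expR (complex.Re z).
Proof.
apply/eqP; rewrite -(@eqrXn2 _ 2) ?normc_ge0 ?expR_ge0 // sqr_normcE /cexp /=.
by rewrite !exprMn -mulrDr cos2Dsin2 mulr1.
Qed.

Lemma cexp_neq0 z : cexp z != 0.
Proof. by rewrite -normc_gt0 normc_cexp expR_gt0. Qed.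

Lemma cexpN z : cexp (- z) = (cexp z)^-1.
Proof.
apply: (mulIf (cexp_neq0 z)); rewrite mulVf ?cexp_neq0 //.
by rewrite -cexpD addNr cexp0.
Qed.

Lemma cexpMn n z : cexp (n%:R * z) = cexp z ^+ n.
Proof.
elim: n => [|n IHn]; first by rewrite mul0r cexp0.
by rewrite -natr1 mulrDl mul1r cexpD IHn exprSr.
Qed.

Lemma mvt0 (f df : R -> R) x : (forall t, is_derive t (1 : R) f (df t)) ->
  exists2 c, `|c| <= `|x| & f x - f 0 = df c * x.
Proof.
move=> h; have cf : continuous f.
  by move=> t; apply: differentiable_continuous; apply/derivable1_diffP; have [] := h t.
have [x0|x0] := leP 0 x.
  have [c] := @MVT_segment R f df 0 x x0 (fun t _ => h t) (continuous_subspaceT cf).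
  rewrite in_itv /= subr0 => /andP[c0 cx] E; exists c => //.
  by rewrite !ger0_norm.
have [c] := @MVT_segment R f df x 0 (ltW x0) (fun t _ => h t) (continuous_subspaceT cf).
rewrite in_itv /= sub0r => /andP[xc c0] E; exists c.
  by rewrite !ler0_norm ?lerN2 // ltW.
by rewrite -opprB E mulrN opprK.
Qed.

Lemma ler_norm_sin x : `|sin x| <= `|x|.
Proof.
have [c _] := @mvt0 sin cos x (fun t => is_derive_sin t).
rewrite sin0 subr0 => ->; rewrite normrM ler_piMl // ler_norml.
by rewrite cos_geN1 cos_le1.
Qed.

Lemma ler_norm_cosB1 x : `|cos x - 1| <= x ^+ 2.
Proof.
have [c cx] := @mvt0 cos (fun t => - sin t) x (fun t => is_derive_cos t).
rewrite cos0 => ->; rewrite normrM normrN -real_normK ?num_real // expr2.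
by rewrite ler_wpM2r // (le_trans (ler_norm_sin _)).
Qed.

Lemma ler_norm_sinB x : `|x| <= 1 -> `|sin x - x| <= x ^+ 2.
Proof.
move=> x1; have [c cx] := @mvt0 sin cos x (fun t => is_derive_sin t).
rewrite sin0 subr0 => ->; rewrite -{2}[x]mul1r -mulrBl normrM.
rewrite -[leRHS]real_normK ?num_real // expr2 ler_wpM2r //.
rewrite (le_trans (ler_norm_cosB1 _)) // -[leLHS]real_normK ?num_real // expr2.
by rewrite (le_trans (ler_pM _ _ cx cx)) // ler_piMl.
Qed.

Lemma ler_norm_expRB1 x : `|x| <= 1 -> `|expR x - 1| <= expR 1 * `|x|.
Proof.
move=> x1; have [c cx] := @mvt0 expR expR x (fun t => is_derive_expR t).
rewrite expR0 => ->; rewrite normrM ler_wpM2r // ger0_norm ?expR_ge0 //.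
by rewrite ler_expR (le_trans (ler_norm _)) // (le_trans cx).
Qed.

Lemma ler_norm_expRB x : `|x| <= 1 -> `|expR x - 1 - x| <= expR 1 * x ^+ 2.
Proof.
move=> x1; have [c cx] := @mvt0 expR expR x (fun t => is_derive_expR t).
rewrite expR0 => ->; rewrite -{2}[x]mul1r -mulrBl normrM.
rewrite (_ : x ^+ 2 = `|x| * `|x|); last by rewrite -expr2 real_normK ?num_real.
rewrite mulrA ler_wpM2r //.
rewrite (le_trans (ler_norm_expRB1 _)) ?(le_trans cx) // ler_wpM2l ?expR_ge0 //.
Qed.

Lemma is_derive_cexp z : is_derive z 1 (@cexp R) (cexp z).
Proof.
pose E : R := expR 1; have E0 : 0 < E by exact: expR_gt0.
pose K := 2 * E + 2 + E.
apply: (@is_derive_of_quadratic _ _ _ _ (normc (cexp z) * (3 * E + 4 + E)) 1) => // h h1.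
rewrite cexpD (_ : _ - _ - _ = cexp z * (cexp h - 1 - h)); last by ring.
rewrite normcM -mulrA ler_wpM2l ?normc_ge0 //.
have hR := ler_normRe h; have hI := ler_normIm h.
case: h h1 hR hI => x y; set n := normc _ => n1 xn yn; rewrite /= in xn yn.
have x1 : `|x| <= 1 by lra. have y1 : `|y| <= 1 by lra.
have n0 : 0 <= n by exact: normc_ge0.
have x2 : x ^+ 2 <= n ^+ 2 by rewrite -real_normK ?num_real // lerXn2r ?nnegrE.
have y2 : y ^+ 2 <= n ^+ 2 by rewrite -real_normK ?num_real // lerXn2r ?nnegrE.
rewrite (le_trans (ler_normc_ReIm _)) //= subr0.
have a1 := ler_norm_expRB x1; have a2 := ler_norm_expRB1 x1.
have a3 := ler_norm_cosB1 y; have a4 := ler_norm_sinB y1.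
have eE : `|expR x| <= E by rewrite ger0_norm ?expR_ge0 // ler_expR (le_trans (ler_norm _)).
have b1 : `|expR x * cos y - 1 - x| <= E * n ^+ 2 + E * n ^+ 2.
  rewrite (_ : _ - _ - _ = expR x * (cos y - 1) + (expR x - 1 - x)); last by ring.
  rewrite (le_trans (ler_normD _ _)) // lerD //; last by rewrite (le_trans a1) // ler_pM2l.
  by rewrite normrM ler_pM // (le_trans a3).
have b2 : `|expR x * sin y - y| <= E * n ^+ 2 + E * n ^+ 2.
  rewrite (_ : _ - _ = expR x * (sin y - y) + (expR x - 1) * y); last by ring.
  rewrite (le_trans (ler_normD _ _)) // !normrM lerD //; first by rewrite ler_pM // (le_trans a4).
  rewrite expr2 mulrA; apply: ler_pM => //.
  by rewrite (le_trans a2) // ler_pM2l.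
have := sqr_ge0 n; nra.
Qed.

End Calculus.

(** * Calculus on the upper half-plane *)

Section UpperHalfPlaneCalculus.
Variable R : realType.
Local Notation C := R[i].
Local Notation H := (uhp R).
Implicit Types (z w : C) (t : H) (f g : H -> C).

Definition e2pi z : C := cexp (two_pi_i R * z).

Lemma e2piD z w : e2pi (z + w) = e2pi z * e2pi w.
Proof. by rewrite /e2pi mulrDr cexpD. Qed.

Lemma e2pi0 : e2pi 0 = 1.
Proof. by rewrite /e2pi mulr0 cexp0. Qed.

Lemma e2piN z : e2pi (- z) = (e2pi z)^-1.
Proof. by rewrite /e2pi mulrN cexpN. Qed.

Lemma e2pi_neq0 z : e2pi z != 0.
Proof. exact: cexp_neq0. Qed.

Lemma e2piMn n z : e2pi (n%:R * z) = e2pi z ^+ n.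
Proof. by rewrite /e2pi mulrCA cexpMn. Qed.

Lemma e2pi1 : e2pi 1 = 1.
Proof.
rewrite /e2pi mulr1 /cexp /two_pi_i /= expR0 !mul1r mulr_natl cos2pi sin2pi.
by [].
Qed.

Lemma e2pi_nat n : e2pi n%:R = 1.
Proof. by rewrite -[n%:R]mulr1 e2piMn e2pi1 expr1n. Qed.

Lemma e2pi_int (m : int) : e2pi m%:~R = 1.
Proof.
case: m => n; first exact: e2pi_nat.
by rewrite NegzE mulrNz e2piN -[X in e2pi X]pmulrn e2pi_nat invr1.
Qed.

Lemma two_pi_iE z : two_pi_i R * z =
  Complex (- (2 * pi) * complex.Im z) (2 * pi * complex.Re z).
Proof. by case: z => x y; rewrite /two_pi_i; simpc. Qed.

Lemma two_pi_i_neq0 : two_pi_i R != 0.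
Proof. by rewrite eq_complex /= eqxx /= mulf_neq0 // gt_eqF // pi_gt0. Qed.

Lemma normc_e2pi z : normc (e2pi z) = expR (- (2 * pi) * complex.Im z).
Proof. by rewrite /e2pi normc_cexp two_pi_iE. Qed.

Lemma e2pi_eq1 z : e2pi z = 1 -> exists m : int, z = m%:~R.
Proof.
move=> z1; have pi0 : 0 < pi :> R := pi_gt0 R.
have Iz : complex.Im z = 0.
  have E : expR (- (2 * pi) * complex.Im z) = expR 0 by rewrite -normc_e2pi z1 normc1 expR0.
  have /eqP := expR_inj E.
  by rewrite mulf_eq0 oppr_eq0 mulf_eq0 pnatr_eq0 /= gt_eqF //= => /eqP.
pose m := Num.floor (complex.Re z); exists m.
pose x : R := complex.Re z - m%:~R.
have x0 : 0 <= x by rewrite subr_ge0 floor_le.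
have x1 : x < 1 by have := @floorD1_gt R (complex.Re z); rewrite intrD -/m /x; lra.
have zE : z = m%:~R + x%:C.
  rewrite rmorphB /= (_ : (m%:~R)%:C = m%:~R); last by rewrite rmorph_int.
  by rewrite addrC subrK [LHS]complexE Iz mulr0 addr0.
have : e2pi x%:C = 1 by move: z1; rewrite zE e2piD e2pi_int mul1r.
rewrite /e2pi two_pi_iE /cexp /= mulr0 expR0 !mul1r => -[cx _].
(* Cosine is injective on [0, pi] only, so beyond 1/2 the argument is made with 1 - x. *)
have [x2|x2] := leP x (2^-1).
  have : 2 * pi * x = 0.
    apply: cos_inj; rewrite ?cos0 // in_itv /=; apply/andP; split; nra.
  move=> /eqP; rewrite !mulf_eq0 pnatr_eq0 /= gt_eqF //= => /eqP x00.
  by rewrite zE x00 addr0.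
have : 2 * pi * (1 - x) = 0.
  apply: cos_inj; rewrite ?cos0 ?in_itv /=; try (apply/andP; split; nra).
  rewrite mulrBr mulr1 mulr_natl cosB cos2pi sin2pi mul0r addr0 mul1r -mulr_natl.
  exact: cx.
move=> /eqP; rewrite !mulf_eq0 pnatr_eq0 /= gt_eqF //= subr_eq0 => /eqP x11.
by move: x1; rewrite -x11 ltxx.
Qed.

Lemma is_derive_e2pi z : is_derive z 1 e2pi (two_pi_i R * e2pi z).
Proof.
rewrite mulrC; apply: (@is_derive_compc _ (fun w => two_pi_i R * w) (@cexp R)).
  apply/is_derive_epsP => e e0; exists 1 => // h _.
  by rewrite (_ : _ - _ - _ = 0) ?normc0 ?mulr_ge0 ?normc_ge0 ?(ltW e0) //; ring.
exact: is_derive_cexp.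
Qed.

Lemma uhp_Im t : 0 < complex.Im (val t).
Proof. by case: t. Qed.

Lemma uhp_neq0 t : val t != 0.
Proof. by apply/eqP => t0; have := uhp_Im t; rewrite t0 ltxx. Qed.

Definition mkuhp (z : C) (z0 : 0 < complex.Im z) : H := exist _ z z0.

Lemma ext0_val f t : ext0 f (val t) = f t.
Proof. by rewrite /ext0 valK. Qed.

Lemma ext0_mkuhp f z (z0 : 0 < complex.Im z) : ext0 f z = f (mkuhp z0).
Proof. by rewrite -ext0_val. Qed.

Lemma uhp_ball t (h : C) : normc h < complex.Im (val t) -> 0 < complex.Im (val t + h).
Proof.
move=> hh; rewrite raddfD; have := ler_normIm h; rewrite ler_norml => /andP[h1 _].
by rewrite /=; move: hh h1 => /=; lra.
Qed.

(** The derivative is carried as an explicit function, so that it can be computed along with the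
    function and adjusted by [has_deriv_eq]. *)
Definition has_deriv f (f' : H -> C) : Prop :=
  forall t, is_derive (val t : C) 1 (ext0 f) (f' t).

Lemma has_deriv_holomorphic f f' : has_deriv f f' -> holomorphic f.
Proof. by move=> h t; have [] := h t. Qed.

Lemma holomorphic_has_deriv f : holomorphic f ->
  has_deriv f (fun t => 'D_1 (ext0 f) (val t : C)).
Proof. by move=> h t; apply: DeriveDef. Qed.

Lemma has_deriv_derive1 f f' t : has_deriv f f' -> derive1 (ext0 f) (val t : C) = f' t.
Proof. by move=> /(_ t) h; rewrite derive1E derive_val. Qed.

Lemma has_deriv_epsP f f' : has_deriv f f' <->
  forall t (e : R), 0 < e -> exists2 d : R, 0 < d & forall s : H,
    normc (val s - val t) < d ->
    normc (f s - f t - (val s - val t) * f' t) <= e * normc (val s - val t).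
Proof.
split=> [hf t e e0|hf t].
  have /is_derive_epsP/(_ e e0)[d d0 hd] := hf t; exists d => // s /hd.
  by rewrite [val t + _]addrC subrK !ext0_val.
apply/is_derive_epsP => e e0; have [d d0 hd] := hf t e e0.
exists (Num.min d (complex.Im (val t))); first by rewrite lt_min d0 uhp_Im.
move=> h; rewrite lt_min => /andP[h1 h2].
have := hd (mkuhp (uhp_ball h2)); rewrite /= addrAC subrr add0r => /(_ h1).
by rewrite (ext0_mkuhp _ (uhp_ball h2)) ext0_val.
Qed.

Lemma has_deriv_of (g : C -> C) f' :
  (forall t, is_derive (val t : C) 1 g (f' t)) -> has_deriv (fun t => g (val t)) f'.
Proof.
move=> hg; apply/has_deriv_epsP => t e e0.
have /is_derive_epsP/(_ e e0)[d d0 hd] := hg t; exists d => // s /hd.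
by rewrite [val t + _]addrC subrK.
Qed.

Lemma has_deriv_compl f f' (g : C -> C) g' :
  has_deriv f f' -> (forall t, is_derive (f t) 1 g (g' t)) ->
  has_deriv (fun t => g (f t)) (fun t => g' t * f' t).
Proof.
move=> hf hg t.
apply: (@near_eq_is_derive _ _ _ (g \o ext0 f)).
  exists (complex.Im (val t))%:C => /=; first by rewrite ltcR uhp_Im.
  move=> z /=; rewrite normrcE ltcR => zt.
  have z0 : 0 < complex.Im z by rewrite -[z](addrNK (val t)) addrC uhp_ball // normcB.
  by rewrite !(ext0_mkuhp _ z0).
by apply: is_derive_compc; [exact: hf|rewrite ext0_val].
Qed.

Lemma has_derivD f f' g g' : has_deriv f f' -> has_deriv g g' ->
  has_deriv (fun t => f t + g t) (fun t => f' t + g' t).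
Proof.
move=> hf hg t; rewrite (_ : ext0 _ = ext0 f + ext0 g).
  by apply: is_deriveD; [exact: hf|exact: hg].
by apply/funext => z; rewrite /ext0 /GRing.add /=; case: insub => //=; rewrite addr0.
Qed.

Lemma has_derivM f f' g g' : has_deriv f f' -> has_deriv g g' ->
  has_deriv (fun t => f t * g t) (fun t => f t * g' t + f' t * g t).
Proof.
move=> hf hg t; rewrite (_ : ext0 _ = ext0 f * ext0 g).
  apply: (is_derive_eq (is_deriveM (hf t) (hg t))).
  by rewrite !ext0_val /GRing.scale /= [_ * f' t]mulrC.
by apply/funext => z; rewrite /ext0 /GRing.mul /=; case: insub => //=; rewrite mulr0.
Qed.

Lemma has_deriv_cst (c : C) : has_deriv (fun=> c) (fun=> 0).
Proof. by apply: (@has_deriv_of (fun=> c)) => t; exact: is_derive_cst. Qed.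

Lemma has_deriv_id : has_deriv (fun t => val t) (fun=> 1).
Proof. by apply: (@has_deriv_of id) => t; exact: is_derive_id. Qed.

Lemma has_deriv_eq f f' g g' : has_deriv f f' -> f =1 g -> f' =1 g' -> has_deriv g g'.
Proof. by move=> h /funext <- /funext <-. Qed.

Lemma has_derivZ (c : C) f f' : has_deriv f f' ->
  has_deriv (fun t => c * f t) (fun t => c * f' t).
Proof.
move=> hf; apply: (has_deriv_eq (has_derivM (has_deriv_cst c) hf)) => // t.
by rewrite mul0r addr0.
Qed.

Lemma has_deriv_sum n (f f' : 'I_n -> H -> C) : (forall i, has_deriv (f i) (f' i)) ->
  has_deriv (fun t => \sum_i f i t) (fun t => \sum_i f' i t).
Proof.
elim: n f f' => [|n IHn] f f' hf.
  by apply: (has_deriv_eq (has_deriv_cst 0)) => t; rewrite big_ord0.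
apply: (has_deriv_eq (has_derivD (hf ord0) (IHn _ _ (fun i => hf (lift ord0 i))))) => t;
  by rewrite [RHS]big_ord_recl.
Qed.

Lemma has_derivX f f' n : has_deriv f f' ->
  has_deriv (fun t => f t ^+ n) (fun t => n%:R * f t ^+ n.-1 * f' t).
Proof.
move=> hf; elim: n => [|n IHn].
  by apply: (has_deriv_eq (has_deriv_cst 1)) => t; rewrite ?expr0 ?mul0r.
apply: (has_deriv_eq (has_derivM hf IHn)) => t; rewrite ?exprS //=.
by case: n {IHn} => [|n] /=; rewrite ?exprS ?mulrS; ring.
Qed.

Lemma has_derivV f f' : (forall t, f t != 0) -> has_deriv f f' ->
  has_deriv (fun t => (f t)^-1) (fun t => - f' t / f t ^+ 2).
Proof.
move=> f0 hf.
apply: (has_deriv_eq (has_deriv_compl hf (fun t => is_derive_invc (f0 t)))) => // t.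
by rewrite mulrC mulrN mulNr.
Qed.

Lemma has_derivXz f f' (k : int) : (forall t, f t != 0) -> has_deriv f f' ->
  has_deriv (fun t => f t ^ k) (fun t => k%:~R * f t ^ (k - 1) * f' t).
Proof.
move=> f0 hf; case: k => n.
  apply: (has_deriv_eq (has_derivX n hf)) => // t.
  case: n => [|n]; first by rewrite !mul0r.
  by rewrite (_ : n.+1%:Z - 1 = n%:Z) //; lia.
have hV := has_derivX n.+1 (has_derivV f0 hf).
have EV m t : f t ^ Negz m = ((f t) ^+ m.+1)^-1 by [].
apply: (has_deriv_eq hV) => t; first by rewrite EV exprVn.
rewrite (_ : Negz n - 1 = Negz n.+1) ?EV; last by rewrite !NegzE; lia.
rewrite (_ : (Negz n)%:~R = - n.+1%:R :> C); last by rewrite NegzE mulrNz.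
rewrite exprVn !exprS /=; have ft := f0 t.
by field; rewrite ft expf_neq0.
Qed.

Lemma segment_uhp t (s : H) (x : R) : 0 <= x <= 1 -> 0 < complex.Im (val t + x%:C * (val s - val t)).
Proof.
move=> /andP[x0 x1]; have := uhp_Im t; have := uhp_Im s.
case: (val t) (val s) => [a b] [c d] /=; rewrite mul0r addr0 => d0 b0; nra.
Qed.

(** The upper half-plane is convex. *)
Lemma has_deriv0_cst f : has_deriv f (fun=> 0) -> forall s t, f s = f t.
Proof.
move=> hf s t; rewrite -(ext0_val f s) -(ext0_val f t).
apply: is_derive0_segment => x x01.
have := hf (mkuhp (segment_uhp s t x01)); exact.
Qed.

End UpperHalfPlaneCalculus.

(** * Partial fractions of the cotangent *)

Section PartialFractions.
Variable R : realType.
Local Notation C := R[i].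
Implicit Types (a b z w : C).

(* Series over Z are summed by their symmetric partial sums over |k| <= n. *)
Definition zfold (t : int -> C) (k : nat) : C :=
  if k is j.+1 then t j.+1%:Z + t (- j.+1%:Z) else t 0.

Definition zsum (t : int -> C) (l : C) : Prop := series (zfold t) @ \oo --> l.

(** A symmetric range has 2M + 1 consecutive integers, a full set of residues modulo 2M + 1: this is
    where sums over roots of unity enter. *)
Lemma zfold_sum (t : int -> C) M :
  \sum_(0 <= k < M.+1) zfold t k = \sum_(i < M.*2.+1) t (i%:Z - M%:Z).
Proof.
elim: M => [|M IHM]; first by rewrite big_nat1 big_ord1 subr0.
rewrite big_nat_recr //= IHM doubleS [RHS]big_ord_recl [in RHS]big_ord_recr /=.
rewrite addrA addrC; congr (_ + (_ + _)).
- by congr t; lia.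
- by apply: eq_bigr => i _; congr t; rewrite /bump /=; lia.
- by congr t; rewrite /bump /=; lia.
Qed.

Lemma zsum_unique t l m : zsum t l -> zsum t m -> l = m.
Proof.
by move=> h1 h2; rewrite -(cvg_lim (@norm_hausdorff _ _) h1) -(cvg_lim (@norm_hausdorff _ _) h2).
Qed.

Lemma zsumD t s l m : zsum t l -> zsum s m -> zsum (fun k => t k + s k) (l + m).
Proof.
move=> h1 h2; rewrite /zsum (_ : series _ = (fun n => series (zfold t) n + series (zfold s) n)).
  by apply: cvgD; [exact: h1|exact: h2].
apply/funext => n; rewrite /series /= -big_split /=; apply: eq_bigr => -[|k] _ //=.
by rewrite addrACA.
Qed.

Lemma zsumZ (c : C) t l : zsum t l -> zsum (fun k => c * t k) (c * l).
Proof.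
move=> h1; rewrite /zsum (_ : series _ = (fun n => c * series (zfold t) n)).
  by apply: cvgMl_tmp; exact: h1.
apply/funext => n; rewrite /series /= mulr_sumr; apply: eq_bigr => -[|k] _ //=.
by rewrite mulrDr.
Qed.

Lemma zsumB t s l m : zsum t l -> zsum s m -> zsum (fun k => t k - s k) (l - m).
Proof.
move=> h1 h2; have := zsumD h1 (@zsumZ (-1) s m h2); rewrite mulN1r.
by congr zsum; apply/funext => k; rewrite mulN1r.
Qed.

(** A summable majorant comparable to 1/k^2 that also serves k = 0. *)
Definition usq (k : nat) : R := (1 + k%:R ^+ 2)^-1.

Lemma usq_gt0 k : 0 < usq k.
Proof. by rewrite invr_gt0 ltr_wpDr // exprn_ge0. Qed.

(** The term at x + 1 is below 1 / ((x + 1)^2 - 1/4) = 1 / (x + 1/2) - 1 / (x + 3/2), which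
    telescopes. *)
Lemma cvg_usq : cvgn (series usq).
Proof.
apply: nondecreasing_is_cvgn; first by apply: nondecreasing_series => n _ _; exact: ltW (usq_gt0 n).
exists 3 => _ [n _ <-].
have : series usq n.+1 <= 3 - (n%:R + 2^-1)^-1.
  elim: n => [|n IHn].
    by rewrite /series /= big_nat1 /usq expr0n addr0 add0r !invr1 invrK; lra.
  rewrite /series /= big_nat_recr //= -lerBrDr (le_trans IHn) //.
  rewrite lerBrDr -lerBrDl opprB addrC subrKA /usq.
  have n0 : 0 <= n%:R :> R by [].
  rewrite -[n.+1%:R]natr1; set x := n%:R in n0 *.
  have -> : (x + 2^-1)^-1 - (x + 1 + 2^-1)^-1 = ((x + 1) ^+ 2 - 4^-1)^-1.
    by field; rewrite !gt_eqF //; nra.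
  by rewrite lef_pV2 ?posrE; nra.
move=> h; rewrite (le_trans (y := series usq n.+1)) //.
  rewrite /series /= big_nat_recr //= lerDl; exact: ltW (usq_gt0 n).
by rewrite (le_trans h) // lerBlDr lerDl invr_ge0 addr_ge0.
Qed.

Lemma sum_roots_of_unity (n j : nat) : (0 < j)%N -> (j < n)%N ->
  \sum_(k < n) (e2pi (k%:R / n%:R : C)) ^+ j = 0.
Proof.
move=> j0 jn; have n0 : n%:R != 0 :> C by rewrite pnatr_eq0 -lt0n (leq_trans _ jn).
have E (k : nat) : (e2pi (k%:R / n%:R : C)) ^+ j = (e2pi (j%:R / n%:R : C)) ^+ k.
  by rewrite -!e2piMn; congr e2pi; field.
under eq_bigr do rewrite E.
set x := e2pi _; have x1 : x != 1.
  apply/eqP => /e2pi_eq1[m] h.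
  have : (j%:Z)%:~R = (m * n%:Z)%:~R :> C by rewrite intrM -h mulfVK.
  move/eqP; rewrite eqr_int => /eqP; case: m {h} => m; last by rewrite NegzE; nia.
  by move=> [] jE; move: j0 jn; rewrite jE; case: m {jE} => // m; nia.
have xn : x ^+ n = 1 by rewrite -e2piMn mulrC divfK // e2pi_nat.
have /eqP := subrX1 x n; rewrite xn subrr eq_sym mulf_eq0 subr_eq0 (negPf x1) /=.
by move/eqP.
Qed.

Lemma sum_over_roots (n : nat) (c : nat -> C) w : (0 < n)%N ->
  \sum_(k < n) \sum_(j < n) c j * (e2pi (k%:R / n%:R) * w) ^+ j = n%:R * c 0%N.
Proof.
case: n => // n _; rewrite exchange_big /= big_ord_recl /=.
rewrite (eq_bigr (fun=> c 0%N)); last by move=> k _; rewrite expr0 mulr1.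
rewrite sumr_const card_ord mulr_natl big1 ?addr0 // => j _.
rewrite (eq_bigr (fun k : 'I_n.+1 => c (lift ord0 j) * w ^+ (lift ord0 j) * e2pi (k%:R / n.+1%:R) ^+ (lift ord0 j))).
  by rewrite -mulr_sumr sum_roots_of_unity ?mulr0.
by move=> k _; rewrite exprMn [X in _ * X]mulrC mulrA.
Qed.

(* Up to constants, [phi] is the cotangent of pi z and [kap] its derivative. *)
Definition phi z : C := (1 - e2pi z)^-1.
Definition kap z : C := e2pi z / (1 - e2pi z) ^+ 2.

(** On the n-th roots x of e2pi(a), 1 / (1 - x) is the polynomial (1 + x + ... + x^(n-1)) / (1 -
    e2pi(a)); summing over the roots keeps n times its constant coefficient. *)
Lemma sum_phi (n : nat) a : (0 < n)%N -> e2pi a != 1 ->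
  \sum_(k < n) phi ((a + k%:R) / n%:R) = n%:R * phi a.
Proof.
move=> n0 a1; have nn : n%:R != 0 :> C by rewrite pnatr_eq0 -lt0n.
pose w := e2pi (a / n%:R).
have wn : w ^+ n = e2pi a by rewrite -e2piMn mulrC divfK.
rewrite -(@sum_over_roots n (fun=> phi a) w n0); apply: eq_bigr => k _.
rewrite -mulr_sumr; have -> : e2pi (k%:R / n%:R) * w = e2pi ((a + k%:R) / n%:R).
  by rewrite -e2piD -mulrDl [a + _]addrC.
set x := e2pi _.
have xn : x ^+ n = e2pi a by rewrite -e2piMn mulrC divfK // e2piD e2pi_nat mulr1.
have x1 : x != 1 by apply: contra_neq a1 => x1; rewrite -xn x1 expr1n.
rewrite /phi -/x -xn; have := subrX1 x n; set S := \sum_(_ < _) _ => E.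
have xn1 : 1 - x ^+ n != 0 by rewrite subr_eq0 eq_sym xn.
have x10 : 1 - x != 0 by rewrite subr_eq0 eq_sym.
apply: (mulfI xn1); rewrite mulVKf //; apply: (mulIf x10); rewrite divfK //.
by rewrite -[LHS]opprB E; ring.
Qed.

Lemma sum_muln_expr (x : C) (m : nat) :
  (\sum_(j < m.+1) j%:R * x ^+ j) * (1 - x) ^+ 2 =
  x - m.+1%:R * x ^+ m.+1 + m%:R * x ^+ m.+2 :> C.
Proof.
elim: m => [|m IHm]; first by rewrite big_ord1 !mul0r expr1; ring.
by rewrite big_ord_recr /= mulrDl IHm -!natr1 !exprS; ring.
Qed.

Lemma sum_kap (n : nat) a : (0 < n)%N -> e2pi a != 1 ->
  \sum_(k < n) kap ((a + k%:R) / n%:R) = n%:R ^+ 2 * kap a.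
Proof.
move=> n0 a1; have nn : n%:R != 0 :> C by rewrite pnatr_eq0 -lt0n.
pose w := e2pi (a / n%:R).
(* Coefficients of the polynomial of degree below n that agrees with x / (1 - x)^2 on the n-th roots
   of e2pi(a). *)
pose c j : C := j%:R * phi a + n%:R * kap a.
have -> : n%:R ^+ 2 * kap a = n%:R * c 0%N by rewrite /c mul0r add0r; ring.
rewrite -(@sum_over_roots n c w n0); apply: eq_bigr => k _.
have -> : e2pi (k%:R / n%:R) * w = e2pi ((a + k%:R) / n%:R).
  by rewrite -e2piD -mulrDl [a + _]addrC.
rewrite /kap; set x := e2pi (_ / _).
have xn : x ^+ n = e2pi a by rewrite -e2piMn mulrC divfK // e2piD e2pi_nat mulr1.
have x1 : x != 1 by apply: contra_neq a1 => x1; rewrite -xn x1 expr1n.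
under [RHS]eq_bigr do rewrite mulrDl mulrAC.
rewrite big_split /= -mulr_suml -mulr_sumr.
rewrite /phi /kap -xn; have := subrX1 x n; set S := \sum_(_ < _) _ => E.
case: n k n0 nn {w c} @x @S E xn x1 => // m k _ _ x S E xn x1; have := sum_muln_expr x m; set T := \sum_(_ < _) _ => E2.
have xn1 : 1 - x ^+ m.+1 != 0 by rewrite subr_eq0 eq_sym xn.
have x10 : 1 - x != 0 by rewrite subr_eq0 eq_sym.
have SE : S = (1 - x ^+ m.+1) / (1 - x) by apply: (mulIf x10); rewrite divfK // -[RHS]opprB E; ring.
have TE : T = (x - m.+1%:R * x ^+ m.+1 + m%:R * x ^+ m.+2) / (1 - x) ^+ 2.
  by apply: (mulIf (expf_neq0 2 x10)); rewrite divfK ?expf_neq0.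
rewrite SE TE -natr1 (exprS x m.+1); set y := x ^+ m.+1 in xn1 *.
by field; rewrite xn1 x10.
Qed.

End PartialFractions.

(** * Passage to the limit in the sums over roots of unity *)

Section Cotangent.
Variable R : realType.
Local Notation C := R[i].
Implicit Types (a b z w : C).
Local Notation ip := (two_pi_i R).

(** Dominated convergence for finite sums over |k| <= M as M grows. The bound c / k^2 is needed only
    within the range of summation, the terms outside being replaced by 0. *)
Lemma zsum_tannery (t : nat -> int -> C) (h : int -> C) (s : nat -> C) (S : C) (c : R) (K : nat) :
  0 <= c -> (forall k, t M k @[M --> \oo] --> h k) ->
  (forall M (k : int), (K <= `|k|)%N -> (`|k| <= M)%N -> (0 < `|k|)%N -> (K <= M)%N ->
     normc (t M k) <= c / (`|k|%N)%:R ^+ 2) ->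
  (forall M, \sum_(i < M.*2.+1) t M (i%:Z - M%:Z) = s M) ->
  s M @[M --> \oo] --> S -> zsum h S.
Proof.
move=> c0 th tb ts sS.
pose f M k := if (k <= M)%N then zfold (t M) k else 0.
pose h' := zfold h.
have fh k : f M k @[M --> \oo] --> h' k.
  have : zfold (t M) k @[M --> \oo] --> h' k.
    by case: k => [|k] /=; [exact: th|apply: cvgD; exact: th].
  apply: cvg_trans; apply: near_eq_cvg; near=> M.
  by rewrite /f ifT //; near: M; exact: nbhs_infty_ge.
have k2 k : (0 < k)%N -> c / k%:R ^+ 2 <= 2 * c * usq R k.
  move=> k0; have : 1 <= k%:R ^+ 2 :> R by rewrite exprn_ege1 // ler1n.
  rewrite /usq; set x := k%:R ^+ 2 => x1.
  rewrite ler_pdivrMr ?(lt_le_trans _ x1) // mulrAC ler_pdivlMr; nra.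
have fb : \forall M \near \oo, forall k, (maxn K 1 <= k)%N -> normc (f M k) <= 4 * c * usq R k.
  near=> M => k; rewrite geq_max => /andP[Kk k0]; rewrite /f; case: ifP => kM; last first.
    by rewrite normc0 !mulr_ge0 // ltW // usq_gt0.
  case: k k0 Kk kM => // k _ Kk kM /=.
  have KM : (K <= M)%N by near: M; exact: nbhs_infty_ge.
  rewrite (le_trans (le_normcD _ _)) //.
  have h1 := le_trans (tb M k.+1%:Z Kk kM isT KM) (k2 k.+1 isT).
  have h2 := tb M (- k.+1%:Z); rewrite abszN in h2.
  have {}h2 := le_trans (h2 Kk kM isT KM) (k2 k.+1 isT).
  by move: h1 h2; lra.
have hb k : (maxn K 1 <= k)%N -> normc (h' k) <= 4 * c * usq R k.
  by move=> Kk; apply: (le_normc_lim (fh k)); apply: filterS fb => M; exact.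
(* Enlarged so that the finitely many initial terms obey the same majorant. *)
pose c' := 4 * c + \sum_(j < maxn K 1) normc (h' j) / usq R j.
have hb' k : normc (h' k) <= c' * usq R k.
  have u0 := usq_gt0 R k.
  have s0 (P : pred 'I_(maxn K 1)) : 0 <= \sum_(j < maxn K 1 | P j) normc (h' j) / usq R j.
    by apply: sumr_ge0 => i _; rewrite divr_ge0 ?normc_ge0 // ltW // usq_gt0.
  have [Kk|kK] := leqP (maxn K 1) k.
    by rewrite (le_trans (hb _ Kk)) // ler_pM2r // lerDl s0.
  rewrite -ler_pdivrMr // /c' (bigD1 (Ordinal kK)) //= addrCA lerDl addr_ge0 ?mulr_ge0 //.
have ch : cvgn (series h').
  by apply: (cvg_series_dominated (g := fun k => c' * usq R k)) => //; apply: is_cvg_seriesZ; exact: cvg_usq.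
have sl : s M @[M --> \oo] --> limn (series h').
  apply: (tannery fh fb _ _ ch); first by apply: is_cvg_seriesZ; exact: cvg_usq.
  move=> M; rewrite -ts -zfold_sum.
  rewrite (_ : \sum_(0 <= k < M.+1) zfold (t M) k = \sum_(0 <= k < M.+1) f M k).
    by apply: cvg_series_stop => k Mk; rewrite /f leqNgt Mk.
  by apply: eq_big_nat => k; rewrite /f ltnS => /andP[_ ->].
rewrite /zsum -(cvg_lim (@norm_hausdorff _ _) sS) (cvg_lim (@norm_hausdorff _ _) sl).
exact: ch.
Unshelve. all: by end_near. Qed.

(** From sin 2y = 2 sin y cos y with cosine at least cos(3 pi / 8) on the range of y. The bound 3/4,
    rather than 1/2, leaves room for the shift by Re a in [dn_ge]. *)
Lemma sin_ge_lin : exists2 c : R, 0 < c & forall x : R, `|x| <= 3 / 4 -> c * `|x| <= `|sin (pi * x)|.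
Proof.
have pi0 := pi_gt0 R.
pose c0 : R := cos (pi * (3 / 8)).
have c00 : 0 < c0 by apply: cos_gt0_pihalf; apply/andP; split; nra.
have cos_le (u v : R) : 0 <= u -> u <= v -> v <= pi -> cos v <= cos u.
  move=> u0 uv vpi; have [x] := @MVT_segment R cos (fun t => - sin t) u v uv
    (fun t _ => is_derive_cos t) (continuous_subspaceT (@continuous_cos R)).
  rewrite in_itv /= => /andP[ux xv] E; rewrite -subr_le0 E mulNr oppr_le0 mulr_ge0 ?subr_ge0 //.
  by apply: sin_ge0_pi; apply/andP; split; lra.
have H (x : R) : 0 <= x -> x <= 3 / 4 -> c0 ^+ 2 * pi * x <= sin (pi * x).
  move=> x0 x1; pose y := pi * x / 2.
  have y0 : 0 <= y by rewrite /y; nra.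
  have y1 : y <= pi * (3 / 8) by rewrite /y; nra.
  have cy (u : R) : `|u| <= y -> c0 <= cos u.
    move=> uy; have -> : cos u = cos `|u|.
      by have [u0|u0] := leP 0 u; [rewrite ger0_norm|rewrite ltr0_norm // cosN].
    by apply: cos_le => //; nra.
  have [v vy E] := mvt0 y (fun u => is_derive_sin u).
  rewrite (ger0_norm y0) in vy.
  have -> : pi * x = y + y by rewrite /y; field.
  have sE : sin y = cos v * y by rewrite -E sin0 subr0.
  rewrite sinD sE.
  have h1 := cy _ vy; have h2 : c0 <= cos y by apply: cy; rewrite ger0_norm.
  rewrite (_ : c0 ^+ 2 * pi * x = c0 * c0 * y + c0 * c0 * y); last by rewrite /y; field.
  have h3 : c0 * c0 <= cos v * cos y by rewrite ler_pM // ltW.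
  have := ler_wpM2r y0 h3; lra.
exists (c0 ^+ 2 * pi); first by rewrite mulr_gt0 ?exprn_gt0.
move=> x; have [x0|x0] := leP 0 x => xx.
  rewrite ger0_norm // in xx *; rewrite (le_trans (H x x0 xx)) // ler_norm //.
rewrite ltr0_norm // in xx *; rewrite -normrN -sinN -mulrN (le_trans (H (- x) _ xx)) ?ler_norm //; lra.
Qed.

(** With s = exp(- pi y), |1 - e2pi(z)|^2 = (1 - s^2)^2 + 4 s^2 sin(pi x)^2. *)
Lemma normc_1Be2pi_ge z :
  2 * expR (- pi * complex.Im z) * `|sin (pi * complex.Re z)| <= normc (1 - e2pi z).
Proof.
set x := complex.Re z; set y := complex.Im z; set s := expR (- pi * y).
have s0 : 0 <= s by exact: expR_ge0.
rewrite -(@ler_pXn2r _ 2) ?nnegrE ?normc_ge0 ?mulr_ge0 //.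
rewrite sqr_normcE /e2pi two_pi_iE /cexp /= -/x -/y.
have -> : expR (- (2 * pi) * y) = s ^+ 2.
  by rewrite -expRM_natl; congr expR; ring.
have -> : 2 * pi * x = pi * x + pi * x by ring.
rewrite cosD sinD !exprMn real_normK ?num_real //.
set S := sin _; set K := cos _; have KS : K ^+ 2 + S ^+ 2 = 1 by exact: cos2Dsin2.
rewrite -subr_ge0 (_ : _ - _ = (1 - s ^+ 2 * (K ^+ 2 + S ^+ 2)) ^+ 2); first exact: sqr_ge0.
by ring.
Qed.

Lemma divrn_complex z n : z / n%:R = Complex (complex.Re z / n%:R) (complex.Im z / n%:R).
Proof.
by case: z => u v; rewrite -[n%:R](rmorph_nat (real_complex R)) -fmorphV /=; simpc.
Qed.

Lemma Re_addz a (k : int) : complex.Re (a + k%:~R) = complex.Re a + k%:~R.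
Proof. by case: a => x y; rewrite -(rmorph_int (real_complex R)); simpc. Qed.

Lemma Im_addz a (k : int) : complex.Im (a + k%:~R) = complex.Im a.
Proof. by case: a => x y; rewrite -(rmorph_int (real_complex R)); simpc. Qed.

Lemma normc_e2pi_rat (k : int) n : normc (e2pi (k%:~R / n%:R : C)) = 1.
Proof.
by rewrite normc_e2pi divrn_complex -[k%:~R]add0r Im_addz /= mul0r mulr0 expR0.
Qed.

Local Notation N M := (M.*2.+1).
(* Since [dn M z] tends to - 2 pi i z, the finite decompositions [sum_phi] and
   [sum_kap] over roots of unity become partial fractions over Z in the limit. *)
Definition dn (M : nat) z : C := (N M)%:R * (1 - e2pi (z / (N M)%:R)).

Lemma cvg_dn z : dn M z @[M --> \oo] --> - ip * z.
Proof.
apply/cvgcP => e e0.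
have [d d0 hd] := (is_derive_epsP _ _ _).1 (is_derive_e2pi (0 : C)) (e / (normc z + 1)) (divr_gt0 e0 (ltr_wpDl (normc_ge0 z) ltr01)).
near=> M; have NN : (N M)%:R != 0 :> C by rewrite pnatr_eq0.
have N0 : 0 < (N M)%:R :> R by rewrite ltr0n.
have hM : normc (z / (N M)%:R) < d.
  rewrite normc_div normc_nat ltr_pdivrMr // mulrC -ltr_pdivrMr //.
  rewrite (lt_trans (y := M%:R)) ?ltr_nat ?ltnS -?addnn ?leq_addr //.
  by near: M; exact: nbhs_infty_gtr.
have := hd _ hM; rewrite add0r e2pi0 mulr1 => h.
have -> : - ip * z - dn M z = (N M)%:R * (e2pi (z / (N M)%:R) - 1 - z / (N M)%:R * ip).
  by rewrite /dn; field.
rewrite normcM normc_nat; rewrite normc_div normc_nat in h.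
rewrite (le_lt_trans (ler_wpM2l (ltW N0) h)) //.
rewrite (_ : (N M)%:R * (e / (normc z + 1) * (normc z / (N M)%:R)) = e * (normc z / (normc z + 1))); last first.
  by field; rewrite !gt_eqF // ltr_wpDl // normc_ge0.
by rewrite gtr_pMr // ltr_pdivrMr ?mul1r ?ltrDl // ltr_wpDl // normc_ge0.
Unshelve. all: by end_near. Qed.

(** For |k| > 2 |Re a| the real part of (a + k) / (2M + 1) is at most 3/4 and at least |k| / (2 (2M
    + 1)) in absolute value, so the linear lower bound for the sine applies uniformly in M. *)
Lemma dn_ge a : exists2 c : R, 0 < c & exists K : nat, forall M (k : int),
  (K <= `|k|)%N -> (`|k| <= M)%N -> (K <= M)%N ->
  c * (`|k|%N)%:R <= normc (dn M (a + k%:~R)).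
Proof.
have [c c0 hc] := sin_ge_lin.
exists (expR (- pi * `|complex.Im a|) * c); first by rewrite mulr_gt0 ?expR_gt0.
pose K := (Num.truncn (2 * `|complex.Re a|)).+1.
have aK : 2 * `|complex.Re a| < K%:R by rewrite truncnS_gt.
exists K => M k Kk kM KM.
have N0 : 0 < (N M)%:R :> R by rewrite ltr0n.
have NE : (N M)%:R = 2 * M%:R + 1 :> R by rewrite -natr1 -muln2 natrM mulrC.
pose x := complex.Re ((a + k%:~R) / (N M)%:R).
pose y := complex.Im ((a + k%:~R) / (N M)%:R).
have xE : x = (complex.Re a + k%:~R) / (N M)%:R by rewrite /x divrn_complex Re_addz.
have yE : y = complex.Im a / (N M)%:R by rewrite /y divrn_complex Im_addz.
have kR : `|k%:~R| = (`|k|%N)%:R :> R by rewrite -intr_norm -abszE.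
have kM' : (`|k|%N)%:R <= M%:R :> R by rewrite ler_nat.
have Kk' : K%:R <= (`|k|%N)%:R :> R by rewrite ler_nat.
have xup : `|x| <= 3 / 4.
  rewrite xE normrM normfV (ger0_norm (ltW N0)) ler_pdivrMr // NE.
  have := ler_normD (complex.Re a) k%:~R; rewrite kR; lra.
have xlo : (`|k|%N)%:R / 2 / (N M)%:R <= `|x|.
  rewrite xE normrM normfV (ger0_norm (ltW N0)) ler_pM2r ?invr_gt0 //.
  have := lerB_normD k%:~R (complex.Re a); rewrite kR [k%:~R + _]addrC; lra.
rewrite /dn normcM normc_nat.
have := normc_1Be2pi_ge ((a + k%:~R) / (N M)%:R); rewrite -/x -/y.
have := hc x xup; set S := `|sin _| => hS hn.
have ey : expR (- pi * `|complex.Im a|) <= expR (- pi * y).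
  rewrite ler_expR !mulNr lerN2 ler_pM2l ?pi_gt0 // yE (le_trans (ler_norm _)) //.
  by rewrite normrM normfV (ger0_norm (ltW N0)) ler_piMr // invf_le1 // ler1n.
set E := expR _ in ey *; have E0 : 0 < E by exact: expR_gt0.
set Y := expR _ in ey hn; set k' := _%:R in xlo *; set n' := _%:R in N0 xlo *.
have k'0 : 0 <= k' by rewrite /k'.
rewrite (le_trans (y := n' * (2 * E * (c * (k' / 2 / n'))))) //.
  by rewrite le_eqVlt; apply/orP; left; apply/eqP; field; rewrite gt_eqF.
rewrite ler_pM2l // (le_trans _ hn) //; apply: ler_pM.
- by rewrite mulr_ge0 // ltW.
- by rewrite mulr_ge0 ?divr_ge0 // ?ltW // ltW.
- by rewrite ler_pM2l.
- by rewrite (le_trans _ hS) // ler_pM2l.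
Qed.

Lemma addz_neq0 a (k : int) : e2pi a != 1 -> a + k%:~R != 0.
Proof.
apply: contra_neq => /eqP; rewrite addr_eq0 => /eqP ->.
by rewrite -rmorphN /= e2pi_int.
Qed.

Lemma dn_neq0 M a (k : int) : e2pi a != 1 -> dn M (a + k%:~R) != 0.
Proof.
move=> a1; rewrite /dn mulf_neq0 ?pnatr_eq0 // subr_eq0 eq_sym.
apply: contra_neq a1 => /e2pi_eq1[m] h.
have -> : a = ((m * (N M)%:Z) - k)%:~R.
  by rewrite rmorphB rmorphM /= -h divfK ?pnatr_eq0 // addrK.
exact: e2pi_int.
Qed.

Lemma e2pi_shift a (k : int) : e2pi (a + k%:~R) = e2pi a.
Proof. by rewrite e2piD e2pi_int mulr1. Qed.

Lemma phi_shift a (k : int) : phi (a + k%:~R) = phi a.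
Proof. by rewrite /phi e2pi_shift. Qed.

Lemma kap_shift a (k : int) : kap (a + k%:~R) = kap a.
Proof. by rewrite /kap e2pi_shift. Qed.

Lemma cvg_invN : ((N M)%:R : C)^-1 @[M --> \oo] --> (0 : C).
Proof.
apply/cvgcP => e e0; near=> M.
rewrite sub0r normcN normcV normc_nat -[ltRHS]invrK ltf_pV2 ?posrE ?invr_gt0 ?ltr0n //.
rewrite (lt_trans (y := M%:R)) ?ltr_nat ?ltnS -?addnn ?leq_addr //.
by near: M; exact: nbhs_infty_gtr.
Unshelve. all: by end_near. Qed.

(** [sum_kap] with n = 2M + 1, divided by n^2: the terms become e2pi(x) / dn^2 with e2pi(x) tending
    to 1. The shift of a by - M makes the range symmetric. *)
Lemma zsum_kap a : e2pi a != 1 ->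
  zsum (fun k => (a + k%:~R)^-2) (ip ^+ 2 * kap a).
Proof.
move=> a1.
have [c c0 [K hK]] := dn_ge a.
have H : zsum (fun k => (- ip * (a + k%:~R))^-2) (kap a).
  apply: (@zsum_tannery (fun M k => e2pi ((a + k%:~R) / (N M)%:R) / dn M (a + k%:~R) ^+ 2) _
     (fun=> kap a) _ (expR (2 * pi * `|complex.Im a|) / c ^+ 2) K).
  - by rewrite divr_ge0 ?expR_ge0 ?exprn_ge0 // ltW.
  - move=> k; have d := @cvg_dn (a + k%:~R).
    have d0 : - ip * (a + k%:~R) != 0 by rewrite mulf_neq0 ?oppr_eq0 ?two_pi_i_neq0 // addz_neq0.
    rewrite -[X in _ --> X]mul1r; apply: cvgM.
      rewrite (_ : (fun M => _) = (fun M => 1 - dn M (a + k%:~R) * ((N M)%:R)^-1)); last first.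
        by apply/funext => M; rewrite /dn mulrAC divff ?pnatr_eq0 // mul1r subKr.
      rewrite -[X in _ --> X]subr0; apply: cvgB; first exact: cvg_cst.
      rewrite -(mulr0 (- ip * (a + k%:~R))); apply: cvgM; [exact: d|exact: cvg_invN].
    apply: cvgV; first by rewrite expf_neq0.
    rewrite expr2; under eq_fun do rewrite expr2.
    by apply: cvgM; exact: d.
  - move=> M k Kk kM k0 KM; have := hK M k Kk kM KM.
    have k'0 : 0 < (`|k|%N)%:R :> R by rewrite ltr0n.
    rewrite normc_div normcX normc_e2pi => h.
    rewrite -mulrA -invfM -exprMn ler_pM ?expR_ge0 ?invr_ge0 ?exprn_ge0 ?normc_ge0 //.
      rewrite divrn_complex Im_addz /=.
      rewrite ler_expR !mulNr -mulrN ler_pM2l ?mulr_gt0 ?pi_gt0 // -mulNr (le_trans (ler_norm _)) //.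
      by rewrite normrM normrN normfV [`|(N M)%:R|]ger0_norm // ler_piMr // invf_le1 ?ler1n ?ltr0n.
    rewrite lef_pV2 ?posrE ?exprn_gt0 ?mulr_gt0 ?normc_gt0 ?dn_neq0 //.
    by rewrite lerXn2r ?nnegrE ?mulr_ge0 ?normc_ge0 // ltW.
  - move=> M; have nn : (N M)%:R != 0 :> C by rewrite pnatr_eq0.
    apply: (mulfI (expf_neq0 2 nn)); rewrite -(kap_shift a (- M%:Z)).
    rewrite -sum_kap //; last by rewrite e2pi_shift.
    rewrite mulr_sumr; apply: eq_bigr => i _.
    have -> : a + (- M%:Z)%:~R + i%:R = a + (i%:Z - M%:Z)%:~R by rewrite rmorphB rmorphN /=; ring.
    have := dn_neq0 M (i%:Z - M%:Z) a1; rewrite /dn mulf_eq0 negb_or nn /= => d0.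
    rewrite /kap; move: (e2pi _) d0 => e' d0; move: (_%:R) nn => n' nn.
    by field; rewrite nn d0.
  - exact: cvg_cst.
have := @zsumZ R (ip ^+ 2) _ _ H; congr zsum; apply/funext => k.
by rewrite exprMn sqrrN invfM mulrA divff ?mul1r // expf_neq0 // two_pi_i_neq0.
Qed.

Lemma dnB M a b (k : int) :
  dn M (b + k%:~R) - dn M (a + k%:~R) = e2pi (k%:~R / (N M)%:R) * (dn M b - dn M a).
Proof. by rewrite /dn !mulrDl !e2piD; ring. Qed.

(** A single cotangent series decays only like 1/k. In a difference the numerator [dnB] stays
    bounded, which leaves 1/k^2. *)
Lemma zsum_phi a b : e2pi a != 1 -> e2pi b != 1 ->
  zsum (fun k => (a + k%:~R)^-1 - (b + k%:~R)^-1) (- ip * (phi a - phi b)).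
Proof.
move=> a1 b1.
have [c c0 [K hK]] := dn_ge a; have [c' c'0 [K' hK']] := dn_ge b.
have cB : dn M b - dn M a @[M --> \oo] --> - ip * b - - ip * a.
  by apply: cvgB; exact: cvg_dn.
pose B := normc (- ip * b - - ip * a) + 1.
have [K2 _ hB] : \forall M \near \oo, normc (dn M b - dn M a) <= B.
  move/cvgcP : cB => /(_ 1 ltr01); apply: filterS => M h.
  have := lB_normcB (dn M b - dn M a) (- ip * b - - ip * a).
  rewrite normcB in h; rewrite /B; lra.
have B0 : 0 <= B by rewrite addr_ge0 // normc_ge0.
have H : zsum (fun k => (- ip * (a + k%:~R))^-1 - (- ip * (b + k%:~R))^-1) (phi a - phi b).
  apply: (@zsum_tannery (fun M k => (dn M (a + k%:~R))^-1 - (dn M (b + k%:~R))^-1) _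
     (fun=> phi a - phi b) _ (B / (c * c')) (maxn K2 (maxn K K'))).
  - by rewrite divr_ge0 // mulr_ge0 // ltW.
  - have d x (k : int) : e2pi x != 1 -> (dn M (x + k%:~R))^-1 @[M --> \oo] --> (- ip * (x + k%:~R))^-1.
      move=> x1; apply: cvgV; last exact: cvg_dn.
      by rewrite mulf_neq0 ?oppr_eq0 ?two_pi_i_neq0 // addz_neq0.
    by move=> k; apply: cvgB; exact: d.
  - move=> M k; rewrite !geq_max => /andP[K2k /andP[Kk K'k]] kM k0 /andP[K2M /andP[KM K'M]].
    have k'0 : 0 < (`|k|%N)%:R :> R by rewrite ltr0n.
    have Da := hK M k Kk kM KM; have Db := hK' M k K'k kM K'M.
    have da := dn_neq0 M k a1; have db := dn_neq0 M k b1.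
    rewrite (_ : _ - _ = (dn M (b + k%:~R) - dn M (a + k%:~R)) / (dn M (a + k%:~R) * dn M (b + k%:~R))); last first.
      by field; rewrite da db.
    rewrite dnB normc_div [normc (e2pi _ * _)]normcM [normc (dn _ _ * _)]normcM normc_e2pi_rat mul1r -[leRHS]mulrA -invfM.
    rewrite ler_pM ?invr_ge0 ?mulr_ge0 ?normc_ge0 ?hB //.
    rewrite lef_pV2 ?posrE ?exprn_gt0 ?mulr_gt0 ?normc_gt0 //.
    by rewrite expr2 mulrACA ler_pM ?mulr_ge0 // ltW.
  - move=> M; have nn : (N M)%:R != 0 :> C by rewrite pnatr_eq0.
    rewrite -(phi_shift a (- M%:Z)) -(phi_shift b (- M%:Z)).
    apply: (mulfI nn); rewrite mulrBr -!sum_phi ?e2pi_shift // -sumrB mulr_sumr.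
    apply: eq_bigr => i _.
    have E (x : C) : x + (- M%:Z)%:~R + i%:R = x + (i%:Z - M%:Z)%:~R by rewrite rmorphB rmorphN /=; ring.
    have := dn_neq0 M (i%:Z - M%:Z) a1; have := dn_neq0 M (i%:Z - M%:Z) b1.
    rewrite !E /dn !mulf_eq0 !negb_or nn /= => d0 d1.
    rewrite /phi; move: (e2pi _) d1 (e2pi _) d0 => e1 d1 e2 d0; move: (_%:R) nn => n' nn.
    by field; rewrite nn d0 d1.
  - exact: cvg_cst.
have := @zsumZ R (- ip) _ _ H; congr zsum; apply/funext => k.
have ip0 : - ip != 0 by rewrite oppr_eq0 two_pi_i_neq0.
by rewrite !invfM mulrBr !mulrA divff // !mul1r.
Qed.

End Cotangent.

(** * The Eisenstein series of weight two *)

Section EisensteinTwo.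
Variable R : realType.
Local Notation C := R[i].
Local Notation H := (uhp R).
Implicit Types (a b z w : C) (t : H).
Local Notation ip := (two_pi_i R).

Lemma cvgc_unique (u : nat -> C) (a b : C) : u @ \oo --> a -> u @ \oo --> b -> a = b.
Proof.
by move=> h1 h2; rewrite -(cvg_lim (@norm_hausdorff _ _) h1) -(cvg_lim (@norm_hausdorff _ _) h2).
Qed.

Lemma zfold_le (b : int -> C) (B : R) (j : nat) :
  (forall n, normc (b n) <= B * usq R `|n|) -> normc (zfold b j) <= 2 * B * usq R j.
Proof.
move=> h; have B0 : 0 <= B by have := le_trans (normc_ge0 _) (h 0); rewrite pmulr_lge0 // usq_gt0.
case: j => [|j] /=.
  by rewrite (le_trans (h 0)) // -mulrA mulr_natl mulr2n lerDl mulr_ge0 // ltW // usq_gt0.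
rewrite (le_trans (le_normcD _ _)) //; have := h j.+1%:Z; have := h (- j.+1%:Z).
by rewrite abszN /=; lra.
Qed.

(** Tannery's theorem over the rows, applied to the sums of the first N folded columns. *)
Lemma zsum_exchange (b : int -> int -> C) (B : R) (r c : int -> C) (L : C) :
  (forall m n, normc (b m n) <= B * usq R `|m| * usq R `|n|) ->
  (forall m, zsum (b m) (r m)) -> (forall n, zsum (fun m => b m n) (c n)) ->
  zsum r L -> zsum c L.
Proof.
move=> hb hr hc rL.
pose f (N : nat) (k : nat) := zfold (fun m => \sum_(0 <= j < N) zfold (b m) j) k.
pose U := limn (series (usq R)).
have U_le N : \sum_(0 <= j < N) usq R j <= U.
  have cU := @cvg_usq R; rewrite (_ : \sum_(0 <= j < N) _ = series (usq R) N) //.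
  apply: nondecreasing_cvgn_le => //; apply: nondecreasing_series => k _ _.
  exact: ltW (usq_gt0 R k).
have fb (N : nat) m : normc (\sum_(0 <= j < N) zfold (b m) j) <= 2 * B * U * usq R `|m|.
  have u0 := usq_gt0 R `|m|.
  have B0 : 0 <= B.
    have := le_trans (normc_ge0 _) (hb 0 0).
    by rewrite -mulrA pmulr_lge0 // mulr_gt0 ?usq_gt0.
  rewrite (le_trans (le_normc_sum _ _ _)) //.
  rewrite (le_trans (y := \sum_(0 <= j < N) 2 * B * usq R `|m| * usq R j)) //.
    apply: ler_sum => j _; rewrite -[2 * B * _]mulrA.
    by apply: zfold_le => n; exact: hb.
  rewrite -mulr_sumr [leRHS]mulrAC ler_wpM2l // !mulr_ge0 // ltW //.
apply: (@tannery R f (fun k => 2 * (2 * B * U) * usq R k) (zfold r) _ _ 0%N _ _ _ _ rL).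
- have hm m : \sum_(0 <= j < N) zfold (b m) j @[N --> \oo] --> r m by exact: hr.
  by case=> [|k]; rewrite /f /=; [exact: hm|apply: cvgD; exact: hm].
- by apply: nearW => N k _; apply: zfold_le => m; exact: fb.
- by apply: is_cvg_seriesZ; exact: cvg_usq.
move=> N.
have -> : series (f N) = (fun M => \sum_(0 <= j < N) \sum_(0 <= k < M) zfold (fun m => zfold (b m) j) k).
  apply/funext => M; rewrite /series /= exchange_big /=; apply: eq_bigr => k _.
  by rewrite /f; case: k => [|k] //=; rewrite -big_split.
have hc' j : zsum (fun m => zfold (b m) j) (zfold c j).
  by case: j => [|j] /=; [exact: hc|apply: zsumD; exact: hc].
elim: N => [|N IHN].
  rewrite (_ : (fun M => _) = cst 0); last by apply/funext => M; rewrite big_geq.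
  by rewrite /series /= big_geq ?leqnn; [exact: cvg_cst|].
rewrite (_ : (fun M => _) = (fun M => \sum_(0 <= j < N) \sum_(0 <= k < M) zfold (fun m => zfold (b m) j) k
   + \sum_(0 <= k < M) zfold (fun m => zfold (b m) N) k)); last first.
  by apply/funext => M; rewrite big_nat_recr.
rewrite /series /= [X in _ --> X](big_nat_recr _ _ _ (leq0n N)) /=.
apply: cvgD; [exact: IHN|exact: hc'].
Qed.

Lemma kap_even z : e2pi z != 1 -> kap (- z) = kap z.
Proof.
move=> z1; rewrite /kap e2piN; have := e2pi_neq0 z; move: (e2pi z) z1 => x x1 x0.
have x10 : 1 - x != 0 by rewrite subr_eq0 eq_sym.
have x01 : x - 1 != 0 by rewrite subr_eq0.
by field; rewrite x0 x10 x01.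
Qed.

Lemma phiN z : e2pi z != 1 -> phi (- z) = 1 - phi z.
Proof.
move=> z1; rewrite /phi e2piN; have := e2pi_neq0 z; move: (e2pi z) z1 => x x1 x0.
have x10 : 1 - x != 0 by rewrite subr_eq0 eq_sym.
have x01 : x - 1 != 0 by rewrite subr_eq0.
by field; rewrite x0 x10 x01.
Qed.

Lemma e2pi_neq1 z : complex.Im z != 0 -> e2pi z != 1.
Proof.
by apply: contra_neq => /e2pi_eq1[m ->]; rewrite -[m%:~R]add0r Im_addz.
Qed.

(** This is 2 zeta(2); the term k = 0 is 0 by the convention for inverses. At a = 1/2 [zsum_kap]
    sums over the odd integers, and splitting all integers by parity gives S = pi^2 / 4 + S / 4. *)
Lemma zsum_inv_sq : zsum (fun k : int => (k%:~R : C)^-2) ((pi ^+ 2)%:C / 3).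
Proof.
pose h : C := 2^-1.
have h1 : e2pi h = - 1.
  rewrite /e2pi two_pi_iE /cexp (_ : h = Complex 2^-1 0); last first.
    by rewrite /h -[2](rmorph_nat (real_complex R)) -fmorphV.
  rewrite /= mulr0 expR0 !mul1r (_ : 2 * pi / 2 = pi); last by field.
  by rewrite cospi sinpi; apply/eqP; rewrite eq_complex /= oppr0 !eqxx.
have h2 : e2pi h != 1 by rewrite h1 eqNr oner_eq0.
have Z := zsum_kap h2.
have zE : ip ^+ 2 * kap h = (pi ^+ 2)%:C.
  rewrite /kap h1 (_ : ip ^+ 2 = - 4 * (pi ^+ 2)%:C); last first.
    rewrite /two_pi_i expr2; apply/eqP; rewrite eq_complex -[4](rmorph_nat (real_complex R)) /=.
    by rewrite !(mul0r, mulr0, subr0, addr0, oppr0, add0r) eqxx andbT; apply/eqP; ring.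
  by field.
rewrite zE in Z.
pose s (n : nat) : C := \sum_(0 <= k < n.+1) zfold (fun k : int => (k%:~R : C)^-2) k.
pose u (n : nat) : C := \sum_(0 <= k < n.+1) zfold (fun k : int => (h + k%:~R)^-2) k.
have sS n : s n.+1 = s n + 2 / (n.+1%:R) ^+ 2.
  rewrite /s big_nat_recr //=; congr (_ + _).
  by rewrite mulrNz sqrrN -pmulrn; ring.
have uS n : u n.+1 = u n + (4 / n.*2.+3%:R ^+ 2 + 4 / n.*2.+1%:R ^+ 2).
  rewrite /u big_nat_recr //= mulrNz -/(u n); congr (_ + (_ + _)).
    rewrite (_ : h + _ = n.*2.+3%:R / 2); last by rewrite /h -!muln2 -pmulrn -!natr1 natrM; field.
    by have := pnatr_eq0 C n.*2.+3; move: (_%:R) => r /= /negbT r0; field; rewrite r0.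
  rewrite (_ : h + _ = - (n.*2.+1%:R / 2)); last by rewrite /h -!muln2 -pmulrn -!natr1 natrM; field.
  by have := pnatr_eq0 C n.*2.+1; move: (_%:R) => r /= /negbT r0; field; rewrite r0.
(* The range of u M reaches the odd number 2M + 1 but not - (2M + 1), hence the subtracted term. *)
have rel M : s M.*2 = u M / 4 - (M.*2.+1%:R)^-2 + s M / 4.
  elim: M => [|M IHM].
    have s0 : s 0%N = 0 by rewrite /s big_nat1 /= mulr0z expr0n invr0.
    have u0 : u 0%N = 4 by rewrite /u big_nat1 /zfold mulr0z addr0 /h; field.
    by rewrite [0.*2]/= s0 u0 expr1n invr1; field.
  rewrite doubleS !sS IHM uS.
  have -> : M.*2.+2%:R = 2 * M.+1%:R :> C by rewrite -natrM mul2n doubleS.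
  have p0 : M.*2.+1%:R != 0 :> C by rewrite pnatr_eq0.
  have q0 : M.+1%:R != 0 :> C by rewrite pnatr_eq0.
  have r0 : M.*2.+3%:R != 0 :> C by rewrite pnatr_eq0.
  move: (M.*2.+1%:R) (M.+1%:R) (M.*2.+3%:R) p0 q0 r0 => p q r p0 q0 r0.
  by field; rewrite p0 q0 r0.
have cs : cvgn (series (zfold (fun k : int => (k%:~R : C)^-2))).
  apply: (@cvg_series_dominated _ _ (fun k => 4 * usq R k)).
    by apply: is_cvg_seriesZ; exact: cvg_usq.
  case=> [|k]; first by rewrite /zfold mulr0z expr0n invr0 normc0 mulr_ge0 // ltW // usq_gt0.
  rewrite [zfold _ _]/= (_ : _ + _ = 2 / k.+1%:R ^+ 2); last by rewrite mulrNz sqrrN -pmulrn; ring.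
  rewrite normc_div normcX !normc_nat /usq.
  have : 1 <= k.+1%:R ^+ 2 :> R by rewrite exprn_ege1 // ler1n.
  move: (_ ^+ 2) => x x1; rewrite ler_pdivrMr ?(lt_le_trans _ x1) // mulrAC ler_pdivlMr; nra.
have [S sS'] := (cvg_ex _).1 cs.
suff -> : (pi ^+ 2)%:C / 3 = S by [].
have c1 : s M @[M --> \oo] --> S by have := sS'; rewrite -(cvg_shiftS (series _)).
have c2 : u M @[M --> \oo] --> (pi ^+ 2)%:C by have := Z; rewrite /zsum -(cvg_shiftS (series _)).
have c3 : s M.*2 @[M --> \oo] --> S.
  have := cvg_comp _ _ (cvg_mulnl _ (isT : (0 < 2)%N)) c1; apply: cvg_trans.
  by apply: near_eq_cvg; apply: nearW => n /=; rewrite mul2n.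
have c4 : u M / 4 - (M.*2.+1%:R)^-2 + s M / 4 @[M --> \oo] --> (pi ^+ 2)%:C / 4 - 0 * 0 + S / 4.
  apply: cvgD; last by apply: cvgMr_tmp; exact: c1.
  apply: cvgB; first by apply: cvgMr_tmp; exact: c2.
  by under eq_fun do rewrite expr2 invfM; apply: cvgM; exact: cvg_invN.
have E : S = (pi ^+ 2)%:C / 4 - 0 * 0 + S / 4.
  apply: (cvgc_unique c3); rewrite (_ : (fun M => s M.*2) = (fun M => u M / 4 - (M.*2.+1%:R)^-2 + s M / 4)) //.
  by apply/funext => M; exact: rel.
by apply: (@mulfI _ (3 / 4)); rewrite ?mulf_neq0 ?invr_eq0 ?pnatr_eq0 //; rewrite [RHS](_ : _ = S - S / 4); [rewrite {1}E; field|field].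
Qed.

Lemma slow1 : slow (fun=> 1 : C).
Proof. by move=> r r0 r1; exists 1 => n; rewrite normc1 mul1r exprn_ile1 // ltW. Qed.

Lemma slow_natr : slow (fun n => n%:R : C).
Proof. by have := slowMn slow1; congr slow; apply/funext => n; rewrite mulr1. Qed.

Lemma psum_natr z : normc z < 1 -> psum (fun n => n%:R) z = z / (1 - z) ^+ 2.
Proof.
move=> z1; have z10 : 1 - z != 0.
  by apply/eqP => /subr0_eq z11; move: z1; rewrite -z11 normc1 ltxx.
have s1 := slow1; have sn := slow_natr.
have E1 : psum (fun=> 1) z = (1 - z)^-1.
  have := psum_shift s1 z1; set P := psum _ _ => E.
  by apply: (mulIf z10); rewrite mulVf // mulrBr mulr1 {1}E [P * z]mulrC addrK.
have := psum_shift sn z1; rewrite add0r.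
have -> : (fun n => n.+1%:R) = (fun n => n%:R + 1) :> (nat -> C).
  by apply/funext => n; rewrite natr1.
rewrite psumD // E1; set P := psum _ _ => E.
apply: (mulIf z10); rewrite expr2 invfM mulrA divfK // mulrBr mulr1 {1}E; ring.
Qed.

Lemma leq_sigma n : (sigma n.+1 <= n.+1 ^ 2)%N.
Proof.
rewrite /sigma (leq_trans (n := \sum_(d <- divisors n.+1) n.+1)) //.
  rewrite big_seq [leqRHS]big_seq; apply: leq_sum => d; rewrite -dvdn_divisors // => h.
  exact: dvdn_leq.
rewrite big_const_seq count_predT iter_addn_0 expnS expn1 leq_mul2l /=.
have : {subset divisors n.+1 <= iota 1 n.+1}.
  move=> d; rewrite -dvdn_divisors // mem_iota => h.
  by rewrite (dvdn_gt0 _ h) //= add1n ltnS dvdn_leq.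
by move/(uniq_leq_size (divisors_uniq _)); rewrite size_iota.
Qed.

Lemma sigmaE n N : (0 < n)%N -> (n <= N)%N ->
  sigma n = (\sum_(1 <= m < N.+1 | m %| n) n %/ m)%N.
Proof.
move=> n0 nN; rewrite /sigma.
have -> : (\sum_(d <- divisors n) d = \sum_(d <- divisors n) n %/ d)%N.
  rewrite -(big_map (divn n) predT id); apply: perm_big.
  have inj : {in divisors n &, injective (divn n)}.
    move=> a b; rewrite -!dvdn_divisors // => an bn E.
    have := divnK an; rewrite E => h; have := divnK bn; rewrite -{2}h => /eqP.
    have : (0 < n %/ b)%N by rewrite divn_gt0 ?(dvdn_gt0 n0 bn) // dvdn_leq.
    by move=> p; rewrite eqn_pmul2l // => /eqP.
  have un : uniq (map (divn n) (divisors n)) by rewrite map_inj_in_uniq ?divisors_uniq.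
  have sub : {subset map (divn n) (divisors n) <= divisors n}.
    by move=> x /mapP[d]; rewrite -!dvdn_divisors // => dn ->; exact: dvdn_div.
  rewrite perm_sym; apply: uniq_perm => //; first exact: divisors_uniq.
  by have [_] := uniq_min_size un sub ltac:(by rewrite size_map).
rewrite -[in RHS]big_filter; apply: perm_big; apply: uniq_perm.
- exact: divisors_uniq.
- by rewrite filter_uniq // iota_uniq.
move=> d; rewrite mem_filter mem_index_iota -dvdn_divisors // ltnS.
case: (boolP (d %| n)%N) => //= h.
by rewrite (dvdn_gt0 n0 h) (leq_trans (dvdn_leq n0 h)).
Qed.

Definition sigmac (n : nat) : C := if n is 0%N then 0 else (sigma n)%:R.

Lemma slow_sigma : slow sigmac.
Proof.
apply: (slow_le (slowMn slow_natr)) => -[|n]; first by rewrite mul0r.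
by rewrite /sigmac -natrM !normc_nat ler_nat mulnn leq_sigma.
Qed.

(** Each term is expanded in powers of z and cut at degree N; collecting a power of z then gives the
    divisor sum, and N tends to infinity by Tannery's theorem. *)
Lemma cvg_lambert z : normc z < 1 ->
  series (fun m => psum (fun n => n%:R) (z ^+ m.+1)) @ \oo --> psum sigmac z.
Proof.
move=> z1; pose a (n : nat) : C := n%:R.
pose h m := psum a (z ^+ m.+1).
pose f (N m : nat) : C := \sum_(0 <= n < N.+1) spread m.+1 a n * z ^+ n.
pose r := (normc z + 1) / 2; have nz := normc_ge0 z.
have r0 : 0 < r by rewrite /r; lra.
have r1 : r < 1 by rewrite /r; lra.
have [K hK] : exists K, forall n, n%:R * normc z ^+ n <= K * r ^+ n.
  have x0 : 0 <= normc z / r by rewrite divr_ge0 // ltW.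
  have x1 : normc z / r < 1 by rewrite ltr_pdivrMr // /r; lra.
  pose y := (normc z / r + 1) / 2.
  have [K hK] := @mulr_nat_expr_bound R y ltac:(rewrite /y; lra) ltac:(rewrite /y; lra).
  exists K => n; rewrite -ler_pdivrMr ?exprn_gt0 // -mulrA -expr_div_n.
  by rewrite (le_trans _ (hK n)) // ler_wpM2l // lerXn2r ?nnegrE // /y; lra.
have K0 : 0 <= K by have := hK 0%N; rewrite mul0r expr0 mulr1.
have fz N m : (N <= m)%N -> f N m = 0.
  move=> Nm; rewrite /f big_nat big1 // => -[|n] /andP[_ h2].
    by rewrite /spread dvdn0 div0n mul0r.
  by rewrite /spread gtnNdvd ?mul0r // (leq_trans h2).
(* The m-th series starts at exponent m + 1, so the tail of a geometric series bounds it
   independently of N. *)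
have fb N m : normc (f N m) <= K * r / (1 - r) * r ^+ m.
  rewrite (le_trans (le_normc_sum _ _ _)) //.
  rewrite (le_trans (y := \sum_(0 <= n < N.+1) if (m < n)%N then K * r ^+ n else 0)) //.
    apply: ler_sum => -[|n] _.
      by rewrite /spread dvdn0 div0n mul0r normc0.
    rewrite /spread; case: ifP => [dv|_]; last first.
      by rewrite mul0r normc0; case: ifP => // _; rewrite mulr_ge0 ?exprn_ge0 // ltW.
    rewrite ifT; last exact: dvdn_leq dv.
    rewrite normcM normcX normc_nat (le_trans _ (hK _)) // ler_wpM2r ?exprn_ge0 //.
    by rewrite ler_nat leq_div.
  have [Nm|mN] := leqP N m.
    have c0 : 0 <= K * r / (1 - r) * r ^+ m.
      apply: mulr_ge0; last by rewrite exprn_ge0 // ltW.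
      by apply: divr_ge0; [apply: mulr_ge0 => //; exact: ltW|rewrite subr_ge0 ltW].
    rewrite big_nat big1 //.
    by move=> n /andP[_ h2]; rewrite ifF // ltnNge; apply/negbTE; rewrite negbK (leq_trans _ Nm).
  rewrite (big_cat_nat (leq0n m.+1)) /=; last by rewrite ltnS ltnW.
  rewrite big_nat big1 ?add0r; last by move=> n /andP[_ h2]; rewrite ifF // ltnNge -ltnS h2.
  rewrite -{1}[m.+1]add0n big_addn big_mkord.
  rewrite (eq_bigr (fun i : 'I_(N.+1 - m.+1) => K * r ^+ m.+1 * r ^+ i)); last first.
    by move=> i _; rewrite ifT ?addnS ?ltnS ?leq_addl // -mulrA -exprD -addnS addnC.
  rewrite -mulr_sumr (_ : K * r / _ * _ = K * r ^+ m.+1 * (1 - r)^-1); last by rewrite exprS; ring.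
  rewrite ler_wpM2l ?mulr_ge0 ?exprn_ge0 ?(ltW r0) //.
  rewrite -[leRHS]mul1r ler_pdivlMr ?subr_gt0 //.
  have := subrX1 r (N.+1 - m.+1); set S := \sum_(_ < _) _.
  have : 0 <= r ^+ (N.+1 - m.+1) by rewrite exprn_ge0 // ltW.
  nra.
have fh k : f N k @[N --> \oo] --> h k.
  rewrite /h -psum_spread //; last exact: slow_natr.
  have := cvg_psum (slow_spread (ltn0Sn k) slow_natr) z1.
  by rewrite -(cvg_shiftS (series _)).
have cg : cvgn (series (fun m => K * r / (1 - r) * r ^+ m)).
  by apply: cvg_geometric_bound => //; exact: ltW.
have ch : cvgn (series h).
  apply: (cvg_series_dominated cg) => k.
  by apply: (le_normc_lim (fh k)); apply: nearW => N; exact: fb.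
have fS N : series (f N) @ \oo --> \sum_(0 <= k < N) f N k.
  by apply: cvg_series_stop => k; exact: fz.
have h1 := @tannery R f _ h _ _ 0%N fh (nearW _ (fun N k _ => fb N k)) cg fS ch.
have E N : \sum_(0 <= k < N) f N k = series (fun n => sigmac n * z ^+ n) N.+1.
  rewrite /f exchange_big /= /series /=; apply: eq_big_nat => -[|n] /andP[_ hn].
    by rewrite [RHS]mul0r big1 // => k _; rewrite /spread dvdn0 div0n mul0r.
  rewrite -mulr_suml; congr (_ * _); rewrite /sigmac (@sigmaE n.+1 N) // natr_sum.
  rewrite big_add1 /= [RHS]big_mkcond /=; apply: eq_bigr => k _.
  by rewrite /spread; case: ifP.
have h2 : \sum_(0 <= k < N) f N k @[N --> \oo] --> psum sigmac z.
  rewrite (_ : (fun N => _) = (fun N => series (fun n => sigmac n * z ^+ n) N.+1)); last exact/funext.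
  by rewrite (cvg_shiftS (series _)); apply: cvg_psum => //; exact: slow_sigma.
rewrite (cvgc_unique h2 (h1 _)); exact: ch.
Qed.

Definition qexp (N : nat) (t : H) : C := e2pi (val t / N%:R).

Lemma normc_qexp N t : normc (qexp N t) = expR (- (2 * pi) * (complex.Im (val t) / N%:R)).
Proof. by rewrite /qexp normc_e2pi divrn_complex. Qed.

Lemma qexp_lt1 N t : (0 < N)%N -> normc (qexp N t) < 1.
Proof.
move=> N0; rewrite normc_qexp expR_lt1 mulNr oppr_lt0 mulr_gt0 ?mulr_gt0 ?pi_gt0 ?uhp_Im ?invr_gt0 ?ltr0n //.
Qed.

Definition eps2 (n : nat) : C := if n is 0%N then 1 else - 24 * (sigma n)%:R.

Lemma eps2E : eps2 = fun n => (n == 0%N)%:R + (- 24) * sigmac n.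
Proof. by apply/funext => -[|n]; rewrite /eps2 /= ?mulr0 ?addr0 ?add0r. Qed.

Lemma slow_delta : slow (fun n => (n == 0%N)%:R : C).
Proof. by apply: (slow_le slow1) => -[|n]; rewrite [_ == _]/= ?normc1 ?normc0 ?ler01. Qed.

Lemma slow_eps2 : slow eps2.
Proof. by rewrite eps2E; apply: slowD; [exact: slow_delta|apply: slowZ; exact: slow_sigma]. Qed.

Lemma psum_delta z : psum (fun n => (n == 0%N)%:R) z = 1.
Proof.
apply: psum_unique.
have := @cvg_series_stop R C (fun n => (n == 0%N)%:R * z ^+ n) 1; rewrite big_nat1 /= mul1r expr0; apply.
by case=> // k _; rewrite mul0r.
Qed.

Lemma E2_psum t : E2 t = psum eps2 (qexp 1 t).
Proof.
have q1 := qexp_lt1 t (isT : (0 < 1)%N).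
rewrite eps2E psumD ?psumZ ?psum_delta //; [|exact: slow_sigma|exact: slow_delta|apply: slowZ; exact: slow_sigma].
rewrite mulNr /E2; congr (1 - 24 * _); apply/cvg_lim; first exact: norm_hausdorff.
have := cvg_psum slow_sigma q1 => /cvg_series_shift; rewrite mul0r subr0.
by rewrite /qexp divr1.
Qed.

Lemma e2pi_normc_lt1 z : 0 < complex.Im z -> normc (e2pi z) < 1.
Proof. by move=> z0; rewrite normc_e2pi -expR0 ltr_expR mulNr oppr_lt0 mulr_gt0 // mulr_gt0 ?pi_gt0. Qed.

Lemma kapE z : 0 < complex.Im z -> kap z = psum (fun n => n%:R) (e2pi z).
Proof. by move=> z0; rewrite psum_natr // e2pi_normc_lt1. Qed.

(** The sum of (m z + n)^-2 over n, the undefined term m = n = 0 counting as 0. *)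
Definition e2row (z : C) (m : int) : C :=
  if m == 0 then (pi ^+ 2)%:C / 3 else ip ^+ 2 * kap (m%:~R * z).

Lemma ip_sq : ip ^+ 2 = - 4 * (pi ^+ 2)%:C.
Proof.
rewrite /two_pi_i expr2; apply/eqP; rewrite eq_complex -[4](rmorph_nat (real_complex R)) /=.
by rewrite !(mul0r, mulr0, subr0, addr0, oppr0, add0r) eqxx andbT; apply/eqP; ring.
Qed.

Lemma Im_natmul n z : complex.Im (n%:R * z) = n%:R * complex.Im z.
Proof. by case: z => x y; rewrite -[n%:R](rmorph_nat (real_complex R)) /=; simpc. Qed.

Lemma Im_intmul (m : int) z : complex.Im (m%:~R * z) = m%:~R * complex.Im z.
Proof. by case: z => x y; rewrite -(rmorph_int (real_complex R)) /=; simpc. Qed.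

Lemma zsum_e2row t : zsum (e2row (val t)) ((pi ^+ 2)%:C / 3 * E2 t).
Proof.
have q1 := qexp_lt1 t (isT : (0 < 1)%N).
have L := cvg_lambert q1; set G := psum _ _ in L.
have -> : (pi ^+ 2)%:C / 3 * E2 t = (pi ^+ 2)%:C / 3 + 2 * ip ^+ 2 * G.
  rewrite E2_psum eps2E psumD ?psumZ ?psum_delta //; [|exact: slow_sigma|exact: slow_delta|apply: slowZ; exact: slow_sigma].
  by rewrite -/G ip_sq; field.
apply/cvg_series_shift; rewrite addrAC subrr add0r.
rewrite (_ : series _ = (fun n => 2 * ip ^+ 2 * series (fun m => psum (fun n => n%:R) (qexp 1 t ^+ m.+1)) n)).
  by apply: cvgMl_tmp; exact: L.
apply/funext => n; rewrite /series /= mulr_sumr; apply: eq_bigr => k _.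
have kt : 0 < complex.Im (k.+1%:R * val t) by rewrite Im_natmul mulr_gt0 ?ltr0n ?uhp_Im.
rewrite /e2row /= mulrNz mulNr -[_%:~R]pmulrn kap_even ?e2pi_neq1 ?gt_eqF // kapE //.
by rewrite e2piMn /qexp divr1; ring.
Qed.

End EisensteinTwo.

(** * The behaviour of E2 under t |-> -1/t *)

Section EisensteinTwoInversion.
Variable R : realType.
Local Notation C := R[i].
Local Notation H := (uhp R).
Local Notation ip := (two_pi_i R).

Lemma zsum_telescope (g : int -> C) l1 l2 :
  g (- M%:Z) @[M --> \oo] --> l1 -> g (M%:Z + 1) @[M --> \oo] --> l2 ->
  zsum (fun k => g k - g (k + 1)) (l1 - l2).
Proof.
move=> h1 h2; rewrite /zsum -(cvg_shiftS (series _)).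
rewrite (_ : (fun M => _) = (fun M => g (- M%:Z) - g (M%:Z + 1))).
  by apply: cvgB; [exact: h1|exact: h2].
apply/funext => M; rewrite /series /= zfold_sum.
have E n : \sum_(i < n) (g (i%:Z - M%:Z) - g (i%:Z - M%:Z + 1)) = g (- M%:Z) - g (n%:Z - M%:Z).
  elim: n => [|n IHn]; first by rewrite big_ord0 add0r subrr.
  rewrite big_ord_recr /= IHn (_ : n%:Z - M%:Z + 1 = n.+1%:Z - M%:Z); last by lia.
  by rewrite addrA subrK.
by rewrite E; congr (_ - g _); lia.
Qed.

Lemma cvg_inv_affine (x : C) (s : nat -> C) : (forall M, normc (s M) = M%:R) ->
  (x + s M)^-1 @[M --> \oo] --> 0.
Proof.
move=> hs; apply/cvgcP => e e0; near=> M.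
rewrite sub0r normcN normcV.
have h : normc x + e^-1 < M%:R by near: M; exact: nbhs_infty_gtr.
have := lB_normcD (s M) x; rewrite hs [s M + x]addrC => h2.
have e1 : 0 < e^-1 by rewrite invr_gt0.
have h3 : e^-1 < normc (x + s M) by lra.
by rewrite -[ltRHS]invrK ltf_pV2 ?posrE // (lt_trans e1).
Unshelve. all: by end_near. Qed.

Lemma quadratic_form_ge (t : H) : exists2 k : R, 0 < k & forall x y : R,
  k * (x ^+ 2 + y ^+ 2) <= normc (x%:C * val t + y%:C) ^+ 2.
Proof.
have t0 := uhp_Im t; case: (val t) t0 => u v /= v0.
(* Determinant over trace of the form |x t + y|^2, a lower bound for its smaller eigenvalue. *)
exists (v ^+ 2 / (1 + u ^+ 2 + v ^+ 2)); first by rewrite divr_gt0; nra.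
move=> x y; rewrite mulrAC ler_pdivrMr; last by nra.
rewrite sqr_sqrtr ?addr_ge0 ?sqr_ge0 //.
rewrite -subr_ge0 (_ : _ - _ = ((u ^+ 2 + v ^+ 2) * x + u * y) ^+ 2 + (u * x + y) ^+ 2); last by ring.
by rewrite addr_ge0 ?sqr_ge0.
Qed.

(* The double series of (m t + n)^-2 converges only conditionally.  Subtracting
   the terms [dd], which telescope along the rows, makes it absolutely
   convergent; its row sums give [E2 t], while its column sums give E2(-1/t) and,
   from [dd], the defect of modularity. *)
Let cc (t : H) (m n : int) : C := (m%:~R * val t + n%:~R)^-2.
Let dd (t : H) (m n : int) : C :=
  (m%:~R * val t + n%:~R - 2^-1)^-1 - (m%:~R * val t + n%:~R + 2^-1)^-1.

Lemma cc_dd_bound (t : H) : exists B, forall m n,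
  normc (cc t m n - dd t m n) <= B * usq R `|m| * usq R `|n|.
Proof.
have [k k0 hk] := quadratic_form_ge t.
(* The summand 4 takes care of m = n = 0, where [cc] is 0 and [dd] is - 4. Elsewhere, with w = m t +
   n, the difference is - 1 / (4 w^2 (w^2 - 1/4)), of order 4. *)
exists (4 / k ^+ 2 + 4) => m n.
have kk : 0 < k ^+ 2 by rewrite exprn_gt0.
have um := usq_gt0 R `|m|; have un := usq_gt0 R `|n|.
have [mn0|mn0] := boolP ((m == 0) && (n == 0)).
  case/andP: mn0 => /eqP -> /eqP ->.
  rewrite /cc /dd mul0r addr0 expr0n invr0 !add0r invrN invrK.
  rewrite (_ : - (- 2 - 2) = 4); last by ring.
  rewrite normc_nat /usq expr0n addr0 invr1 !mulr1.
  by rewrite lerDr divr_ge0 // ltW.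
have sqE (j : int) : (`|j|%N)%:R ^+ 2 = j%:~R ^+ 2 :> R.
  by rewrite -[RHS]real_normK ?num_real // -intr_norm -abszE.
have castE (j : int) : j%:~R = (j%:~R : R)%:C :> C by rewrite rmorph_int.
have halfE : 2^-1 = (2^-1 : R)%:C :> C by rewrite fmorphV rmorph_nat.
pose x : R := m%:~R; pose y : R := n%:~R.
have Q1 : 1 <= x ^+ 2 + y ^+ 2.
  rewrite /x /y -!rmorphXn -rmorphD /= ler1z.
  by move: mn0; rewrite negb_and => /orP[] /eqP; nia.
(* This uses that n is an integer; it keeps w + 1/2 and w - 1/2 away from 0. *)
have n_half (s : R) : s = 2^-1 \/ s = - 2^-1 -> y ^+ 2 / 4 <= (y + s) ^+ 2.
  have : y ^+ 2 <= 0 \/ 1 <= y ^+ 2 /\ (y <= -1 \/ 1 <= y).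
    rewrite /y; have [->|[h|h]] : n = 0 \/ (1 <= n \/ n <= -1) by lia.
    - by left; rewrite expr0n.
    - by right; have : 1 <= n%:~R :> R by [rewrite ler1z]; nra.
    - by right; have : n%:~R <= (-1)%:~R :> R by [rewrite ler_int]; rewrite mulrNz; nra.
  by move=> h [] ->; case: h => [h|[h [h'|h']]]; nra.
set w := m%:~R * val t + n%:~R.
have hw : k * (x ^+ 2 + y ^+ 2) <= normc w ^+ 2 by rewrite /w !castE; exact: hk.
have hws (s : R) : s = 2^-1 \/ s = - 2^-1 -> k / 4 * (x ^+ 2 + y ^+ 2) <= normc (w + s%:C) ^+ 2.
  move=> hs; have := hk x (y + s); rewrite rmorphD /= addrA /x /y -!castE -/w -/x -/y.
  apply: le_trans; rewrite -mulrA ler_pM2l //; have := n_half s hs; have := sqr_ge0 x; lra.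
have hp := hws _ (or_introl erefl); have hm := hws _ (or_intror erefl).
rewrite -halfE in hp; rewrite rmorphN /= -halfE in hm.
set Q := x ^+ 2 + y ^+ 2 in Q1 hw hp hm.
have Q0 : 0 < k / 4 * Q by rewrite mulr_gt0 ?divr_gt0 // (lt_le_trans _ Q1).
have Q0' : 0 < k * Q by rewrite mulr_gt0 // (lt_le_trans _ Q1).
have nz0 (z : C) c : 0 < c -> c <= normc z ^+ 2 -> z != 0.
  by move=> c0 cz; apply: contraTneq (lt_le_trans c0 cz) => ->; rewrite normc0 expr0n ltxx.
have w0 := nz0 _ _ Q0' hw; have p0 := nz0 _ _ Q0 hp; have m0 := nz0 _ _ Q0 hm.
have -> : cc t m n - dd t m n = - (4 * w ^+ 2 * ((w + 2^-1) * (w - 2^-1)))^-1.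
  have E1 : (w - 2^-1)^-1 - (w + 2^-1)^-1 = ((w + 2^-1) * (w - 2^-1))^-1.
    have d1 : (w + 2^-1) - (w - 2^-1) = 1 by field.
    move: (w + _) (w - _) p0 m0 d1 => p q p0 q0 d1.
    by rewrite -[RHS]mul1r -d1; field; rewrite p0 q0.
  rewrite /cc /dd -/w E1.
  have d2 : (w + 2^-1) * (w - 2^-1) - w ^+ 2 = - 4^-1 by field.
  have pm0 : (w + 2^-1) * (w - 2^-1) != 0 by rewrite mulf_neq0.
  move: (_ * _) pm0 d2 => p pn0 d2.
  have -> : w ^- 2 - p^-1 = (p - w ^+ 2) / (w ^+ 2 * p) by field; rewrite pn0 w0.
  by rewrite d2; field; rewrite pn0 w0.
rewrite normcN normcV (normcM (4 * _)) (normcM 4) (normcM (w + _)) (normcX w) normc_nat.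
have hpm : k / 4 * Q <= normc (w + 2^-1) * normc (w - 2^-1).
  rewrite -(@ler_pXn2r _ 2) ?nnegrE ?(ltW Q0) //; last by rewrite mulr_ge0 ?normc_ge0.
  by rewrite [leRHS]exprMn [leLHS]expr2; apply: ler_pM hp hm; exact: ltW.
have big : k ^+ 2 * Q ^+ 2 <= 4 * normc w ^+ 2 * (normc (w + 2^-1) * normc (w - 2^-1)).
  have := ler_pM (ltW Q0') (ltW Q0) hw hpm; lra.
(* As Q >= 1, both 1 + m^2 and 1 + n^2 are at most 2 Q. *)
have u4 : (4 * Q ^+ 2)^-1 <= usq R `|m| * usq R `|n|.
  rewrite /usq !sqE -/x -/y -invfM lef_pV2 ?posrE; rewrite /Q in Q1 *; have := sqr_ge0 x; have := sqr_ge0 y; nra.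
rewrite (le_trans (y := (k ^+ 2 * Q ^+ 2)^-1)) //.
  by rewrite lef_pV2 ?posrE // ?(lt_le_trans _ big) // mulr_gt0 ?exprn_gt0 // (lt_le_trans _ Q1).
rewrite (_ : (_ * _)^-1 = 4 / k ^+ 2 * (4 * Q ^+ 2)^-1); last first.
  by field; rewrite !gt_eqF // (lt_le_trans _ Q1).
rewrite -[leRHS]mulrA (le_trans (ler_wpM2l _ u4)) ?divr_ge0 ?(ltW kk) //.
by rewrite ler_wpM2r ?mulr_ge0 ?(ltW um) ?(ltW un) // lerDl.
Qed.

Lemma e2pi_intmul_neq1 (t : H) (m : int) : m != 0 -> e2pi (m%:~R * val t) != 1.
Proof. by move=> m0; rewrite e2pi_neq1 // Im_intmul mulf_neq0 ?intr_eq0 // gt_eqF // uhp_Im. Qed.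

Lemma zsum_row (t : H) m : zsum (fun n => cc t m n - dd t m n) (e2row (val t) m).
Proof.
rewrite -[e2row _ _]subr0; apply: zsumB.
  rewrite /e2row; have [->|m0] := eqVneq m 0.
    by have := @zsum_inv_sq R; congr zsum; apply/funext => n; rewrite /cc mul0r add0r.
  by rewrite /cc; apply: zsum_kap; exact: e2pi_intmul_neq1.
pose g (n : int) : C := (m%:~R * val t + n%:~R - 2^-1)^-1.
have := @zsum_telescope g 0 0; rewrite subrr => h.
have : zsum (fun k => g k - g (k + 1)) 0.
  apply: h.
    rewrite /g; under eq_fun do rewrite addrAC.
    by apply: cvg_inv_affine => M; rewrite normc_int mulrNz normrN ger0_norm.
  rewrite (_ : (fun M => _) = (fun M => (m%:~R * val t + 2^-1 + M%:R)^-1)).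
    by apply: cvg_inv_affine => M; rewrite normc_nat.
  by apply/funext => M; rewrite /g rmorphD /=; congr (_^-1); field.
congr zsum; apply/funext => n; rewrite /g /dd; congr (_ - _^-1).
by rewrite rmorphD /=; field.
Qed.

(** Column sums: the first part comes from [cc], after t^-2 is taken out, the second from [dd] by
    [zsum_phi]. *)
Definition e2col (t t' : H) (n : int) : C :=
  (val t)^-2 * e2row (val t') n -
  (val t)^-1 * (- ip * (phi ((n%:~R - 2^-1) / val t) - phi ((n%:~R + 2^-1) / val t))).

Lemma e2pi_half_neq1 (t t' : H) (x : R) : val t' = - (val t)^-1 -> x != 0 ->
  e2pi (x%:C / val t) != 1.
Proof.
move=> tt' x0; have -> : (val t)^-1 = - val t' by rewrite tt' opprK.
have := uhp_Im t'; case: (val t') => u v /= v0; rewrite e2pi_neq1 //=.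
by rewrite mul0r addr0 mulrN oppr_eq0 mulf_neq0 // gt_eqF.
Qed.

Lemma half_castE (n : int) (s : R) : n%:~R + s%:C = (n%:~R + s)%:C :> C.
Proof. by rewrite rmorphD /= rmorph_int. Qed.

Lemma half_neq0 (n : int) (s : R) : s = 2^-1 \/ s = - 2^-1 -> n%:~R + s != 0.
Proof.
have h (k : int) : k%:~R * 2 + 1 != 0 :> R.
  by rewrite -[1]/(1%:~R) -[2]/(2%:~R) -intrM -intrD intr_eq0; lia.
case=> ->; apply/eqP => E.
  by have /eqP := h n; apply; lra.
by have /eqP := h (n - 1); apply; rewrite intrB; lra.
Qed.

Lemma zsum_col (t t' : H) n : val t' = - (val t)^-1 ->
  zsum (fun m => cc t m n - dd t m n) (e2col t t' n).
Proof.
move=> tt'; have t0 := uhp_neq0 t; rewrite /e2col; apply: zsumB.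
  rewrite (_ : (fun m => _) = (fun m => (val t)^-2 * (n%:~R / val t + m%:~R)^-2)); last first.
    apply/funext => m; rewrite /cc -invfM -exprMn; congr ((_ ^+ 2)^-1).
    by rewrite mulrDr mulrCA divff // mulr1 addrC mulrC.
  apply: zsumZ; rewrite /e2row; have [->|n0] := eqVneq n 0.
    by have := @zsum_inv_sq R; congr zsum; apply/funext => m; rewrite mul0r add0r.
  have -> : n%:~R / val t = - (n%:~R * val t') by rewrite tt' mulrN opprK.
  have n1 := e2pi_intmul_neq1 t' n0.
  rewrite -kap_even //; apply: zsum_kap.
  by rewrite e2piN invr_eq1.
have hE : 2^-1 = (2^-1 : R)%:C :> C by rewrite fmorphV rmorph_nat.
have a1 : e2pi ((n%:~R - 2^-1) / val t) != 1.
  rewrite hE -rmorphN half_castE; apply: (e2pi_half_neq1 tt').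
  by apply: half_neq0; right.
have b1 : e2pi ((n%:~R + 2^-1) / val t) != 1.
  rewrite hE half_castE; apply: (e2pi_half_neq1 tt').
  by apply: half_neq0; left.
have := zsumZ (c := (val t)^-1) (zsum_phi a1 b1); congr zsum; apply/funext => m.
rewrite /dd mulrBr -!invfM; congr (_^-1 - _^-1); rewrite mulrDr mulrCA divff // mulr1; ring.
Qed.

Lemma cvg_phi1 (t : H) (z : C) : phi (z + M%:R * val t) @[M --> \oo] --> (1 : C).
Proof.
have q1 : normc (e2pi (val t)) < 1 by rewrite e2pi_normc_lt1 ?uhp_Im.
rewrite -[X in _ --> X]invr1; apply: cvgV; first exact: oner_neq0.
apply: (@cvgc_squeeze _ _ _ _ _ _ (fun M => normc (e2pi z) * normc (e2pi (val t)) ^+ M)).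
  by apply: nearW => M; rewrite subKr e2piD e2piMn normcM normcX.
rewrite -[X in _ --> X](mulr0 (normc (e2pi z))); apply: cvgMl_tmp; apply: cvg_expr.
by rewrite ger0_norm ?normc_ge0.
Qed.

(** [phi] tends to 1 or to 0 as the imaginary part of its argument tends to plus or minus infinity.
    The resulting 1 is the defect of modularity of E2: along the rows the same terms telescope to
    0. *)
Lemma zsum_phi_telescope (t t' : H) : val t' = - (val t)^-1 ->
  zsum (fun n : int => phi ((n%:~R - 2^-1) / val t) - phi ((n%:~R + 2^-1) / val t)) 1.
Proof.
move=> tt'; pose g (n : int) := phi ((n%:~R - 2^-1) / val t).
have tE : (val t)^-1 = - val t' by rewrite tt' opprK.
have c1 := @cvg_phi1 t' (2^-1 * val t').
have := @zsum_telescope g 1 0; rewrite subr0 => h.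
have : zsum (fun k => g k - g (k + 1)) 1.
  apply: h.
    rewrite (_ : (fun M => _) = (fun M => phi (2^-1 * val t' + M%:R * val t'))); first exact: c1.
    by apply/funext => M; rewrite /g tE; congr phi; rewrite mulrNz -pmulrn; ring.
  rewrite (_ : (fun M => _) = (fun M => 1 - phi (2^-1 * val t' + M%:R * val t'))).
    have := cvgB (@cvg_cst _ (1 : C) _ _ _) c1; rewrite subrr; apply.
  apply/funext => M; rewrite /g -phiN; last first.
    have -> : 2^-1 * val t' + M%:R * val t' = (M%:R + 2^-1 : R)%:C * val t'.
      by rewrite rmorphD fmorphV !rmorph_nat; ring.
    have := uhp_Im t'; case: (val t') => u v /= v0; rewrite e2pi_neq1 //=.
    by rewrite mul0r addr0 mulf_neq0 // gt_eqF // ltr_wpDl // invr_gt0.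
  by congr phi; rewrite tE rmorphD /= -pmulrn; field.
congr zsum; apply/funext => n; rewrite /g.
by have -> : (n + 1)%:~R - 2^-1 = n%:~R + 2^-1 :> C by rewrite rmorphD /=; field.
Qed.

Lemma E2_inversion (t t' : H) : val t' = - (val t)^-1 ->
  E2 t' = val t ^+ 2 * E2 t + 12 / ip * val t.
Proof.
move=> tt'; have [B hB] := cc_dd_bound t.
have h1 := @zsum_exchange R _ B _ _ _ hB (@zsum_row t) (fun n => @zsum_col t t' n tt') (@zsum_e2row R t).
have h2 : zsum (e2col t t') ((val t)^-2 * ((pi ^+ 2)%:C / 3 * E2 t') - (val t)^-1 * (- ip * 1)).
  apply: zsumB; first by apply: zsumZ; exact: zsum_e2row.
  by do 2 apply: zsumZ; exact: (zsum_phi_telescope tt').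
have := zsum_unique h1 h2; rewrite mulr1.
have ip0 := two_pi_i_neq0 R; have t0 := uhp_neq0 t.
have -> : (pi ^+ 2)%:C = - ip ^+ 2 / 4 :> C by rewrite ip_sq; field.
move: (val t) ip t0 ip0 => x c x0 c0 E.
have {}E : E2 t * x ^+ 2 = E2 t' - 12 / c * x.
  apply: (mulfI (_ : - c ^+ 2 / 4 / 3 != 0)).
    by rewrite !mulf_neq0 ?oppr_eq0 ?expf_neq0 ?invr_eq0 ?pnatr_eq0.
  rewrite mulrA E; field; rewrite c0 x0 //.
by rewrite [x ^+ 2 * _]mulrC E subrK.
Qed.

End EisensteinTwoInversion.

(** * Generators of the modular group and of Gamma_0(2) *)

Section ModularGroup.

Definition mx2 (a b c d : int) : 'M[int]_2 :=
  \matrix_(i < 2, j < 2) if i == 0 then (if j == 0 then a else b)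
                         else (if j == 0 then c else d).

Lemma mx2E (g : 'M[int]_2) : g = mx2 (g 0 0) (g 0 1) (g 1 0) (g 1 1).
Proof.
apply/matrixP => i j; rewrite !mxE.
by case: i => -[|[|//]] hi; case: j => -[|[|//]] hj /=; congr (g _ _); exact: val_inj.
Qed.

Lemma mx2_00 a b c d : mx2 a b c d 0 0 = a. Proof. by rewrite mxE. Qed.
Lemma mx2_01 a b c d : mx2 a b c d 0 1 = b. Proof. by rewrite mxE. Qed.
Lemma mx2_10 a b c d : mx2 a b c d 1 0 = c. Proof. by rewrite mxE. Qed.
Lemma mx2_11 a b c d : mx2 a b c d 1 1 = d. Proof. by rewrite mxE. Qed.
Definition mx2_ij := (mx2_00, mx2_01, mx2_10, mx2_11).

Lemma mx2P (g h : 'M[int]_2) : [/\ g 0 0 = h 0 0, g 0 1 = h 0 1, g 1 0 = h 1 0 & g 1 1 = h 1 1] -> g = h.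
Proof. by case=> h1 h2 h3 h4; rewrite (mx2E g) (mx2E h) h1 h2 h3 h4. Qed.

Lemma mx2M_ij (g h : 'M[int]_2) i j : (g * h) i j = g i 0 * h 0 j + g i 1 * h 1 j.
Proof.
by rewrite mxE big_ord_recl big_ord1; congr (_ + g _ _ * h _ _); exact: val_inj.
Qed.

Lemma mx2M a b c d a' b' c' d' : mx2 a b c d * mx2 a' b' c' d' =
  mx2 (a * a' + b * c') (a * b' + b * d') (c * a' + d * c') (c * b' + d * d').
Proof. by apply: mx2P; rewrite !mx2M_ij !mx2_ij. Qed.

Lemma det_mx2 (g : 'M[int]_2) : \det g = g 0 0 * g 1 1 - g 0 1 * g 1 0.
Proof.
rewrite (expand_det_row _ 0) big_ord_recl big_ord1 /cofactor !det_mx11 !mxE /=.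
rewrite expr0 mul1r expr1 mulN1r mulrN.
by congr (_ * g _ _ - g _ _ * g _ _); apply/val_inj.
Qed.

Lemma SL2ZP g : SL2Z g <-> g 0 0 * g 1 1 - g 0 1 * g 1 0 = 1.
Proof. by rewrite -det_mx2. Qed.

Lemma SL2Z_mx2 a b c d : SL2Z (mx2 a b c d) <-> a * d - b * c = 1.
Proof. by rewrite SL2ZP !mx2_ij. Qed.

Lemma one_mx2 : 1 = mx2 1 0 0 1.
Proof. by apply: mx2P; rewrite !mx2_ij !mxE. Qed.

Lemma SL2Z1 : SL2Z 1.
Proof. by rewrite one_mx2 SL2Z_mx2. Qed.

Lemma SL2ZM g h : SL2Z g -> SL2Z h -> SL2Z (g * h).
Proof. by rewrite /SL2Z /= det_mulmx => -> ->; rewrite mulr1. Qed.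

Definition inv2 (g : 'M[int]_2) := mx2 (g 1 1) (- g 0 1) (- g 1 0) (g 0 0).

Lemma mul_inv2 g : SL2Z g -> g * inv2 g = 1.
Proof.
move=> /SL2ZP h; apply: mx2P; rewrite !mx2M_ij /inv2 one_mx2 !mx2_ij -h; split; ring.
Qed.

Lemma inv2_mul g : SL2Z g -> inv2 g * g = 1.
Proof.
move=> /SL2ZP h; apply: mx2P; rewrite !mx2M_ij /inv2 one_mx2 !mx2_ij -h; split; ring.
Qed.

Lemma SL2Z_inv2 g : SL2Z g -> SL2Z (inv2 g).
Proof. by move=> /SL2ZP h; rewrite SL2Z_mx2 -h; ring. Qed.

Lemma invg2E g : SL2Z g -> g^-1 = inv2 g.
Proof.
move=> hg; have u : g \is a GRing.unit.
  by apply/unitrP; exists (inv2 g); rewrite mul_inv2 // inv2_mul.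
by rewrite -[g^-1]mulr1 -(mul_inv2 hg) mulKr.
Qed.

Lemma Gamma0_SL2Z g : Gamma0_2 g -> SL2Z g. Proof. by case. Qed.

Lemma Gamma0M g h : Gamma0_2 g -> Gamma0_2 h -> Gamma0_2 (g * h).
Proof.
move=> [g1 g2] [h1 h2]; split; first exact: SL2ZM.
by rewrite mx2M_ij; apply: rpredD; [exact: dvdz_mulr|exact: dvdz_mull].
Qed.

Lemma Tmx_mx2 : Tmx = mx2 1 1 0 1.
Proof. by apply: mx2P; rewrite !mx2_ij !mxE. Qed.

Lemma TmxX n : Tmx ^+ n = mx2 1 n%:Z 0 1.
Proof.
elim: n => [|n IHn]; first by rewrite expr0 one_mx2.
by rewrite exprS IHn Tmx_mx2 mx2M; congr mx2; lia.
Qed.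

Lemma SL2Z_TmxX n : SL2Z (Tmx ^+ n).
Proof. by rewrite TmxX SL2Z_mx2 mulr1 mulr0 subr0. Qed.

Definition Smx := mx2 0 (-1) 1 0.

Lemma SL2Z_Smx : SL2Z Smx.
Proof. by rewrite SL2Z_mx2. Qed.

Lemma conj_TmxX g n : SL2Z g -> (g * Tmx ^+ n * g^-1) 1 0 = - (g 1 0 ^+ 2 * n%:Z).
Proof.
move=> hg; rewrite invg2E // TmxX mx2M_ij !(mx2M_ij g) /inv2 !mx2_ij; ring.
Qed.

(** The lower left entry of g T^n g^-1 is - c^2 n, and c = 1 for [Smx]. *)
Lemma T_power_in_conjugatesE N : T_power_in_conjugates N <-> (0 < N)%N /\ (2 %| N)%N.
Proof.
split=> [[N0 h]|[N0 h]]; split=> //.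
  have [_] := h _ SL2Z_Smx; rewrite conj_TmxX ?mx2_ij; last exact: SL2Z_Smx.
  by rewrite rpredN expr1n mul1r.
move=> g hg; split.
  rewrite invg2E //; apply: SL2ZM; last exact: SL2Z_inv2.
  by apply: SL2ZM => //; exact: SL2Z_TmxX.
by rewrite conj_TmxX // rpredN; exact: dvdz_mull.
Qed.

Lemma is_cusp_period2 N : is_cusp_period N <-> N = 2%N.
Proof.
split=> [[/T_power_in_conjugatesE[N0 N2] h]|->].
  have := h 2%N; rewrite T_power_in_conjugatesE => /(_ (conj isT isT)).
  by move: N0 N2; case: N {h} => [|[|[|//]]].
split; first by rewrite T_power_in_conjugatesE.
by move=> M /T_power_in_conjugatesE[M0 M2]; exact: dvdn_leq.
Qed.

(** The bottom row modulo 2 decides the coset: (0, 1), (1, 0) or (1, 1), with representatives 1, S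
    and S T. *)
Lemma Gamma0_cosets g : SL2Z g -> Gamma0_2 g \/
  exists2 gamma, Gamma0_2 gamma & exists j, g = gamma * Smx * Tmx ^+ j.
Proof.
move=> hg; have [c2|c2] := boolP (2 %| g 1%R 0%R)%Z; [by left|right].
pose j : nat := if (2 %| g 1%R 1%R)%Z then 0%N else 1%N.
pose w := Smx * Tmx ^+ j.
have hw : SL2Z w by apply: SL2ZM; [exact: SL2Z_Smx|exact: SL2Z_TmxX].
exists (g * inv2 w); last first.
  by exists j; rewrite -!mulrA -/w inv2_mul // mulr1.
split; first by apply: SL2ZM => //; exact: SL2Z_inv2.
rewrite mx2M_ij /inv2 !mx2_ij /w TmxX /Smx mx2M !mx2_ij /j.
by case: ifP => d2; lia.
Qed.

Lemma SL2Z_Tz (n : int) : SL2Z (mx2 1 n 0 1).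
Proof. by rewrite SL2Z_mx2; ring. Qed.

Lemma T_int_ind (P : 'M[int]_2 -> Prop) : P (mx2 1 1 0 1) -> P (mx2 1 (-1) 0 1) ->
  (forall m n, P (mx2 1 m 0 1) -> P (mx2 1 n 0 1) -> P (mx2 1 (m + n) 0 1)) ->
  forall n, P (mx2 1 n 0 1).
Proof.
move=> P1 PN1 PM.
have P0 : P (mx2 1 0 0 1) by have := PM _ _ P1 PN1; rewrite subrr.
case=> n; first by elim: n => [//|n IHn]; have := PM _ _ P1 IHn; congr (P (mx2 _ _ _ _)); lia.
rewrite NegzE; elim: n => [//|n IHn]; have := PM _ _ PN1 IHn.
by congr (P (mx2 _ _ _ _)); lia.
Qed.

Lemma intmul_eq1 (a d : int) : a * d = 1 -> (a = 1 /\ d = 1) \/ (a = -1 /\ d = -1).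
Proof.
move=> ad; have /eqP : (`|a| * `|d|)%N = 1%N by rewrite -abszM ad.
by rewrite muln_eq1 => /andP[/eqP a1 /eqP d1]; nia.
Qed.

(** Euclid's algorithm on the first column. The property is closed under products only, hence the
    separate hypothesis for the inverse of T. *)
Lemma SL2Z_ind (P : 'M[int]_2 -> Prop) :
  P Smx -> P (mx2 1 1 0 1) -> P (mx2 1 (-1) 0 1) ->
  (forall g h, SL2Z g -> SL2Z h -> P g -> P h -> P (g * h)) ->
  forall g, SL2Z g -> P g.
Proof.
move=> PS PT PT' PM.
have PTn : forall n, P (mx2 1 n 0 1).
  apply: T_int_ind => // m n Pm Pn.
  have := PM _ _ (SL2Z_Tz m) (SL2Z_Tz n) Pm Pn; rewrite mx2M.
  by congr (P (mx2 _ _ _ _)); ring.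
have hS := SL2Z_Smx.
have PN : P (mx2 (-1) 0 0 (-1)) by have := PM _ _ hS hS PS PS; rewrite mx2M.
have hN : SL2Z (mx2 (-1) 0 0 (-1)) by rewrite SL2Z_mx2.
have hS3 : SL2Z (mx2 0 1 (-1) 0) by rewrite SL2Z_mx2.
have PS3 : P (mx2 0 1 (-1) 0) by have := PM _ _ hN hS PN PS; rewrite mx2M.
move=> g; have [m hm] := ubnP `|g 1%R 0%R|%N; elim: m g hm => // m IHm g hm hg.
have := (SL2ZP g).1 hg; rewrite (mx2E g) !mx2_ij.
move: (g 0 0) (g 0 1) (g 1 0) (g 1 1) hm => a b c d hm det1.
have [c0|c0] := eqVneq c 0.
  rewrite c0 in det1 *.
  have [[a1 d1]|[a1 d1]] : (a = 1 /\ d = 1) \/ (a = -1 /\ d = -1).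
    have ad : a * d = 1 by move: det1; rewrite mulr0 subr0.
    exact: intmul_eq1.
  by rewrite a1 d1.
  rewrite a1 d1; have := PM _ _ hN (SL2Z_Tz (- b)) PN (PTn _); rewrite mx2M.
  by congr (P (mx2 _ _ _ _)); ring.
(* The matrix is T^q times [mx2 0 1 (-1) 0] times a matrix with lower left entry r, and 0 <= r <
   |c|. *)
pose q := (a %/ c)%Z; pose r := (a %% c)%Z.
have ar : a = q * c + r by exact: divz_eq.
have r0 : 0 <= r by exact: modz_ge0.
have rc : r < `|c| by exact: ltz_mod.
have hg' : SL2Z (mx2 (- c) (- d) r (b - q * d)).
  by rewrite SL2Z_mx2 -det1 ar; ring.
have Pg' : P (mx2 (- c) (- d) r (b - q * d)).
  by apply: IHm => //; rewrite mx2_ij; lia.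
have h2 := SL2ZM hS3 hg'; have P2 := PM _ _ hS3 hg' PS3 Pg'.
have := PM _ _ (SL2Z_Tz q) h2 (PTn q) P2; rewrite !mx2M.
by congr (P (mx2 _ _ _ _)); rewrite ?ar; ring.
Qed.

Lemma balanced_divz (a c : int) : c != 0 -> exists q, 2 * `|a - q * c| <= `|c|.
Proof.
move=> c0; have E := divz_eq a c; have r0 := modz_ge0 a c0; have rc := ltz_mod a c0.
move: (a %/ c)%Z (a %% c)%Z E r0 rc => q r -> r0 rc.
have [h|h] := leP (2 * r) `|c|.
  by exists q; rewrite addrAC subrr add0r ger0_norm.
exists (q + (if 0 < c then 1 else -1)); case: ifP => c1.
  rewrite (_ : _ - _ = r - c); last by ring.
  by move: h rc; rewrite (gtr0_norm c1); lia.
rewrite (_ : _ - _ = r + c); last by ring.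
have c2 : c < 0 by lia.
by move: h rc; rewrite (ltr0_norm c2); lia.
Qed.

(** Here c can be changed only by multiples of 2a. Balanced remainders make Euclid's algorithm work
    nevertheless: 2|r| <= |c| and 2|c'| <= |2r| give |c'| <= |c| / 2. *)
Lemma Gamma0_ind (P : 'M[int]_2 -> Prop) :
  P (mx2 1 1 0 1) -> P (mx2 1 (-1) 0 1) -> P (mx2 1 0 2 1) -> P (mx2 1 0 (-2) 1) ->
  P (mx2 (-1) 0 0 (-1)) ->
  (forall g h, Gamma0_2 g -> Gamma0_2 h -> P g -> P h -> P (g * h)) ->
  forall g, Gamma0_2 g -> P g.
Proof.
move=> PT PT' PU PU' PN PM.
have GT n : Gamma0_2 (mx2 1 n 0 1) by split; [exact: SL2Z_Tz|rewrite mx2_ij].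
have GU n : Gamma0_2 (mx2 1 0 (2 * n) 1) by split; [rewrite SL2Z_mx2; ring|rewrite mx2_ij dvdz_mulr].
have GN : Gamma0_2 (mx2 (-1) 0 0 (-1)) by split; [rewrite SL2Z_mx2|rewrite mx2_ij].
have PTn : forall n, P (mx2 1 n 0 1).
  apply: T_int_ind => // m n Pm Pn; have := PM _ _ (GT m) (GT n) Pm Pn; rewrite mx2M.
  by congr (P (mx2 _ _ _ _)); ring.
have PUn : forall n, P (mx2 1 0 (2 * n) 1).
  move=> n; have := @T_int_ind (fun g => P (mx2 1 0 (2 * g 0 1) 1)); rewrite !mx2_ij.
  move=> /(_ PU PU') h; have := h _ n; rewrite mx2_ij; apply=> m k.
  rewrite !mx2_ij => Pm Pk; have := PM _ _ (GU m) (GU k) Pm Pk; rewrite mx2M.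
  by congr (P (mx2 _ _ _ _)); ring.
move=> g; have [m hm] := ubnP `|g 1%R 0%R|%N; elim: m g hm => // m IHm g hm hg.
have [/SL2ZP] := hg; rewrite (mx2E g) !mx2_ij.
move: (g 0 0) (g 0 1) (g 1 0) (g 1 1) hm => a b c d hm det1 c2.
have [c0|c0] := eqVneq c 0.
  rewrite c0 in det1 *.
  have [[a1 d1]|[a1 d1]] : (a = 1 /\ d = 1) \/ (a = -1 /\ d = -1).
    by apply: intmul_eq1; move: det1; rewrite mulr0 subr0.
  by rewrite a1 d1.
  rewrite a1 d1; have := PM _ _ GN (GT (- b)) PN (PTn _); rewrite mx2M.
  by congr (P (mx2 _ _ _ _)); ring.
have [q [r [ar hq]]] : exists q r, a = q * c + r /\ 2 * `|r| <= `|c|.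
  have [q hq] := balanced_divz a c0; exists q, (a - q * c); split=> //.
  by rewrite addrC subrK.
(* Otherwise c, which is even, would divide the determinant 1. *)
have r0 : r != 0.
  apply/eqP => r0; move: det1; rewrite ar r0; case/dvdzP: c2 => c' ->; lia.
have [p [c' [cE hp]]] : exists p c', c' = c - p * (2 * r) /\ 2 * `|c'| <= `|2 * r|.
  have [p hp] := balanced_divz c (mulf_neq0 (isT : (2 : int) != 0) r0).
  by exists p, (c - p * (2 * r)).
have hg' : Gamma0_2 (mx2 r (b - q * d) c' (d - 2 * p * (b - q * d))).
  split; first by rewrite SL2Z_mx2 -[RHS]det1 ar cE; ring.
  by rewrite mx2_ij cE; apply: rpredB => //; rewrite mulrCA; exact: dvdz_mulr.
have Pg' : P (mx2 r (b - q * d) c' (d - 2 * p * (b - q * d))).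
  by apply: IHm => //; rewrite mx2_ij; move: hq hp; lia.
have h2 := Gamma0M (GU p) hg'; have P2 := PM _ _ (GU p) hg' (PUn p) Pg'.
have := PM _ _ (GT q) h2 (PTn q) P2; rewrite !mx2M.
by congr (P (mx2 _ _ _ _)); rewrite ?ar ?cE ?ar; ring.
Qed.

End ModularGroup.

(** * The slash action and the modular derivative *)

Section Slash.
Variable R : realType.
Local Notation C := R[i].
Local Notation H := (uhp R).
Local Notation ip := (two_pi_i R).
Implicit Types (t : H) (g h : 'M[int]_2) (k l : int).

Definition jf g t : C := (g 1 0)%:~R * val t + (g 1 1)%:~R.

Lemma jf_neq0 g t : SL2Z g -> jf g t != 0.
Proof.
move=> /SL2ZP hg; apply/eqP => j0.
have := congr1 (@complex.Im R) j0; rewrite /jf Im_addz Im_intmul /= => /eqP.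
rewrite mulf_eq0 (gt_eqF (uhp_Im t)) orbF intr_eq0 => /eqP c0.
move: j0 hg; rewrite /jf c0 mul0r add0r => /eqP; rewrite intr_eq0 => /eqP ->.
by rewrite !mulr0 subrr.
Qed.

Lemma mobius_val g t : SL2Z g ->
  val (mobius g t) = ((g 0 0)%:~R * val t + (g 0 1)%:~R) / jf g t.
Proof. exact: mobiusE. Qed.

Lemma jfM g h t : SL2Z h -> jf (g * h) t = jf g (mobius h t) * jf h t.
Proof.
move=> hh; have j0 := jf_neq0 t hh.
rewrite {1}/jf !mx2M_ij {1}/jf mobius_val // mulrDl -mulrA divfK //.
by rewrite /jf !rmorphD !rmorphM /=; ring.
Qed.

Lemma mobiusM g h t : SL2Z g -> SL2Z h -> mobius (g * h) t = mobius g (mobius h t).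
Proof.
move=> hg hh; apply: val_inj; rewrite !mobius_val //; last exact: SL2ZM.
have j0 := jf_neq0 t hh; have := jf_neq0 (mobius h t) hg.
rewrite jfM //; move: (jf g _) => j j1; apply: (mulIf (mulf_neq0 j1 j0)).
rewrite divfK ?mulf_neq0 // mulrA divfK // mulrDl -mulrA divfK //.
by rewrite !mx2M_ij /jf !rmorphD !rmorphM /=; ring.
Qed.

Lemma jf1 t : jf 1 t = 1.
Proof. by rewrite /jf one_mx2 !mx2_ij mul0r add0r. Qed.

Lemma mobius1 t : mobius 1 t = t.
Proof.
apply: val_inj; rewrite mobius_val ?jf1; last exact: SL2Z1.
by rewrite one_mx2 !mx2_ij mul1r addr0 divr1.
Qed.

Section Vector.
Variable V : lmodType C.
Implicit Types F G : H -> V.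

Lemma slashE k g F t : slash k g F t = jf g t ^ (- k) *: F (mobius g t).
Proof. by []. Qed.

Lemma slashM k g h F : SL2Z g -> SL2Z h ->
  slash k (g * h) F = slash k h (slash k g F).
Proof.
move=> hg hh; apply/funext => t; rewrite !slashE jfM // mobiusM // exprzMl ?unitfE ?jf_neq0 //.
by rewrite scalerA mulrC.
Qed.

Lemma slash1 k F : slash k 1 F = F.
Proof. by apply/funext => t; rewrite slashE jf1 mobius1 exp1rz scale1r. Qed.

Lemma slashD k g F G : slash k g (fun t => F t + G t) = (fun t => slash k g F t + slash k g G t).
Proof. by apply/funext => t; rewrite !slashE scalerDr. Qed.

Lemma slashZ k g (c : C) F : slash k g (fun t => c *: F t) = (fun t => c *: slash k g F t).
Proof. by apply/funext => t; rewrite !slashE !scalerA mulrC. Qed.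

Lemma slash_scale k l g (f : H -> C) F : SL2Z g ->
  slash (k + l) g (fun t => f t *: F t) = (fun t => slash k g f t *: slash l g F t).
Proof.
move=> hg; apply/funext => t; rewrite !slashE opprD expfzDr ?jf_neq0 // !scalerA.
congr (_ *: _); rewrite /GRing.scale /=.
by rewrite mulrAC.
Qed.

Lemma slash_eq0 k g F : SL2Z g -> slash k g F = (fun=> 0) -> F = (fun=> 0).
Proof.
move=> hg h; rewrite -(slash1 k F) -(mul_inv2 hg) slashM // ?h; last exact: SL2Z_inv2.
by apply/funext => t; rewrite slashE scaler0.
Qed.

End Vector.

Lemma slash_mul k l g (f f' : H -> C) : SL2Z g ->
  slash (k + l) g (fun t => f t * f' t) = (fun t => slash k g f t * slash l g f' t).
Proof. by move=> hg; exact: (slash_scale k l f f' hg). Qed.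

Lemma slash_mulmx n m k g (F : H -> 'cV[C]_n) (P : 'M[C]_(m, n)) :
  slash k g (fun t => P *m F t) = (fun t => P *m slash k g F t).
Proof. by apply/funext => t; rewrite !slashE scalemxAr. Qed.

Lemma has_deriv_comp (m : H -> H) (m' : H -> C) (f f' : H -> C) :
  has_deriv (fun t => val (m t)) m' -> has_deriv f f' ->
  has_deriv (fun t => f (m t)) (fun t => f' (m t) * m' t).
Proof.
move=> hm hf.
apply: (has_deriv_eq (has_deriv_compl hm (g := ext0 f) (fun t => hf (m t)))) => // t.
by rewrite ext0_val.
Qed.

Lemma has_deriv_jf g : has_deriv (jf g) (fun=> (g 1 0)%:~R).
Proof.
apply: (has_deriv_eq (has_derivD (has_derivZ (g 1 0)%:~R (@has_deriv_id R)) (has_deriv_cst (g 1 1)%:~R))) => // t.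
by rewrite mulr1 addr0.
Qed.

Lemma SL2Z_detC g : SL2Z g ->
  (g 0 0)%:~R * (g 1 1)%:~R - (g 0 1)%:~R * (g 1 0)%:~R = 1 :> C.
Proof. by move=> /SL2ZP h; rewrite -!intrM -intrB h. Qed.

Lemma has_deriv_mobius g : SL2Z g ->
  has_deriv (fun t => val (mobius g t)) (fun t => (jf g t)^-2).
Proof.
move=> hg; have j0 t := jf_neq0 t hg.
have hn : has_deriv (fun t => (g 0 0)%:~R * val t + (g 0 1)%:~R) (fun=> (g 0 0)%:~R).
  apply: (has_deriv_eq (has_derivD (has_derivZ (g 0 0)%:~R (@has_deriv_id R)) (has_deriv_cst (g 0 1)%:~R))) => // t.
  by rewrite mulr1 addr0.
apply: (has_deriv_eq (has_derivM hn (has_derivV j0 (has_deriv_jf g)))) => t.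
  by rewrite mobius_val.
have := j0 t; have := SL2Z_detC hg; rewrite /jf.
move: ((g 0 0)%:~R : C) ((g 0 1)%:~R : C) ((g 1 0)%:~R : C) ((g 1 1)%:~R : C) => a' b' c' d' det.
move: det; move: (val t : C) => x det jn.
by rewrite -[RHS]mul1r -det; field.
Qed.

Lemma has_deriv_slash k g (f f' : H -> C) : SL2Z g -> has_deriv f f' ->
  has_deriv (slash k g f) (fun t => jf g t ^ (- k) * (f' (mobius g t) * (jf g t)^-2)
    + (- k)%:~R * jf g t ^ (- k - 1) * (g 1 0)%:~R * f (mobius g t)).
Proof.
move=> hg hf; have j0 t := jf_neq0 t hg.
have h1 := has_derivXz (- k) j0 (has_deriv_jf g).
have h2 := has_deriv_comp (has_deriv_mobius hg) hf.
exact: (has_deriv_eq (has_derivM h1 h2)).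
Qed.

(** The Serre derivative; [modular_derivative] is this one in every entry. *)
Definition sderiv k (f : H -> C) t : C :=
  ip^-1 * derive1 (ext0 f) (val t : C) - k%:~R / 12 * E2 t * f t.

Lemma sderivE k f f' : has_deriv f f' ->
  sderiv k f = (fun t => ip^-1 * f' t - k%:~R / 12 * E2 t * f t).
Proof. by move=> hf; apply/funext => t; rewrite /sderiv (has_deriv_derive1 t hf). Qed.

Lemma E2_periodic t t' (n : int) : val t' = val t + n%:~R -> E2 t' = E2 t.
Proof.
by move=> tt'; rewrite !E2_psum /qexp tt' mulrDl invr1 mulr1 e2piD mulr1 e2pi_int mulr1.
Qed.

(** The formula is compatible with products by the cocycle property of [jf], so the generators S and
    T suffice. *)
Lemma E2_slash g t : SL2Z g ->
  E2 (mobius g t) = jf g t ^+ 2 * E2 t + 12 / ip * (g 1 0)%:~R * jf g t.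
Proof.
move=> hg; elim/SL2Z_ind : g / hg t.
- move=> t; rewrite (@E2_inversion _ t); last first.
    rewrite mobius_val; last exact: SL2Z_Smx.
    by rewrite /jf /Smx !mx2_ij mul0r mul1r addr0 add0r mulrNz mulN1r.
  by rewrite /jf /Smx !mx2_ij mul1r addr0 mulr1.
- move=> t; rewrite (@E2_periodic t _ 1); last first.
    by rewrite mobius_val ?SL2Z_mx2 // /jf !mx2_ij mul0r add0r mul1r divr1.
  by rewrite /jf !mx2_ij mul0r add0r expr1n mul1r mulr0 mul0r addr0.
- move=> t; rewrite (@E2_periodic t _ (-1)); last first.
    by rewrite mobius_val ?SL2Z_mx2 // /jf !mx2_ij mul0r add0r mul1r divr1.
  by rewrite /jf !mx2_ij mul0r add0r expr1n mul1r mulr0 mul0r addr0.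
move=> g h hg hh IHg IHh t; have -> : mobius (g * h) t = mobius g (mobius h t) by exact: mobiusM.
have -> : jf (g * h) t = jf g (mobius h t) * jf h t by exact: jfM.
rewrite IHg IHh.
have E : (g 1 0)%:~R * 1 = ((g * h)%R 1 0)%:~R * jf h t - jf g (mobius h t) * jf h t * (h 1 0)%:~R.
  have <- : jf (g * h) t = jf g (mobius h t) * jf h t by exact: jfM.
  have := SL2Z_detC hh; rewrite /jf !mx2M_ij !intrD !intrM.
  move: (val t : C) ((g 1 0)%:~R : C) ((g 1 1)%:~R : C) ((h 0 0)%:~R : C) ((h 0 1)%:~R : C) ((h 1 0)%:~R : C) ((h 1 1)%:~R : C).
  by move=> x1 x2 x3 x4 x5 x6 x7 <-; ring.
rewrite mulr1 in E; rewrite E.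
move: (jf g _) (jf h t) (E2 t) ((h 1 0)%:~R : C) (((g * h)%R 1 0)%:~R : C) => p q e x y.
have := two_pi_i_neq0 R; move: ip => c c0; by field.
Qed.

(** The extra term of [E2_slash] cancels the derivative of the automorphy factor. *)
Lemma sderiv_slash k g (f : H -> C) : SL2Z g -> holomorphic f ->
  sderiv k (slash k g f) = slash (k + 2) g (sderiv k f).
Proof.
move=> hg /holomorphic_has_deriv; set f' := (X in has_deriv f X); move: f' => f' hf.
rewrite (sderivE _ (has_deriv_slash k hg hf)) (sderivE k hf).
apply/funext => t; rewrite !slashE E2_slash // /GRing.scale /=.
have j0 := jf_neq0 t hg; have ip0 := two_pi_i_neq0 R.
rewrite (_ : - (k + 2) = - k - 2); last by ring.
rewrite !expfzDr // -!exprnN expr1.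
move: (f' _) (f _) (E2 t) (jf g t) (jf g t ^ (- k)) ((g 1 0)%:~R : C) ip j0 ip0 => f'' f0 e j jk c i j0 i0.
rewrite rmorphN /=; move: (k%:~R : C) => k'.
by field; rewrite i0 j0.
Qed.

Lemma holomorphic_slash k g (f : H -> C) : SL2Z g -> holomorphic f -> holomorphic (slash k g f).
Proof.
move=> hg /holomorphic_has_deriv hf.
exact: has_deriv_holomorphic (has_deriv_slash k hg hf).
Qed.

Lemma modular_derivativeE n k (F : H -> 'cV[C]_n) t i :
  modular_derivative k F t i 0 = sderiv k (fun t => F t i 0) t.
Proof. by rewrite !mxE. Qed.

End Slash.

(** * Expansions at the cusps *)

Section Expansions.
Variable R : realType.
Local Notation C := R[i].
Local Notation H := (uhp R).
Local Notation ip := (two_pi_i R).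
Implicit Types (t : H) (f g : H -> C) (mu : C) (a b : nat -> C).

(** Every nonzero eigenvalue has exactly one exponent here. The bound 0 yields moderate growth, the
    bound 1 separates leading terms from those with a further factor exp(pi i t). *)
Definition strip mu := 0 <= complex.Re mu < 1.

(* The normal form of [has_expansion 2 mu f] when [mu] lies in the strip. *)
Definition qform mu f : Prop :=
  exists2 a, slow a & forall t, f t = e2pi (mu * val t / 2) * psum a (qexp 2 t).

Lemma e2pi_surj (z : C) : z != 0 -> exists2 mu, strip mu & e2pi mu = z.
Proof.
move=> z0; have n0 : 0 < normc z by rewrite normc_gt0.
pose u := z / (normc z)%:C.
have nC : (normc z)%:C != 0 :> C by rewrite eq_complex /= eqxx andbT gt_eqF.
have u1 : complex.Re u ^+ 2 + complex.Im u ^+ 2 = 1.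
  rewrite -sqr_normcE /u normc_div normc_real ger0_norm ?normc_ge0 //.
  by rewrite divff ?gt_eqF // expr1n.
have pi0 := pi_gt0 R.
have [x [xE yE]] : exists x, cos (2 * pi * x) = complex.Re u /\ sin (2 * pi * x) = complex.Im u.
  have ru : -1 <= complex.Re u <= 1.
    by have := sqr_ge0 (complex.Im u); move=> h; apply/andP; split; nra.
  have cE : cos (acos (complex.Re u)) = complex.Re u by rewrite acosK // in_itv.
  have sE : sin (acos (complex.Re u)) = `|complex.Im u|.
    rewrite sin_acos // -sqrtr_sqr; congr (Num.sqrt _).
    by rewrite -u1 addrAC subrr add0r.
  have [h|h] := leP 0 (complex.Im u).
    exists (acos (complex.Re u) / (2 * pi)); rewrite mulrC divfK ?mulf_neq0 ?gt_eqF //.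
    by rewrite cE sE ger0_norm.
  exists (- (acos (complex.Re u) / (2 * pi))); rewrite mulrN mulrC divfK ?mulf_neq0 ?gt_eqF //.
  by rewrite cosN sinN cE sE ltr0_norm // opprK.
pose y : R := - ln (normc z) / (2 * pi).
have E : e2pi (Complex x y) = z.
  rewrite /e2pi two_pi_iE /cexp /= xE yE.
  have -> : - (2 * pi) * y = ln (normc z) 
    by rewrite /y !mulNr mulrN opprK mulrC divfK // mulf_neq0 // gt_eqF.
  rewrite lnK ?posrE //.
  have zE : z = (normc z)%:C * u by rewrite mulrC divfK.
  by rewrite [RHS]zE; case: (u) => p q; simpc.
exists (Complex x y - (Num.floor x)%:~R).
  rewrite /strip raddfB /= (_ : complex.Re (_%:~R) = (Num.floor x)%:~R); last first.
    by rewrite -(rmorph_int (real_complex R)).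
  have := floor_le x; have := @floorD1_gt R x; rewrite intrD => h1 h2.
  by apply/andP; split; lra.
by rewrite e2piD -mulrNz e2pi_int mulr1.
Qed.

Lemma strip_inj mu nu : strip mu -> strip nu -> e2pi mu = e2pi nu -> mu = nu.
Proof.
move=> /andP[m0 m1] /andP[n0 n1] E.
have : e2pi (mu - nu) = 1 by rewrite e2piD e2piN E divff ?e2pi_neq0.
move=> /e2pi_eq1[m mE].
have RE : complex.Re mu - complex.Re nu = m%:~R.
  by rewrite -raddfB mE -(rmorph_int (real_complex R)).
have m2 : m = 0.
  have h1 : (-1 : R) < m%:~R by rewrite -RE; lra.
  have h2 : m%:~R < (1 : R) by rewrite -RE; lra.
  have h1' : (-1)%:~R < (m%:~R : R) by [].
  have h2' : (m%:~R : R) < 1%:~R by [].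
  by move: h1' h2'; rewrite !ltr_int; lia.
by apply/eqP; rewrite -subr_eq0 mE m2.
Qed.

Lemma cvg_series_eq (u v : nat -> C) (l : C) : u =1 v ->
  series u @ \oo --> l -> series v @ \oo --> l.
Proof. by move=> /funext ->. Qed.

Lemma sums_over_int_eq (u v : int -> C) (l : C) : u =1 v ->
  sums_over_int u l -> sums_over_int v l.
Proof. by move=> /funext ->. Qed.

Lemma cvg_series0 (u : nat -> C) : (forall k, u k = 0) -> series u @ \oo --> (0 : C).
Proof.
move=> u0; have -> : series u = fun=> 0; last exact: cvg_cst.
by apply/funext => n; rewrite /series /= big1.
Qed.

Lemma sums_over_int_succ (u : int -> C) (l : C) :
  sums_over_int u l -> sums_over_int (fun n => u (n + 1)) l.
Proof.
move=> [l1 [l2 [h1 h2 ->]]]; exists (l1 - u 0), (l2 + u 0); split; last by ring.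
  have /cvg_series_shift := h1.
  by apply: cvg_series_eq => k; congr u; lia.
apply/cvg_series_shift; rewrite addNr.
rewrite (_ : l2 + u 0 - u 0 = l2); last by ring.
by apply: (cvg_series_eq _ h2) => k; congr u; lia.
Qed.

Lemma sums_over_int_pred (u : int -> C) (l : C) :
  sums_over_int u l -> sums_over_int (fun n => u (n - 1)) l.
Proof.
move=> [l1 [l2 [h1 h2 ->]]]; exists (l1 + u (-1)), (l2 - u (-1)); split; last by ring.
  apply/cvg_series_shift; rewrite sub0r (_ : l1 + _ - _ = l1); last by ring.
  by apply: (cvg_series_eq _ h1) => k; congr u; lia.
have /cvg_series_shift := h2.
by apply: cvg_series_eq => k; congr u; lia.
Qed.

Lemma has_expansion_shift N mu f (m : int) :
  has_expansion N mu f -> has_expansion N (mu + m%:~R) f.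
Proof.
have up nu : has_expansion N nu f -> has_expansion N (nu + 1) f.
  move=> [a [a0 ha]]; exists (fun n => a (n + 1)); split=> [n|t].
    by move=> h; apply: a0; rewrite intrD -addrA [1 + _]addrC.
  apply: (sums_over_int_eq _ (sums_over_int_succ (ha t))) => n.
  by rewrite (_ : (n + 1)%:~R + nu = n%:~R + (nu + 1)) // intrD -addrA [1 + _]addrC.
have down nu : has_expansion N nu f -> has_expansion N (nu - 1) f.
  move=> [a [a0 ha]]; exists (fun n => a (n - 1)); split=> [n|t].
    by move=> h; apply: a0; rewrite intrB -addrA [- 1 + _]addrC.
  apply: (sums_over_int_eq _ (sums_over_int_pred (ha t))) => n.
  by rewrite (_ : (n - 1)%:~R + nu = n%:~R + (nu - 1)) // intrB -addrA [- 1 + _]addrC.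
move=> h; case: m => n.
  elim: n => [|n IHn]; first by rewrite addr0.
  by rewrite -addn1 PoszD intrD addrA; exact: up.
elim: n => [|n IHn]; first exact: down.
have := down _ IHn; rewrite -addrA !NegzE.
by rewrite (_ : - n.+2%:Z = - n.+1%:Z - 1) ?intrB //; lia.
Qed.

Lemma uhp_qexp (r : R) : 0 < r < 1 -> exists t, qexp 2 t = r%:C.
Proof.
move=> /andP[r0 r1]; have pi0 := pi_gt0 R.
have y0 : 0 < - ln r / pi by rewrite divr_gt0 // oppr_gt0 ln_lt0 // r0.
exists (@mkuhp R (Complex 0 (- ln r / pi)) y0).
rewrite /qexp /e2pi two_pi_iE divrn_complex /cexp /= mul0r mulr0 cos0 sin0 mulr1 mulr0.
have -> : - (2 * pi) * (- ln r / pi / 2) = ln r.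
  rewrite !mulNr mulrN opprK; move: (ln r) => x.
  by rewrite mulrC mulrA divfK // divfK // gt_eqF.
by rewrite lnK.
Qed.

(** For mu in the strip, Re(n + mu) < 0 means n < 0, so the coefficients of negative index vanish
    and a power series remains. *)
Lemma has_expansion_qform mu f : strip mu -> has_expansion 2 mu f <-> qform mu f.
Proof.
move=> /andP[m0 m1].
have Re_int (n : int) : complex.Re (n%:~R + mu) = n%:~R + complex.Re mu.
  by rewrite raddfD -(rmorph_int (real_complex R)).
have ReN n : complex.Re ((- n.+1%:Z)%:~R + mu) < 0.
  rewrite Re_int mulrNz -pmulrn -natr1; have := ler0n R n; lra.
have term (b : int -> C) (n : nat) t :
    b n%:Z * cexp (two_pi_i R * (n%:~R + mu) * val t / 2) =
    e2pi (mu * val t / 2) * (b n%:Z * qexp 2 t ^+ n).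
  rewrite -mulrA -mulrA -/(e2pi _) mulrA mulrDl mulrDl e2piD /qexp -e2piMn.
  by rewrite -pmulrn [n%:R * (_ / _)]mulrA [X in _ * X = _]mulrC mulrCA.
split=> [[a [a0 ha]]|[b sb hb]].
  have cv t : series (fun n : nat => a n%:Z * qexp 2 t ^+ n) @ \oo --> f t / e2pi (mu * val t / 2).
    have [l1 [l2 [h1 h2 fE]]] := ha t.
    have E0 : l2 = 0.
      apply: (cvgc_unique h2).
      by apply: cvg_series0 => k; rewrite a0 ?mul0r //; exact: ReN.
    rewrite fE E0 addr0 mulrC.
    rewrite (_ : series _ = (fun n => (e2pi (mu * val t / 2))^-1 *
      series (fun n : nat => a n%:Z * cexp (two_pi_i R * (n%:~R + mu) * val t / 2%:R)) n)).
      by apply: cvgMl_tmp; exact: h1.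
    apply/funext => n; rewrite /series /= mulr_sumr; apply: eq_bigr => i _.
    by rewrite term mulKf ?e2pi_neq0.
  exists (fun n => a n%:Z).
    apply: slow_of_cvg => r r1.
    (* At least 1/2, because [qexp 2 t] is never 0. *)
    pose s := Num.max r (2^-1).
    have s01 : 0 < s < 1 by rewrite /s lt_max gt_max r1 invr_gt0 invf_lt1 // ltr0n ltr1n orbT.
    have [t tE] := uhp_qexp s01; exists s%:C.
    have /andP[s0 s1] := s01.
    split; rewrite ?normc_real ?gtr0_norm //; first by rewrite /s le_max lexx.
      exact: ltW.
    by rewrite -tE; apply/cvg_ex; exists (f t / e2pi (mu * val t / 2)); exact: cv.
  by move=> t; rewrite (psum_unique (cv t)) mulrC divfK ?e2pi_neq0.
exists (fun n : int => if n is Posz k then b k else 0); split.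
  move=> [n|//]; rewrite Re_int -pmulrn => h; exfalso.
  by have := ler0n R n; move: h m0; lra.
move=> t; exists (f t), 0; split; last by rewrite addr0.
  rewrite hb.
  rewrite (_ : series _ = (fun n => (e2pi (mu * val t / 2)) *
      series (fun n : nat => b n * qexp 2 t ^+ n) n)).
    by apply: cvgMl_tmp; apply: cvg_psum => //; exact: qexp_lt1.
  apply/funext => n; rewrite /series /= mulr_sumr; apply: eq_bigr => i _.
  by rewrite (term (fun n : int => if n is Posz k then b k else 0)).
by apply: cvg_series0 => k; rewrite mul0r.
Qed.

Lemma has_expansionP nu f : has_expansion 2 nu f <->
  exists mu, [/\ strip mu, e2pi mu = e2pi nu & qform mu f].
Proof.
split=> [h|[mu [smu E hf]]].
  have [mu smu E] := e2pi_surj (e2pi_neq0 nu); exists mu; split=> //.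
  have : e2pi (mu - nu) = 1 by rewrite e2piD e2piN E divff ?e2pi_neq0.
  move=> /e2pi_eq1[m mE]; apply/has_expansion_qform => //.
  by rewrite (_ : mu = nu + m%:~R); [exact: has_expansion_shift|rewrite -mE addrC subrK].
have : e2pi (nu - mu) = 1 by rewrite e2piD e2piN E divff ?e2pi_neq0.
move=> /e2pi_eq1[m mE].
rewrite (_ : nu = mu + m%:~R); last by rewrite -mE addrC subrK.
by apply: has_expansion_shift; apply/has_expansion_qform.
Qed.

Lemma strip0 : strip 0.
Proof. by rewrite /strip /= lexx ltr01. Qed.

Lemma has_expansion0 f : has_expansion 2 0 f <-> qform 0 f.
Proof. exact: has_expansion_qform strip0. Qed.

Lemma qform0P f : qform 0 f <-> exists2 a, slow a & forall t, f t = psum a (qexp 2 t).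
Proof.
have E t : e2pi (0 * val t / 2) = 1 :> C by rewrite !mul0r e2pi0.
by split=> -[a sa h]; exists a => // t; rewrite h E mul1r.
Qed.

Lemma q_lt1 t : normc (qexp 2 t) < 1. Proof. exact: qexp_lt1. Qed.

Lemma qform_ext mu f g : qform mu f -> f =1 g -> qform mu g.
Proof. by move=> h /funext <-. Qed.

Lemma qformD mu f g : qform mu f -> qform mu g -> qform mu (fun t => f t + g t).
Proof.
move=> [a sa ha] [b sb hb]; exists (fun n => a n + b n); first exact: slowD.
by move=> t; rewrite ha hb psumD ?q_lt1 // mulrDr.
Qed.

Lemma qformM mu f g : qform 0 f -> qform mu g -> qform mu (fun t => f t * g t).
Proof.
move=> /qform0P[a sa ha] [b sb hb]; exists (cauchy_prod a b); first exact: slow_cauchy_prod.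
by move=> t; rewrite ha hb psumM ?q_lt1 // mulrCA.
Qed.

Lemma qform_cst (c : C) : qform 0 (fun=> c).
Proof.
apply/qform0P; exists (fun n => c * (n == 0%N)%:R); first by apply: slowZ; exact: slow_delta.
by move=> t; rewrite psumZ ?psum_delta ?mulr1 ?q_lt1 //; exact: slow_delta.
Qed.

Lemma qformZ mu (c : C) f : qform mu f -> qform mu (fun t => c * f t).
Proof. exact: qformM (qform_cst c). Qed.

Lemma qform0 mu : qform mu (fun=> 0).
Proof.
have [a sa ha] : qform mu (fun t => 0 * e2pi (mu * val t / 2)).
  apply: qformM (qform_cst 0) _; exists (fun n => (n == 0%N)%:R); first exact: slow_delta.
  by move=> t; rewrite psum_delta mulr1.
by exists a => // t; rewrite -ha mul0r.
Qed.

Lemma has_deriv_qexp N : has_deriv (qexp N) (fun t => ip / N%:R * qexp N t).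
Proof.
have h : has_deriv (fun t : H => val t / N%:R) (fun=> N%:R^-1).
  by apply: (has_deriv_eq (has_derivZ N%:R^-1 (@has_deriv_id R))) => t; rewrite ?mulr1 // mulrC.
apply: (has_deriv_eq (has_deriv_compl h (fun t => is_derive_e2pi _))) => // t.
by rewrite /qexp mulrAC.
Qed.

Lemma has_deriv_psum N a : (0 < N)%N -> slow a ->
  has_deriv (fun t => psum a (qexp N t)) (fun t => ip / N%:R * psum (fun n => n%:R * a n) (qexp N t)).
Proof.
move=> N0 sa.
apply: (has_deriv_eq (has_deriv_compl (has_deriv_qexp N)
  (fun t => is_derive_psum sa (qexp_lt1 t N0)))) => // t.
rewrite [in RHS]psum_shift ?qexp_lt1 ?mul0r ?add0r //; last exact: slowMn.
by rewrite mulrC -!mulrA.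
Qed.

Lemma has_deriv_e2piM (c : C) : has_deriv (fun t => e2pi (c * val t)) (fun t => ip * c * e2pi (c * val t)).
Proof.
have h : has_deriv (fun t : H => c * val t) (fun=> c).
  by apply: (has_deriv_eq (has_derivZ c (@has_deriv_id R))) => t //; rewrite mulr1.
apply: (has_deriv_eq (has_deriv_compl h (fun t => is_derive_e2pi _))) => // t.
by rewrite mulrAC.
Qed.

Lemma qform_deriv mu f : qform mu f -> exists2 f', has_deriv f f' & qform mu f'.
Proof.
move=> [a sa ha].
have h1 := has_derivM (has_deriv_e2piM (mu / 2)) (has_deriv_psum (isT : (0 < 2)%N) sa).
have E t : mu / 2 * val t = mu * val t / 2 by rewrite mulrAC.
exists (fun t => e2pi (mu * val t / 2) * psum (fun n => ip / 2 * (n%:R * a n) + ip * (mu / 2) * a n) (qexp 2 t)).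
  apply: (has_deriv_eq h1) => t; rewrite /= ?E ?ha //.
  have sn := slowMn sa.
  rewrite psumD ?psumZ ?q_lt1 //; [|exact: slowZ|exact: slowZ].
  by rewrite mulrDr; congr (_ + _); rewrite -mulrA mulrCA mulrA.
eexists; last by move=> t; reflexivity.
by apply: slowD; apply: slowZ => //; exact: slowMn.
Qed.

Lemma psum_qexp1 a t : slow a -> psum a (qexp 1 t) = psum (spread 2 a) (qexp 2 t).
Proof.
move=> sa; have E : qexp 2 t ^+ 2 = qexp 1 t.
  by rewrite /qexp -e2piMn divr1 mulrC divfK // pnatr_eq0.
by rewrite -E (psum_spread (isT : (0 < 2)%N) sa (q_lt1 t)).
Qed.

Lemma qform_qexp1 a : slow a -> qform 0 (fun t => psum a (qexp 1 t)).
Proof.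
move=> sa; apply/qform0P; exists (spread 2 a); first exact: slow_spread.
by move=> t; rewrite psum_qexp1.
Qed.

Lemma qform_E2 : qform 0 (@E2 R).
Proof.
have h := qform_qexp1 (@slow_eps2 R).
by apply: (qform_ext h) => t; rewrite E2_psum.
Qed.

Lemma mobius_Tz t (n : int) : val (mobius (mx2 1 n 0 1) t) = val t + n%:~R.
Proof.
by rewrite mobius_val /jf ?mx2_ij ?mul0r ?add0r ?mul1r ?divr1 //; exact: SL2Z_Tz.
Qed.

Lemma jf_Tz t (n : int) : jf (mx2 1 n 0 1) t = 1.
Proof. by rewrite /jf !mx2_ij mul0r add0r. Qed.

Lemma qexp_Tz t (n : int) : qexp 2 (mobius (mx2 1 n 0 1) t) = e2pi (n%:~R / 2) * qexp 2 t.
Proof. by rewrite /qexp mobius_Tz mulrDl e2piD mulrC. Qed.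

Lemma slow_twist (n : int) a : slow a -> slow (fun k => e2pi (n%:~R / 2) ^+ k * a k).
Proof.
move=> sa; apply: (slow_le sa) => k; rewrite normcM normcX normc_e2pi_rat.
by rewrite expr1n mul1r.
Qed.

Lemma qform_Tz mu f (n : int) : qform mu f -> qform mu (fun t => f (mobius (mx2 1 n 0 1) t)).
Proof.
move=> [a sa ha]; have [b sb hb] : qform mu (fun t => e2pi (mu * n%:~R / 2) *
    (e2pi (mu * val t / 2) * psum (fun k => e2pi (n%:~R / 2) ^+ k * a k) (qexp 2 t))).
  apply: qformZ; eexists; last by move=> t; reflexivity.
  exact: slow_twist.
exists b; first exact: sb.
move=> t; rewrite -hb ha mobius_Tz qexp_Tz.
have -> : mu * (val t + n%:~R) / 2 = mu * n%:~R / 2 + mu * val t / 2.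
  by rewrite mulrDr mulrDl addrC.
rewrite e2piD -mulrA.
suff -> : psum a (e2pi (n%:~R / 2) * qexp 2 t) =
  psum (fun k => e2pi (n%:~R / 2) ^+ k * a k) (qexp 2 t) by [].
apply/esym/psum_unique.
have z1 : normc (e2pi (n%:~R / 2) * qexp 2 t) < 1.
  by rewrite normcM normc_e2pi_rat mul1r q_lt1.
apply: (cvg_series_eq _ (cvg_psum sa z1)) => k.
by rewrite exprMn mulrCA mulrA.
Qed.

End Expansions.

(** * Growth at a cusp *)

Section Growth.
Variable R : realType.
Local Notation C := R[i].
Local Notation H := (uhp R).
Implicit Types (t : H) (f g : H -> C) (mu : C) (a b : nat -> C).

(* Polynomials in t with coefficients satisfying [qform mu]. *)
Inductive qfpoly mu : (H -> C) -> Prop :=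
| qfpoly_zero : qfpoly mu (fun=> 0)
| qfpoly_step f g : qform mu f -> qfpoly mu g -> qfpoly mu (fun t => f t + val t * g t).

Lemma qfpoly_ext mu f g : qfpoly mu f -> f =1 g -> qfpoly mu g.
Proof. by move=> h /funext <-. Qed.

Lemma qfpolyP mu f : qfpoly mu f <-> exists d (c : 'I_d -> H -> C),
  (forall j, qform mu (c j)) /\ forall t, f t = \sum_(j < d) c j t * val t ^+ j.
Proof.
split=> [|[d [c [hc hf]]]].
  elim=> [|{}f g hf _ [d [c [hc hg]]]].
    by exists 0%N, (fun _ _ => 0); split=> [[]|t] //; rewrite big_ord0.
  exists d.+1, (fun i => if unlift ord0 i is Some j then c j else f); split=> [j|t].
    by case: unliftP => [i _|_].
  rewrite big_ord_recl unlift_none expr0 mulr1; congr (_ + _).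
  rewrite hg mulr_sumr; apply: eq_bigr => i _; rewrite liftK.
  by rewrite /= exprS mulrCA.
elim: d c f hc hf => [|d IHd] c f hc hf.
  by apply: (qfpoly_ext (qfpoly_zero mu)) => t; rewrite hf big_ord0.
have h := IHd (fun j => c (lift ord0 j)) _ (fun j => hc _) (fun t => erefl).
apply: (qfpoly_ext (qfpoly_step (hc ord0) h)) => t.
rewrite hf big_ord_recl expr0 mulr1; congr (_ + _).
rewrite mulr_sumr; apply: eq_bigr => i _.
by rewrite /= exprS mulrCA.
Qed.

Lemma qfpoly_qform mu f : qform mu f -> qfpoly mu f.
Proof.
by move=> h; apply: (qfpoly_ext (qfpoly_step h (qfpoly_zero mu))) => t; rewrite mulr0 addr0.
Qed.

Lemma qfpolyD mu f g : qfpoly mu f -> qfpoly mu g -> qfpoly mu (fun t => f t + g t).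
Proof.
move=> hf; elim: hf g => [|{}f f' qf _ IH] g hg.
  by apply: (qfpoly_ext hg) => t; rewrite add0r.
case: hg => [|{}g g' qg hg'].
  by apply: (qfpoly_ext (qfpoly_step qf (IH _ (qfpoly_zero mu)))) => t; rewrite !addr0.
apply: (qfpoly_ext (qfpoly_step (qformD qf qg) (IH _ hg'))) => t.
by rewrite mulrDr addrACA.
Qed.

Lemma qfpolyM mu f g : qform 0 f -> qfpoly mu g -> qfpoly mu (fun t => f t * g t).
Proof.
move=> hf; elim=> [|{}g g' qg _ IH].
  by apply: (qfpoly_ext (qfpoly_zero mu)) => t; rewrite mulr0.
apply: (qfpoly_ext (qfpoly_step (qformM hf qg) IH)) => t.
by rewrite mulrDr [val t * (_ * _)]mulrCA.
Qed.

Lemma qfpolyZ mu (c : C) f : qfpoly mu f -> qfpoly mu (fun t => c * f t).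
Proof. exact: qfpolyM (qform_cst c). Qed.

Lemma qfpoly_val mu f : qfpoly mu f -> qfpoly mu (fun t => val t * f t).
Proof.
by move=> hf; apply: (qfpoly_ext (qfpoly_step (qform0 mu) hf)) => t; rewrite add0r.
Qed.

Lemma qfpoly_deriv mu f : qfpoly mu f -> exists2 f', has_deriv f f' & qfpoly mu f'.
Proof.
elim=> [|{}f g /qform_deriv[f' df qf'] hg [g' dg hg']].
  by exists (fun=> 0); [exact: has_deriv_cst|exact: qfpoly_zero].
exists (fun t => f' t + (val t * g' t + 1 * g t)).
  by apply: has_derivD => //; exact: has_derivM (@has_deriv_id R) dg.
apply: qfpolyD; first exact: qfpoly_qform.
apply: qfpolyD; first exact: qfpoly_val.
by apply: (qfpoly_ext hg) => t; rewrite mul1r.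
Qed.

Lemma qform_lead mu f : qform mu f -> exists (c : C) f1, qform mu f1 /\
  forall t, f t = e2pi (mu * val t / 2) * c + e2pi (val t / 2) * f1 t.
Proof.
move=> [a sa ha].
exists (a 0%N), (fun t => e2pi (mu * val t / 2) * psum (fun n => a n.+1) (qexp 2 t)); split.
  by exists (fun n => a n.+1); first exact: slow_shift.
by move=> t; rewrite ha psum_shift ?q_lt1 // mulrDr; congr (_ + _); rewrite /qexp mulrCA.
Qed.

(** The polynomial collects the constant coefficients of all the power series involved. *)
Lemma qfpoly_lead mu f : qfpoly mu f -> exists (p : {poly C}) f1, qfpoly mu f1 /\
  forall t, f t = e2pi (mu * val t / 2) * p.[val t] + e2pi (val t / 2) * f1 t.
Proof.
elim=> [|{}f g /qform_lead[c [f1 [hf1 fE]]] _ [p [g1 [hg1 gE]]]].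
  exists 0, (fun=> 0); split; first exact: qfpoly_zero.
  by move=> t; rewrite horner0 !mulr0 addr0.
exists (c%:P + 'X * p), (fun t => f1 t + val t * g1 t); split; first exact: qfpoly_step.
move=> t; rewrite fE gE hornerD hornerC hornerM hornerX.
by ring.
Qed.

(* Polynomial growth towards i oo along vertical lines; [van] requires the decay
   of exp(pi i t), the local parameter at a cusp of width 2. *)
Definition grow f := forall x : R, exists2 K : R, 0 <= K & exists d : nat,
  forall t, complex.Re (val t) = x -> 1 <= complex.Im (val t) ->
    normc (f t) <= K * complex.Im (val t) ^+ d.

Definition van f := grow (fun t => f t * e2pi (- (val t / 2))).

Lemma grow_ext f g : grow f -> f =1 g -> grow g.
Proof. by move=> h /funext <-. Qed.

Lemma growD f g : grow f -> grow g -> grow (fun t => f t + g t).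
Proof.
move=> hf hg x; have [K K0 [d hK]] := hf x; have [L L0 [e hL]] := hg x.
exists (K + L); first exact: addr_ge0.
exists (d + e)%N => t tx t1; rewrite (le_trans (le_normcD _ _)) // mulrDl lerD //.
  rewrite (le_trans (hK t tx t1)) // ler_wpM2l // ler_weXn2l //; exact: leq_addr.
rewrite (le_trans (hL t tx t1)) // ler_wpM2l // ler_weXn2l //; exact: leq_addl.
Qed.

Lemma growM f g : grow f -> grow g -> grow (fun t => f t * g t).
Proof.
move=> hf hg x; have [K K0 [d hK]] := hf x; have [L L0 [e hL]] := hg x.
exists (K * L); first exact: mulr_ge0.
exists (d + e)%N => t tx t1; rewrite normcM exprD mulrACA.
by apply: ler_pM; rewrite ?normc_ge0 // ?hK ?hL.
Qed.

Lemma grow_cst (c : C) : grow (fun=> c).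
Proof. by move=> x; exists (normc c); [exact: normc_ge0|exists 0%N => t _ _; rewrite expr0 mulr1]. Qed.

Lemma growZ (c : C) f : grow f -> grow (fun t => c * f t).
Proof. exact: growM (grow_cst c). Qed.

Lemma grow_val : grow (fun t => val t).
Proof.
move=> x; exists (`|x| + 1); first by rewrite addr_ge0.
exists 1%N => t tx t1; rewrite expr1 (le_trans (ler_normc_ReIm _)) // tx mulrDl mul1r.
have i0 := le_trans ler01 t1.
by rewrite (ger0_norm i0) lerD2r ler_peMr.
Qed.

Lemma grow_sum n (f : 'I_n -> H -> C) : (forall i, grow (f i)) -> grow (fun t => \sum_i f i t).
Proof.
elim: n f => [|n IHn] f hf; first by apply: (grow_ext (grow_cst 0)) => t; rewrite big_ord0.
by apply: (grow_ext (growD (hf ord0) (IHn _ (fun i => hf (lift ord0 i))))) => t; rewrite big_ord_recl.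
Qed.

Lemma grow_qform mu f : strip mu -> qform mu f -> grow f.
Proof.
move=> /andP[m0 m1] [a sa ha] x.
have pi0 := pi_gt0 R.
have r1 : expR (- pi) < 1 :> R by rewrite expR_lt1 oppr_lt0.
have [K hK] := psum_bounded sa r1.
exists (expR (- pi * (complex.Im mu * x)) * `|K|); first by rewrite mulr_ge0 ?expR_ge0.
exists 0%N => t tx t1; rewrite expr0 mulr1 ha normcM ler_pM ?normc_ge0 //.
  rewrite normc_e2pi divrn_complex ler_expR /=.
  have -> : complex.Im (mu * val t) = complex.Re mu * complex.Im (val t) + complex.Im mu * x.
    by rewrite -tx; case: (mu) (val t) => [p q] [u v].
  have h : 0 <= complex.Re mu * complex.Im (val t) by rewrite mulr_ge0 // (le_trans ler01).
  by move: (_ * complex.Im _) (complex.Im mu * x) h => u v h; nra.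
rewrite (le_trans (hK _ _)) ?ler_norm // normc_qexp ler_expR; nra.
Qed.

Lemma grow_qfpoly mu f : strip mu -> qfpoly mu f -> grow f.
Proof.
move=> hmu; elim=> [|{}f g hf _ IH]; first exact: grow_cst.
by apply: growD; [exact: grow_qform hf|exact: growM grow_val IH].
Qed.

Lemma grow_Tz f (n : int) : grow f -> grow (fun t => f (mobius (mx2 1 n 0 1) t)).
Proof.
move=> hf x; have [K K0 [d hK]] := hf (x + n%:~R); exists K => //; exists d => t tx t1.
by have := hK (mobius (mx2 1 n 0 1) t); rewrite mobius_Tz Re_addz Im_addz tx; apply.
Qed.

Lemma van_ext f g : van f -> f =1 g -> van g.
Proof. by move=> h /funext <-. Qed.

Lemma vanD f g : van f -> van g -> van (fun t => f t + g t).
Proof. by move=> hf hg; apply: (grow_ext (growD hf hg)) => t; rewrite mulrDl. Qed.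

Lemma vanM f g : grow f -> van g -> van (fun t => f t * g t).
Proof. by move=> hf hg; apply: (grow_ext (growM hf hg)) => t; rewrite mulrA. Qed.

Lemma vanZ (c : C) f : van f -> van (fun t => c * f t).
Proof. exact: vanM (grow_cst c). Qed.

Lemma van0 : van (fun=> 0).
Proof. by apply: (grow_ext (grow_cst 0)) => t; rewrite mul0r. Qed.

Lemma van_sum n (f : 'I_n -> H -> C) : (forall i, van (f i)) -> van (fun t => \sum_i f i t).
Proof. by move=> hf; apply: (grow_ext (grow_sum hf)) => t; rewrite mulr_suml. Qed.

Lemma van_e2piM f : grow f -> van (fun t => e2pi (val t / 2) * f t).
Proof.
by move=> hf; apply: (grow_ext hf) => t; rewrite mulrAC -e2piD subrr e2pi0 mul1r.
Qed.

Lemma van_Tz f (n : int) : van f -> van (fun t => f (mobius (mx2 1 n 0 1) t)).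
Proof.
move=> /(grow_Tz n) /(growZ (e2pi (n%:~R / 2))) h; apply: (grow_ext h) => t.
by rewrite mobius_Tz mulrCA -e2piD mulrDl opprD addrCA subrr addr0.
Qed.

Lemma prod_sub_ge1 (r : seq C) : exists Y : R, forall y, Y <= y ->
  1 <= normc (\prod_(z <- r) (Complex 0 y - z)).
Proof.
elim: r => [|z r [Y hY]]; first by exists 0 => y _; rewrite big_nil normc1.
exists (Num.max Y (1 + complex.Im z)) => y; rewrite ge_max => /andP[y1 y2].
rewrite big_cons normcM -[leLHS]mulr1 ler_pM ?ler01 ?hY //.
rewrite (le_trans _ (ler_normIm _)) // ler_normr; apply/orP; left.
by case: z y2 => u v /=; lra.
Qed.

(** With c = d / (n + 1), exp(d y) is the (n+1)-st power of exp(c y) >= c y: one power of y more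
    than needed, which absorbs K. *)
Lemma expR_gt_pow (d : R) (n : nat) (K Y : R) : 0 < d ->
  exists2 y, Y <= y & K * y ^+ n < expR (d * y).
Proof.
move=> d0; pose c := d / n.+1%:R.
have c0 : 0 < c by rewrite divr_gt0.
have cn : 0 < c ^+ n.+1 by rewrite exprn_gt0.
pose y := Num.max (Num.max Y 1) ((`|K| + 1) / c ^+ n.+1).
exists y; first by rewrite /y !le_max lexx.
have y1 : 1 <= y by rewrite /y !le_max lexx orbT.
have y2 : (`|K| + 1) / c ^+ n.+1 <= y by rewrite /y le_max lexx orbT.
have y0 : 0 < y by rewrite (lt_le_trans ltr01).
have -> : d * y = n.+1%:R * (c * y).
  by rewrite /c mulrA mulrCA divff ?mulr1 // pnatr_eq0.
rewrite expRM_natl (@lt_le_trans _ _ ((c * y) ^+ n.+1)) //.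
  rewrite exprMn exprS [y ^+ n.+1]exprS mulrA ltr_pM2r ?exprn_gt0 // -exprS.
  move: y2; rewrite ler_pdivrMr // mulrC => /(lt_le_trans _); apply.
  by rewrite ltr_pwDr // ler_norm.
rewrite lerXn2r ?nnegrE ?expR_ge0 ?mulr_ge0 ?ltW //.
by rewrite (lt_le_trans _ (expR_ge1Dx _)) // ltrDr.
Qed.

(** Since Re mu < 1, division by exp(pi i t) leaves an exponentially growing factor on the imaginary
    axis, where a nonzero polynomial is eventually bounded below by its factorization. *)
Lemma van_poly0 mu (p : {poly C}) : strip mu ->
  van (fun t => e2pi (mu * val t / 2) * p.[val t]) -> p = 0.
Proof.
move=> /andP[m0 m1] /(_ 0)[K K0 [d hK]]; apply/eqP/negPn/negP => p0.
have pi0 := pi_gt0 R.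
have [r pE] := closed_field_poly_normal p.
have [Y hY] := prod_sub_ge1 r.
have l0 : 0 < normc (lead_coef p) by rewrite normc_gt0 lead_coef_eq0.
have d0 : 0 < pi * (1 - complex.Re mu) by rewrite mulr_gt0 // subr_gt0.
have [y y1] := expR_gt_pow d (K / normc (lead_coef p)) (Num.max Y 1) d0.
move: y1; rewrite ge_max => /andP[yY y1].
have y0 : 0 < complex.Im (Complex 0 y) by rewrite (lt_le_trans ltr01).
have := hK (mkuhp y0) erefl y1; rewrite {1}pE hornerZ horner_prod.
under eq_bigr do rewrite hornerXsubC.
rewrite /= normcM normcM normcM !normc_e2pi => h1 h2.
have h3 : expR (pi * (1 - complex.Re mu) * y) * normc (lead_coef p) <= K * y ^+ d.
  apply: le_trans h1; have := hY _ yY.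
  set P := normc (\prod_(z <- r) _) => P1.
  have -> : expR (- (2 * pi) * complex.Im (mu * Complex 0 y / 2)) *
      (normc (lead_coef p) * P) * expR (- (2 * pi) * complex.Im (- (Complex 0 y / 2))) =
      expR (pi * (1 - complex.Re mu) * y) * normc (lead_coef p) * P.
    rewrite mulrAC -expRD mulrA; congr (expR _ * _ * _).
    rewrite !divrn_complex; case: (mu) => u v /=; rewrite ?mulr0 ?addr0 ?add0r.
    by field.
  by rewrite ler_peMr // mulr_ge0 ?expR_ge0 ?normc_ge0.
move: h2; rewrite mulrAC ltr_pdivrMr // => /(le_lt_trans h3).
by rewrite ltxx.
Qed.

(** Decay alone yields divisibility by the local parameter within the same class; this is what makes
    division by D possible. *)
Lemma qfpoly_van mu f : strip mu -> qfpoly mu f -> van f ->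
  exists2 f1, qfpoly mu f1 & forall t, f t = e2pi (val t / 2) * f1 t.
Proof.
move=> hmu /qfpoly_lead[p [f1 [hf1 fE]]] vf; exists f1 => // t.
suff p0 : p = 0 by rewrite fE p0 horner0 mulr0 add0r.
apply: (van_poly0 hmu).
have v1 := vanZ (-1) (van_e2piM (grow_qfpoly hmu hf1)).
by apply: (van_ext (vanD vf v1)) => s; rewrite fE mulN1r addrK.
Qed.

Lemma qform_van mu f : strip mu -> qform mu f -> van f ->
  exists2 f1, qform mu f1 & forall t, f t = e2pi (val t / 2) * f1 t.
Proof.
move=> hmu /qform_lead[c [f1 [hf1 fE]]] vf; exists f1 => // t.
suff /polyC_inj c0 : c%:P = 0%:P by rewrite fE c0 mulr0 add0r.
rewrite polyC0; apply: (van_poly0 hmu).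
have v1 := vanZ (-1) (van_e2piM (grow_qform hmu hf1)).
by apply: (van_ext (vanD vf v1)) => s; rewrite fE hornerC mulN1r addrK.
Qed.

Lemma qform0_limit f : qform 0 f -> exists c : C, van (fun t => f t - c).
Proof.
move=> /qform_lead[c [f1 [hf1 fE]]]; exists c.
apply: (van_ext (van_e2piM (grow_qform (strip0 R) hf1))) => t.
by rewrite fE !mul0r e2pi0 mul1r addrAC subrr add0r.
Qed.

(** Uniqueness of coefficients, read off one at a time from the decay of what remains. *)
Lemma psum_qexp_low a b n : slow a -> slow b ->
  (forall t, psum a (qexp 2 t) = qexp 2 t ^+ n * psum b (qexp 2 t)) ->
  forall m, (m < n)%N -> a m = 0.
Proof.
elim: n a => [//|n IHn] a sa sb hab.
have qf c : slow c -> grow (fun t => psum c (qexp 2 t)).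
  by move=> sc; apply: (grow_qform (strip0 R)); apply/qform0P; exists c.
have gn : grow (fun t => qexp 2 t ^+ n * psum b (qexp 2 t)).
  apply: growM (qf b sb); elim: (n) => [|k IHk]; first exact: (grow_ext (grow_cst 1)).
  have q1 : grow (qexp 2).
    have h : slow (fun k => (k == 1%N)%:R : C).
      by apply: slow_unshift; exact: slow_delta.
    apply: (grow_ext (qf _ h)) => t; rewrite psum_shift ?q_lt1 // add0r.
    by rewrite (_ : psum _ _ = 1) ?mulr1 // -[RHS](psum_delta (qexp 2 t)).
  by apply: (grow_ext (growM q1 IHk)) => t; rewrite exprS.
have a0 : a 0%N = 0.
  apply: polyC_inj; rewrite polyC0; apply: (van_poly0 (strip0 R)).
  have v1 := vanZ (-1) (van_e2piM (qf _ (slow_shift sa))).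
  apply: (van_ext (vanD (van_e2piM gn) v1)) => t.
  have := hab t; rewrite psum_shift ?q_lt1 // exprS -mulrA => E.
  by rewrite -/(qexp 2 t) -E !mul0r e2pi0 mul1r hornerC mulN1r addrK.
case=> [_ //|m]; rewrite ltnS.
apply: (IHn (fun k => a k.+1)) => //; first exact: slow_shift.
move=> t; apply: (mulfI (e2pi_neq0 (val t / 2))).
have := hab t; rewrite psum_shift ?q_lt1 // a0 add0r exprS -mulrA => E.
exact: E.
Qed.

Lemma qform0_flat f : qform 0 f ->
  (forall n, qform 0 (fun t => f t * qexp 2 t ^- n)) -> f = fun=> 0.
Proof.
move=> /qform0P[a sa fE] hn; apply/funext => t; rewrite fE.
apply: psum_unique; apply: cvg_series0 => k.
have /qform0P[b sb gE] := hn k.+1.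
rewrite (psum_qexp_low sa sb _ (ltnSn k)) ?mul0r // => s.
by rewrite -gE fE mulrC divfK // expf_neq0 // e2pi_neq0.
Qed.

End Growth.

(** * Linear differential equations *)

Section ExponentialRecursion.
Variable R : realType.
Local Notation C := R[i].
Implicit Types (a b : nat -> C).

(* Coefficients of the solution of q e' = 2 b e with value 1 at q = 0. *)
Fixpoint exp_prefix b n : seq C :=
  if n is m.+1 then
    rcons (exp_prefix b m) (2 / m.+1%:R * \sum_(k < m.+1) b k.+1 * nth 0 (exp_prefix b m) (m - k))
  else [:: 1].

Definition exp_coef b n : C := nth 0 (exp_prefix b n) n.

Lemma size_exp_prefix b n : size (exp_prefix b n) = n.+1.
Proof. by elim: n => //= n IHn; rewrite size_rcons IHn. Qed.

Lemma nth_exp_prefix b n k : (k <= n)%N -> nth 0 (exp_prefix b n) k = exp_coef b k.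
Proof.
elim: n => [|n IHn]; first by rewrite leqn0 => /eqP ->.
rewrite leq_eqVlt => /predU1P[-> //|kn].
by rewrite /= nth_rcons size_exp_prefix kn IHn.
Qed.

Lemma exp_coefS b n : exp_coef b n.+1 =
  2 / n.+1%:R * \sum_(k < n.+1) b k.+1 * exp_coef b (n - k)%N.
Proof.
rewrite {1}/exp_coef /= nth_rcons size_exp_prefix ltnn eqxx; congr (_ * _).
by apply: eq_bigr => k _; rewrite nth_exp_prefix // leq_subr.
Qed.

Lemma mul_exp_coef b n : b 0%N = 0 -> n%:R * exp_coef b n = 2 * cauchy_prod b (exp_coef b) n.
Proof.
move=> b0; rewrite /cauchy_prod; case: n => [|n].
  by rewrite mul0r big_ord_recl big_ord0 b0 mul0r addr0 mulr0.
rewrite big_ord_recl (_ : b (@ord0 n.+1) = 0) // mul0r add0r [in LHS]exp_coefS mulrA; congr (_ * _).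
by rewrite mulrC divfK // pnatr_eq0.
Qed.

(** A bound K for all earlier |e_k| r^k gives the bound L K / n for the n-th, with L independent of
    n. Once n exceeds L, the bound K valid for the initial terms propagates. *)
Lemma slow_exp_coef b : slow b -> slow (exp_coef b).
Proof.
move=> sb r r0 r1; pose s := (1 + r) / 2.
have s0 : 0 < s by rewrite /s; lra.
have s1 : s < 1 by rewrite /s; lra.
have [M hM] := sb s s0 s1.
have M0 : 0 <= M by rewrite (le_trans _ (hM 0%N)) // expr0 mulr1 normc_ge0.
pose u := r / s.
have u0 : 0 <= u by rewrite /u divr_ge0 // ltW.
have u1 : u < 1 by rewrite /u ltr_pdivrMr // mul1r /s; lra.
pose L := 2 * M / (1 - u).
have L0 : 0 <= L by rewrite /L divr_ge0 ?mulr_ge0 // subr_ge0 ltW.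
have [n0 hn0] : exists n0 : nat, L <= n0%:R.
  by exists (Num.bound L); exact: ltW (archi_boundP L0).
pose K := \sum_(k < n0.+1) normc (exp_coef b k) * r ^+ k.
have K0 : 0 <= K by apply: sumr_ge0 => k _; rewrite mulr_ge0 ?normc_ge0 ?exprn_ge0 // ltW.
exists K => n; have [m hm] := ubnP n; elim: m n hm => // m IHm n nm.
have [nn0|n0n] := leqP n n0.
  rewrite /K (bigD1 (Ordinal (nn0 : (n < n0.+1)%N))) //= lerDl.
  by apply: sumr_ge0 => k _; rewrite mulr_ge0 ?normc_ge0 ?exprn_ge0 // ltW.
case: n nm n0n => // n nm n0n; rewrite exp_coefS normcM.
have n1 : 0 < n.+1%:R :> R by rewrite ltr0n.
have -> : normc (2 / n.+1%:R : C) = 2 / n.+1%:R by rewrite normc_div !normc_nat.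
have h : normc (\sum_(k < n.+1) b k.+1 * exp_coef b (n - k)%N) * r ^+ n.+1 <= M / (1 - u) * K.
  have hs : normc (\sum_(k < n.+1) b k.+1 * exp_coef b (n - k)%N) <=
      \sum_(k < n.+1) normc (b k.+1) * normc (exp_coef b (n - k)%N).
    elim/big_ind2 : _ => [|x1 x2 y1 y2 h1 h2|k _]; first by rewrite normc0.
      by rewrite (le_trans (le_normcD _ _)) // lerD.
    by rewrite normcM.
  rewrite (le_trans (ler_wpM2r _ hs)) ?exprn_ge0 ?(ltW r0) // mulr_suml.
  rewrite (le_trans (y := \sum_(k < n.+1) M * K * u ^+ k)) //.
    apply: ler_sum => k _.
    have -> : r ^+ n.+1 = u ^+ k.+1 * s ^+ k.+1 * r ^+ (n - k).
      rewrite -exprMn /u divfK ?gt_eqF // -exprD; congr (_ ^+ _).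
      by rewrite addSn subnKC // -ltnS.
    have -> : normc (b k.+1) * normc (exp_coef b (n - k)) * (u ^+ k.+1 * s ^+ k.+1 * r ^+ (n - k)) =
      (normc (b k.+1) * s ^+ k.+1) * (normc (exp_coef b (n - k)) * r ^+ (n - k)) * u ^+ k.+1.
      by ring.
    apply: ler_pM; rewrite ?mulr_ge0 ?normc_ge0 ?exprn_ge0 ?(ltW r0) ?(ltW s0) //.
      apply: ler_pM; rewrite ?mulr_ge0 ?normc_ge0 ?exprn_ge0 ?(ltW r0) ?(ltW s0) //.
      by apply: IHm; rewrite (leq_ltn_trans (leq_subr _ _)).
    by rewrite ler_wiXn2l // ltW.
  rewrite -mulr_sumr [leRHS]mulrAC ler_wpM2l ?mulr_ge0 //.
  rewrite -[leRHS]mulr1 ler_pdivlMl ?subr_gt0 //.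
  by rewrite -opprB mulNr -subrX1 opprB gerBl exprn_ge0.
rewrite -mulrA (le_trans (ler_wpM2l _ h)) ?divr_ge0 //.
have -> : 2 / n.+1%:R * (M / (1 - u) * K) = L / n.+1%:R * K by rewrite /L; ring.
rewrite ler_piMl // ler_pdivrMr // mul1r (le_trans hn0) // ler_nat.
exact: ltnW.
Qed.

End ExponentialRecursion.

(** * First-order equations on the upper half-plane *)

Section LinearODE.
Variable R : realType.
Local Notation C := R[i].
Local Notation H := (uhp R).
Local Notation ip := (two_pi_i R).
Implicit Types (t : H) (f g w : H -> C) (a b : nat -> C) (k : int).

(** The quotient f / g has derivative 0. *)
Lemma ode_unique w f g : (forall t, g t != 0) ->
  has_deriv f (fun t => ip * w t * f t) -> has_deriv g (fun t => ip * w t * g t) ->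
  exists c : C, forall t, f t = c * g t.
Proof.
move=> g0 hf hg.
have h : has_deriv (fun t => f t * (g t)^-1) (fun=> 0).
  apply: (has_deriv_eq (has_derivM hf (has_derivV g0 hg))) => // t.
  by have := g0 t; move: (f t) (g t) ip (w t) => *; field.
have z0 : 0 < complex.Im ('i : C) by rewrite /= ltr01.
pose s := mkuhp z0; exists (f s * (g s)^-1) => t.
by rewrite (has_deriv0_cst h s t) divfK.
Qed.

Lemma van_cst (c : C) : van (fun _ : H => c) -> c = 0.
Proof.
move=> h; apply: polyC_inj; rewrite polyC0; apply: (van_poly0 (strip0 R)).
by apply: (van_ext h) => t; rewrite !mul0r e2pi0 mul1r hornerC.
Qed.

Lemma has_deriv_exp_coef b : slow b -> b 0%N = 0 ->
  has_deriv (fun t => psum (exp_coef b) (qexp 2 t))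
    (fun t => ip * psum b (qexp 2 t) * psum (exp_coef b) (qexp 2 t)).
Proof.
move=> sb b0; have se := slow_exp_coef sb.
apply: (has_deriv_eq (has_deriv_psum (isT : (0 < 2)%N) se)) => // t.
rewrite -[RHS]mulrA -psumM ?q_lt1 //.
rewrite (_ : (fun n => n%:R * exp_coef b n) = (fun n => 2 * cauchy_prod b (exp_coef b) n)); last first.
  by apply/funext => n; rewrite mul_exp_coef.
rewrite psumZ ?q_lt1 //; last exact: slow_cauchy_prod.
by rewrite mulrA divfK // pnatr_eq0.
Qed.

(** The constant term of b contributes e2pi(b_0 t), the rest a power series [e]. The series [e'],
    built from - b, inverts it, so the solution has no zeros and its inverse again has an
    expansion. *)
Lemma psum_exp b : slow b -> exists e e' : nat -> C,
  [/\ slow e, slow e', e 0%N = 1, forall t, psum e (qexp 2 t) * psum e' (qexp 2 t) = 1 &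
    has_deriv (fun t => e2pi (b 0%N * val t) * psum e (qexp 2 t))
      (fun t => ip * psum b (qexp 2 t) * (e2pi (b 0%N * val t) * psum e (qexp 2 t)))].
Proof.
move=> sb; pose b1 n := if n is 0%N then 0 else b n.
have sb1 : slow b1 by apply: slow_unshift; exact: slow_shift sb.
have snb1 : slow (fun n => -1 * b1 n) by exact: slowZ.
have se := slow_exp_coef sb1; have se' := slow_exp_coef snb1.
have h := has_deriv_exp_coef sb1 erefl.
have h' := has_deriv_exp_coef snb1 (mulr0 _).
exists (exp_coef b1), (exp_coef (fun n => -1 * b1 n)); split=> //.
  have hm : has_deriv (fun t => psum (exp_coef b1) (qexp 2 t) *
      psum (exp_coef (fun n => -1 * b1 n)) (qexp 2 t)) (fun=> 0).
    apply: (has_deriv_eq (has_derivM h h')) => // t.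
    rewrite psumZ ?q_lt1 //.
    by ring.
  move=> t; apply/eqP; rewrite -subr_eq0; apply/eqP.
  (* The product is constant; its value is read off at i oo. *)
  have v : van (fun s => psum (cauchy_prod (exp_coef b1) (exp_coef (fun n => -1 * b1 n))) (qexp 2 s) - 1).
    have sc := slow_cauchy_prod se se'.
    apply: (van_ext (van_e2piM (grow_qform (strip0 R) ((qform0P _).2
      (ex_intro2 _ _ _ (slow_shift sc) (fun=> erefl)))))) => s.
    rewrite [in RHS]psum_shift ?q_lt1 // /cauchy_prod big_ord_recl big_ord0 addr0.
    by rewrite /exp_coef /= mulr1 addrAC subrr add0r.
  apply: van_cst; apply: (van_ext v) => s.
  have E := psumM se se' (q_lt1 s); have E' := has_deriv0_cst hm s t.
  exact: (congr1 (fun z : C => z - 1) (etrans E E')).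
apply: (has_deriv_eq (has_derivM (has_deriv_e2piM (b 0%N)) h)) => // t.
have -> : psum b (qexp 2 t) = b 0%N + psum b1 (qexp 2 t).
  by rewrite psum_shift ?q_lt1 // [psum b1 _]psum_shift ?q_lt1 // add0r.
by ring.
Qed.

Lemma has_deriv_sderiv k f : holomorphic f ->
  has_deriv f (fun t => ip * (sderiv k f t + k%:~R / 12 * E2 t * f t)).
Proof.
move=> /holomorphic_has_deriv; set f' := (X in has_deriv f X); move: f' => f' hf.
rewrite (sderivE k hf); apply: (has_deriv_eq hf) => // t.
by rewrite subrK mulrA divff ?mul1r // two_pi_i_neq0.
Qed.

Lemma sderiv_ode k f w : has_deriv f (fun t => ip * w t * f t) ->
  sderiv k f = (fun t => (w t - k%:~R / 12 * E2 t) * f t).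
Proof.
move=> hf; rewrite (sderivE k hf); apply/funext => t.
by rewrite -mulrA mulKf ?two_pi_i_neq0 // mulrBl.
Qed.

End LinearODE.

(** * Scalar forms on Gamma_0(2) *)

Section ScalarForms.
Variable R : realType.
Local Notation C := R[i].
Local Notation H := (uhp R).
Local Notation ip := (two_pi_i R).
Implicit Types (t : H) (f : H -> C) (g h : 'M[int]_2) (k l : int) (a : nat -> C) (mu : C).

Lemma Smx_mobius t : val (mobius Smx t) = - (val t)^-1.
Proof.
rewrite mobius_val; last exact: SL2Z_Smx.
by rewrite /jf /Smx !mx2_ij mul0r add0r mul1r addr0 mulrNz mulN1r.
Qed.

Lemma jf_Smx t : jf Smx t = val t.
Proof. by rewrite /jf /Smx !mx2_ij mul1r addr0. Qed.

Lemma slash_cosets (V : lmodType C) k (F : H -> V) gamma j : Gamma0_2 gamma ->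
  slash k (gamma * Smx * Tmx ^+ j) F =
  (fun t => slash k Smx (slash k gamma F) (mobius (mx2 1 j%:Z 0 1) t)).
Proof.
move=> hg; have hg' := Gamma0_SL2Z hg.
rewrite slashM; [|by apply: SL2ZM => //; exact: SL2Z_Smx|exact: SL2Z_TmxX].
rewrite slashM //; last exact: SL2Z_Smx.
by apply/funext => t; rewrite slashE TmxX jf_Tz exp1rz scale1r.
Qed.

(** By [Gamma0_cosets] the cusps oo and 0 suffice, translations preserving [qform]. *)
Lemma modular_formP k f : modular_form k f <->
  [/\ holomorphic f, forall g, Gamma0_2 g -> slash k g f = f,
      qform 0 f & qform 0 (slash k Smx f)].
Proof.
have c2 := (is_cusp_period2 2).2 erefl.
split=> [[h1 h2 h3]|[h1 h2 h3 h4]].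
  split=> //; apply/has_expansion0; last by apply: h3; [exact: SL2Z_Smx|].
  by rewrite -[f](slash1 k); apply: h3; [exact: SL2Z1|].
split=> // g N hg /is_cusp_period2 ->; apply/has_expansion0.
have [gG|[gamma hgamma [j ->]]] := Gamma0_cosets hg; first by rewrite h2.
by rewrite slash_cosets // h2 //; exact: qform_Tz.
Qed.

Lemma scalecE (x y : C) : x *: y = x * y.
Proof. by []. Qed.

Lemma slashMl k g (c : C) f : slash k g (fun t => c * f t) = (fun t => c * slash k g f t).
Proof. exact: (@slashZ R C^o k g c f). Qed.

Lemma holomorphicM (f g : H -> C) : holomorphic f -> holomorphic g -> holomorphic (fun t => f t * g t).
Proof.
move=> /holomorphic_has_deriv hf /holomorphic_has_deriv hg.
exact: has_deriv_holomorphic (has_derivM hf hg).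
Qed.

Lemma holomorphicD (f g : H -> C) : holomorphic f -> holomorphic g -> holomorphic (fun t => f t + g t).
Proof.
move=> /holomorphic_has_deriv hf /holomorphic_has_deriv hg.
exact: has_deriv_holomorphic (has_derivD hf hg).
Qed.

Lemma holomorphic_qform mu f : qform mu f -> holomorphic f.
Proof. by move=> /qform_deriv[f' hf _]; exact: has_deriv_holomorphic hf. Qed.

Lemma modular_formM k l (f g : H -> C) : modular_form k f -> modular_form l g ->
  modular_form (k + l) (fun t => f t * g t).
Proof.
move=> /modular_formP[f1 f2 f3 f4] /modular_formP[g1 g2 g3 g4]; apply/modular_formP; split.
- exact: holomorphicM.
- by move=> h hh; rewrite slash_mul ?f2 ?g2 //; exact: Gamma0_SL2Z.
- exact: qformM.
- by rewrite slash_mul; [exact: qformM|exact: SL2Z_Smx].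
Qed.

Lemma modular_formD k (f g : H -> C) : modular_form k f -> modular_form k g ->
  modular_form k (fun t => f t + g t).
Proof.
move=> /modular_formP[f1 f2 f3 f4] /modular_formP[g1 g2 g3 g4]; apply/modular_formP.
have E h : slash k h (fun t => f t + g t) = (fun t => slash k h f t + slash k h g t).
  exact: (@slashD R C^o k h f g).
split.
- exact: holomorphicD.
- by move=> h hh; rewrite E f2 ?g2.
- exact: qformD.
- by rewrite E; exact: qformD.
Qed.

Lemma modular_form_cst (c : C) : modular_form 0 (fun=> c).
Proof.
have E h : slash 0 h (fun=> c) = (fun=> c).
  by apply/funext => t; rewrite slashE oppr0 expr0z scale1r.
apply/modular_formP; split=> [|h hh||]; rewrite ?E //; last 2 first.
- exact: qform_cst.
- exact: qform_cst.
exact: (has_deriv_holomorphic (has_deriv_cst c)).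
Qed.

Lemma modular_form0 k : modular_form k (fun _ : H => 0 : C).
Proof.
have E h : slash k h (fun _ : H => 0 : C) = (fun=> 0) by apply/funext => t; rewrite slashE scaler0.
apply/modular_formP; split=> [|h hh||]; rewrite ?E //; last 2 first.
- exact: qform0.
- exact: qform0.
exact: (has_deriv_holomorphic (has_deriv_cst 0)).
Qed.

Lemma modular_formX k f n : modular_form k f -> modular_form (k *+ n) (fun t => f t ^+ n).
Proof.
move=> hf; elim: n => [|n IHn]; first exact: modular_form_cst.
rewrite mulrS (_ : (fun t => _) = (fun t => f t * f t ^+ n)); first exact: modular_formM.
by apply/funext => t; rewrite exprS.
Qed.

Lemma scale_uhp_gt0 (r : R) t : 0 < r -> 0 < complex.Im (r%:C * val t).
Proof. by move=> r0; have := uhp_Im t; case: (val t) => x y /= y0; rewrite mul0r addr0 mulr_gt0. Qed.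

Definition double_uhp t : H := mkuhp (scale_uhp_gt0 t (ltr0n R 2)).

Lemma half_gt0 : (0 : R) < 2^-1. Proof. by rewrite invr_gt0. Qed.

Definition halve_uhp t : H := mkuhp (scale_uhp_gt0 t half_gt0).

Lemma double_uhp_val t : val (double_uhp t) = 2 * val t.
Proof. by rewrite /= rmorph_nat. Qed.

Lemma halve_uhp_val t : val (halve_uhp t) = val t / 2.
Proof. by rewrite /= fmorphV rmorph_nat mulrC. Qed.

(* The Eisenstein series of weight 2 on Gamma_0(2). *)
Definition eisA t : C := 2 * E2 (double_uhp t) - E2 t.

(** Conjugation by diag(2, 1) sends (a, b; c, d) to (a, 2b; c/2, d), integral because c is even. *)
Lemma double_mobius g t : Gamma0_2 g -> exists g', [/\ SL2Z g',
  double_uhp (mobius g t) = mobius g' (double_uhp t), jf g' (double_uhp t) = jf g t & g 1 0 = 2 * g' 1 0].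
Proof.
move=> [hg /dvdzP[c' cE]]; exists (mx2 (g 0 0) (2 * g 0 1) c' (g 1 1)).
have hg' : SL2Z (mx2 (g 0 0) (2 * g 0 1) c' (g 1 1)).
  by rewrite SL2Z_mx2 -[RHS]((SL2ZP g).1 hg) cE; ring.
have jE : jf (mx2 (g 0 0) (2 * g 0 1) c' (g 1 1)) (double_uhp t) = jf g t.
  by rewrite /jf !mx2_ij cE double_uhp_val intrM mulrA.
split=> //; last by rewrite mx2_ij cE mulrC.
apply: val_inj; rewrite double_uhp_val !mobius_val // jE !mx2_ij double_uhp_val intrM.
by rewrite mulrA; congr (_ / _); rewrite mulrDr; congr (_ + _); rewrite mulrCA.
Qed.

Lemma eisA_slash g : Gamma0_2 g -> slash 2 g eisA = eisA.
Proof.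
move=> hg; have hg1 := Gamma0_SL2Z hg; apply/funext => t; rewrite slashE /eisA.
have [g' [hg' -> jE cE]] := double_mobius t hg.
rewrite !E2_slash // jE cE intrM.
have j0 := jf_neq0 t hg1; have ip0 := two_pi_i_neq0 R.
move: (jf g t) (E2 t) (E2 (double_uhp t)) ((g' 1 0)%:~R : C) ip j0 ip0 => j e e' c i j0 i0.
rewrite -exprnN scalecE.
by field; rewrite i0.
Qed.

Lemma eisA_Smx t : slash 2 Smx eisA t = E2 (halve_uhp t) / 2 - E2 t.
Proof.
rewrite slashE /eisA jf_Smx.
have -> : double_uhp (mobius Smx t) = mobius Smx (halve_uhp t).
  apply: val_inj; rewrite double_uhp_val !Smx_mobius halve_uhp_val.
  by rewrite invfM invrK mulrN mulrC.
rewrite !E2_slash; [|exact: SL2Z_Smx|exact: SL2Z_Smx].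
rewrite !jf_Smx halve_uhp_val {1 2}/Smx !mx2_ij.
have t0 := uhp_neq0 t; have ip0 := two_pi_i_neq0 R.
rewrite -exprnN scalecE.
move: (E2 t) (E2 (halve_uhp t)) (val t : C) ip t0 ip0 => e e' z i z0 i0.
by field; rewrite i0 z0.
Qed.

Lemma E2_q t : E2 t = psum (spread 2 (@eps2 R)) (qexp 2 t).
Proof. by rewrite E2_psum psum_qexp1 //; exact: slow_eps2. Qed.

Lemma E2_double t : E2 (double_uhp t) = psum (spread 4 (@eps2 R)) (qexp 2 t).
Proof.
rewrite E2_psum (psum_spread (isT : (0 < 4)%N) (@slow_eps2 R) (q_lt1 t)).
have -> : qexp 1 (double_uhp t) = qexp 2 t ^+ 4; last by [].
rewrite /qexp -e2piMn double_uhp_val divr1 mulrCA [4%:R * _]mulrC.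
have -> : 2^-1 * 4 = 2 :> C by field.
by rewrite mulrC.
Qed.

Lemma E2_halve t : E2 (halve_uhp t) = psum (@eps2 R) (qexp 2 t).
Proof. by rewrite E2_psum /qexp halve_uhp_val divr1. Qed.

Lemma qform_psum a : slow a -> qform 0 (fun t => psum a (qexp 2 t)).
Proof. by move=> sa; apply/qform0P; exists a. Qed.

Lemma qform_E2_double : qform 0 (fun t => E2 (double_uhp t)).
Proof.
apply: (qform_ext (qform_psum (slow_spread (isT : (0 < 4)%N) (@slow_eps2 R)))) => t.
by rewrite E2_double.
Qed.

Lemma qform_E2_halve : qform 0 (fun t => E2 (halve_uhp t)).
Proof. by apply: (qform_ext (qform_psum (@slow_eps2 R))) => t; rewrite E2_halve. Qed.

Lemma qform_eisA : qform 0 eisA.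
Proof.
apply: (qform_ext (qformD (qformZ 2 qform_E2_double) (qformZ (-1) (qform_E2 R)))) => t.
by rewrite mulN1r.
Qed.

Lemma qform_eisA_Smx : qform 0 (slash 2 Smx eisA).
Proof.
apply: (qform_ext (qformD (qformZ 2^-1 qform_E2_halve) (qformZ (-1) (qform_E2 R)))) => t.
by rewrite eisA_Smx mulN1r mulrC.
Qed.

Lemma modular_form_eisA : modular_form 2 eisA.
Proof.
apply/modular_formP; split.
- exact: holomorphic_qform qform_eisA.
- exact: eisA_slash.
- exact: qform_eisA.
- exact: qform_eisA_Smx.
Qed.

(** By [eisA_Smx] the value of A at the cusp 0 is 1/2 - 1 = - 1/2. That it is not 0 allows A to be
    cancelled there. *)
Lemma van_eisA_Smx : van (fun t => - 2 * slash 2 Smx eisA t - 1).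
Proof.
have se := @slow_eps2 R; have ss := slow_spread (isT : (0 < 2)%N) se.
have h1 := van_e2piM (grow_qform (strip0 R) (qform_psum (slow_shift ss))).
have h2 := van_e2piM (grow_qform (strip0 R) (qform_psum (slow_shift se))).
apply: (van_ext (vanD (vanZ 2 h1) (vanZ (-1) h2))) => t.
rewrite eisA_Smx E2_halve E2_q.
rewrite [psum (spread _ _) _](psum_shift ss (q_lt1 t)) [psum (@eps2 R) _](psum_shift se (q_lt1 t)).
have -> : spread 2 (@eps2 R) 0 = 1 by [].
have -> : @eps2 R 0 = 1 by [].
rewrite -/(qexp 2 t).
by field.
Qed.

End ScalarForms.

(** * The form D of weight 4 *)

Section CuspForm.
Variable R : realType.
Local Notation C := R[i].
Local Notation H := (uhp R).
Local Notation ip := (two_pi_i R).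
Implicit Types (t : H) (f w : H -> C) (g h : 'M[int]_2) (k l : int) (a : nat -> C).

Lemma slash_ode k g f : SL2Z g -> holomorphic f -> forall c : C, sderiv k f = (fun t => c * eisA t * f t) ->
  has_deriv (slash k g f)
    (fun t => ip * (c * slash 2 g (@eisA R) t + k%:~R / 12 * E2 t) * slash k g f t).
Proof.
move=> hg hf c E.
have h := has_deriv_sderiv k (@holomorphic_slash _ k g f hg hf).
apply: (has_deriv_eq h); first by [].
move=> t.
rewrite sderiv_slash // E.
rewrite [X in slash X g _](_ : k + 2 = 2 + k); last by rewrite addrC.
have -> : (fun t => c * eisA t * f t) = (fun t => c * (eisA t * f t)).
  by apply/funext => s; rewrite mulrA.
rewrite slashMl slash_mul //; ring.
Qed.

Lemma mx2_opp1_mobius t : mobius (mx2 (-1) 0 0 (-1)) t = t.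
Proof.
have h : SL2Z (mx2 (-1) 0 0 (-1)) by rewrite SL2Z_mx2.
apply: val_inj; rewrite mobius_val // /jf !mx2_ij mul0r add0r addr0.
by rewrite mulrNz mulN1r invrN invr1 mulrN mulr1 opprK.
Qed.

Lemma slash_opp1 (V : lmodType C) k (F : H -> V) t :
  slash k (mx2 (-1) 0 0 (-1)) F t = (-1) ^ (- k) *: F t.
Proof. by rewrite slashE mx2_opp1_mobius /jf !mx2_ij mul0r add0r mulrNz. Qed.

Lemma qexp_Tz2 t (n : int) : qexp 2 (mobius (mx2 1 (2 * n) 0 1) t) = qexp 2 t.
Proof.
rewrite qexp_Tz intrM mulrAC (_ : 2%:~R / 2 = 1 :> C) ?mul1r ?e2pi_int ?mul1r //.
by rewrite divff // pnatr_eq0.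
Qed.

Lemma slash_Tz (V : lmodType C) k (F : H -> V) n t :
  slash k (mx2 1 n 0 1) F t = F (mobius (mx2 1 n 0 1) t).
Proof. by rewrite slashE jf_Tz exp1rz scale1r. Qed.

(* D is the eta quotient eta(t)^16 / eta(2t)^8, obtained from its logarithmic
   derivative: its only zero is a simple one, in the parameter exp(pi i t), at
   the cusp 0. *)
Lemma cusp_form_exists : exists D : H -> C,
  [/\ forall t, D t != 0, modular_form 4 D, qform 0 (fun t => (D t)^-1),
      qform 0 (fun t => e2pi (- (val t / 2)) * slash 4 Smx D t) &
      qform 0 (fun t => e2pi (val t / 2) / slash 4 Smx D t)].
Proof.
have ip0 := two_pi_i_neq0 R.
have se := @slow_eps2 R.
have s2 := slow_spread (isT : (0 < 2)%N) se; have s4 := slow_spread (isT : (0 < 4)%N) se.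
(* Since eta has logarithmic derivative E2 / 24, the quotient has 16/24 E2(t) - 8 * 2/24 E2(2t). *)
pose b n : C := 2 / 3 * spread 2 (@eps2 R) n + - (2 / 3) * spread 4 (@eps2 R) n.
have sb : slow b by apply: slowD; exact: slowZ.
have bE t : psum b (qexp 2 t) = 2 / 3 * E2 t - 2 / 3 * E2 (double_uhp t).
  rewrite E2_double E2_q /b psumD ?q_lt1 //; try exact: slowZ.
  by rewrite !psumZ ?q_lt1 // mulNr.
have b0 : b 0%N = 0 by rewrite /b mulNr subrr.
have [e [e' [se1 se1' e0 ee' hD]]] := psum_exp sb.
pose D t : C := psum e (qexp 2 t).
have D0 t : D t != 0.
  by apply/eqP => D0; have := ee' t; rewrite -/(D t) D0 mul0r => /esym/eqP; rewrite oner_eq0.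
have {}hD : has_deriv D (fun t => ip * psum b (qexp 2 t) * D t).
  by apply: (has_deriv_eq hD) => t; rewrite b0 mul0r e2pi0 mul1r.
have holD := has_deriv_holomorphic hD.
have DsD : sderiv 4 D = (fun t => - (1 / 3) * eisA t * D t).
  rewrite (sderiv_ode 4 hD); apply/funext => t; rewrite bE /eisA.
  move: (E2 t) (E2 (double_uhp t)) (D t) => x y z.
  rewrite (_ : 4%:~R = 4 :> C) //; by field.
have ode g : SL2Z g -> has_deriv (slash 4 g D)
    (fun t => ip * (- (1 / 3) * slash 2 g (@eisA R) t + 4%:~R / 12 * E2 t) * slash 4 g D t).
  by move=> hg; exact: (@slash_ode 4 g D hg holD (- (1 / 3)) DsD).
(* A is invariant under g, so D and its transform solve the same equation; it remains to show that
   the multiplier c is 1 on generators. *)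
have chi g : Gamma0_2 g -> exists c : C, forall t, slash 4 g D t = c * D t.
  move=> hg; apply: (ode_unique D0 (has_deriv_eq (ode g (Gamma0_SL2Z hg)) (fun=> erefl) (fun t => _)) hD).
  move=> t; rewrite eisA_slash // bE /eisA; congr (ip * _ * _).
  rewrite (_ : 4%:~R = 4 :> C) //; move: (E2 t) (E2 (double_uhp t)) => x y; by field.
have D1 : van (fun t => D t - 1).
  apply: (van_ext (van_e2piM (grow_qform (strip0 R) (qform_psum (slow_shift se1))))) => t.
  by rewrite /D [in RHS]psum_shift ?q_lt1 // e0 addrAC subrr add0r.
have DT n : slash 4 (mx2 1 n 0 1) D = D.
  have [c hc] : exists c : C, forall t, slash 4 (mx2 1 n 0 1) D t = c * D t.
    by apply: chi; split; [exact: SL2Z_Tz|rewrite mx2_ij].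
  have /van_cst c1 : van (fun _ : H => c - 1).
    have v1 := van_Tz n D1; have v2 := vanZ (- c) D1.
    apply: (van_ext (vanD v1 v2)) => t; have := hc t; rewrite slash_Tz => ->; ring.
  apply/funext => t; rewrite hc.
  by move/eqP: c1; rewrite subr_eq0 => /eqP ->; rewrite mul1r.
(* The logarithmic derivative at the cusp 0. Its constant term 2/3 - 1/6 = 1/2 is the exponent of
   exp(pi i t): a simple zero. *)
pose bS n : C := 2 / 3 * spread 2 (@eps2 R) n + - (1 / 6) * eps2 R n.
have sbS : slow bS by apply: slowD; exact: slowZ.
have bSE t : psum bS (qexp 2 t) = 2 / 3 * E2 t - 1 / 6 * E2 (halve_uhp t).
  rewrite E2_halve E2_q /bS psumD ?q_lt1 //; try exact: slowZ.
  by rewrite !psumZ ?q_lt1 // mulNr.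
have bS0 : bS 0%N = 2^-1 by rewrite /bS /=; field.
have [s [s' [ss ss' s0 ss1 hS]]] := psum_exp sbS.
have hS0 t : e2pi (bS 0%N * val t) * psum s (qexp 2 t) != 0.
  rewrite mulf_neq0 ?e2pi_neq0 //; apply/eqP => s00.
  by have := ss1 t; rewrite s00 mul0r => /esym/eqP; rewrite oner_eq0.
have [c cE] : exists c : C, forall t, slash 4 Smx D t = c * (e2pi (bS 0%N * val t) * psum s (qexp 2 t)).
  apply: (ode_unique hS0 (has_deriv_eq (ode Smx SL2Z_Smx) (fun=> erefl) (fun t => _)) hS).
  move=> t; rewrite eisA_Smx bSE; congr (ip * _ * _).
  rewrite (_ : 4%:~R = 4 :> C) //; move: (E2 t) (E2 (halve_uhp t)) => x y; by field.
have {}cE t : slash 4 Smx D t = c * (e2pi (val t / 2) * psum s (qexp 2 t)).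
  by rewrite cE bS0 [2^-1 * _]mulrC.
have c0 : c != 0.
  apply/eqP => c0; have z0 : 0 < complex.Im ('i : C) by rewrite /= ltr01.
  have := cE (mkuhp z0); rewrite c0 mul0r slashE => /eqP.
  rewrite scaler_eq0 (negPf (D0 _)) orbF expfz_eq0 (negPf (jf_neq0 _ SL2Z_Smx)) andbF.
  by [].
(* Such a matrix is S T^(-2n) S^-1, and D | S, a series in integral powers of exp(pi i t), has
   period 2. *)
have DU n : slash 4 (mx2 1 0 (2 * n) 1) D = D.
  have E : mx2 1 0 (2 * n) 1 = Smx * mx2 1 (2 * - n) 0 1 * inv2 Smx.
    by rewrite /inv2 /Smx !mx2_ij !mx2M; apply: mx2P; rewrite !mx2_ij; split; ring.
  rewrite E slashM; last 2 first.
  - by apply: SL2ZM; [exact: SL2Z_Smx|exact: SL2Z_Tz].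
  - by apply: SL2Z_inv2; exact: SL2Z_Smx.
  rewrite slashM; [|exact: SL2Z_Smx|exact: SL2Z_Tz].
  have -> : slash 4 (mx2 1 (2 * - n) 0 1) (slash 4 Smx D) = slash 4 Smx D.
    apply/funext => t; rewrite slash_Tz !cE qexp_Tz2 mobius_Tz intrM mulrDl e2piD.
    rewrite [2%:~R * _ / 2]mulrAC divff ?pnatr_eq0 // mul1r e2pi_int mulr1.
    by [].
  rewrite -slashM; [|exact: SL2Z_Smx|apply: SL2Z_inv2; exact: SL2Z_Smx].
  by rewrite mul_inv2 ?slash1 //; exact: SL2Z_Smx.
have Dinv g : Gamma0_2 g -> slash 4 g D = D.
  elim/Gamma0_ind : g /.
  - exact: DT.
  - exact: DT.
  - exact: (DU 1).
  - exact: (DU (-1)).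
  - have sg : (-1 : C) ^ (- 4) = 1 by rewrite -exprnN -signr_odd expr0 invr1.
    by apply/funext => t; rewrite slash_opp1 sg scale1r.
  by move=> g h hg hh Eg Eh; rewrite (slashM _ _ (Gamma0_SL2Z hg) (Gamma0_SL2Z hh)) Eg Eh.
exists D; split=> //.
- apply/modular_formP; split=> //; first exact: qform_psum.
  apply/qform0P; exists (fun n => c * (if n is m.+1 then s m else 0)).
    by apply: slowZ; apply: slow_unshift.
  have su : slow (fun n => if n is m.+1 then s m else 0) by apply: slow_unshift.
  move=> t; rewrite cE (psumZ c su (q_lt1 t)) (psum_shift su (q_lt1 t)) add0r.
  by [].
- apply: (qform_ext (qform_psum se1')) => t.
  by apply: (mulfI (D0 t)); rewrite divff // ee'.
- apply: (qform_ext (qformZ c (qform_psum ss))) => t.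
  by rewrite cE mulrCA [e2pi (- _) * _]mulrA -e2piD addNr e2pi0 mul1r.
apply: (qform_ext (qformZ c^-1 (qform_psum ss'))) => t.
have st0 : psum s (qexp 2 t) != 0.
  apply/eqP => s00.
  by have := ss1 t; rewrite s00 mul0r => /esym/eqP; rewrite oner_eq0.
apply: (mulIf (mulf_neq0 c0 (mulf_neq0 (e2pi_neq0 (val t / 2)) st0))).
rewrite -cE divfK; last by rewrite cE !mulf_neq0 ?e2pi_neq0.
rewrite cE mulrACA mulVf // mul1r mulrCA [psum s' _ * _]mulrC ss1 mulr1.
by [].
Qed.

End CuspForm.

(** * Vector-valued forms *)

Section JordanForm2.
Variable R : realType.
Local Notation C := R[i].

Definition mat2 (a b c d : C) : 'M[C]_2 :=
  \matrix_(i < 2, j < 2) if i == 0 then (if j == 0 then a else b)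
                         else (if j == 0 then c else d).

Lemma mat2E (A : 'M[C]_2) : A = mat2 (A 0 0) (A 0 1) (A 1 0) (A 1 1).
Proof.
apply/matrixP => i j; rewrite !mxE.
by case: i => -[|[|//]] hi; case: j => -[|[|//]] hj /=; congr (A _ _); exact: val_inj.
Qed.

Lemma mat2_00 a b c d : mat2 a b c d 0 0 = a. Proof. by rewrite mxE. Qed.
Lemma mat2_01 a b c d : mat2 a b c d 0 1 = b. Proof. by rewrite mxE. Qed.
Lemma mat2_10 a b c d : mat2 a b c d 1 0 = c. Proof. by rewrite mxE. Qed.
Lemma mat2_11 a b c d : mat2 a b c d 1 1 = d. Proof. by rewrite mxE. Qed.
Definition mat2_ij := (mat2_00, mat2_01, mat2_10, mat2_11).

Lemma mat2P (A B : 'M[C]_2) : A 0 0 = B 0 0 -> A 0 1 = B 0 1 -> A 1 0 = B 1 0 -> A 1 1 = B 1 1 -> A = B.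
Proof. by move=> h1 h2 h3 h4; rewrite (mat2E A) (mat2E B) h1 h2 h3 h4. Qed.

Lemma mat2M_ij (A B : 'M[C]_2) i j : (A *m B) i j = A i 0 * B 0 j + A i 1 * B 1 j.
Proof.
by rewrite mxE big_ord_recl big_ord1; congr (_ + A _ _ * B _ _); exact: val_inj.
Qed.

Lemma det_mat2 (A : 'M[C]_2) : \det A = A 0 0 * A 1 1 - A 0 1 * A 1 0.
Proof.
rewrite (expand_det_row _ 0) big_ord_recl big_ord1 /cofactor !det_mx11 !mxE /=.
rewrite expr0 mul1r expr1 mulN1r mulrN.
by congr (_ * A _ _ - A _ _ * A _ _); apply/val_inj.
Qed.

Lemma jordan_form_mat2 (a b c d : C) : c = 0 -> b = 0 \/ (b = 1 /\ a = d) ->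
  is_jordan_form (mat2 a b c d).
Proof.
move=> -> hb; split=> i j.
  by rewrite mxE; case: i => -[|[|//]] hi; case: j => -[|[|//]] hj.
case: i => -[|[|//]] hi; case: j => -[|[|//]] hj //= _.
by rewrite !mxE /=; case: hb => [->|[-> ->]]; [left|right].
Qed.

(** [holomorphic_at_cusps] speaks only about matrices P that give a Jordan form; this provides one,
    without which it would yield no information. *)
Lemma jordan_form2_exists (A : 'M[C]_2) :
  exists2 P : 'M[C]_2, P \in unitmx & is_jordan_form (P *m A *m invmx P).
Proof.
have conj (P J : 'M[C]_2) : P 0 0 * P 1 1 - P 0 1 * P 1 0 != 0 -> P *m A = J *m P ->
    is_jordan_form J -> exists2 P : 'M[C]_2, P \in unitmx & is_jordan_form (P *m A *m invmx P).
  move=> dP E hJ; have u : P \in unitmx by rewrite unitmxE unitfE det_mat2.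
  by exists P => //; rewrite E -mulmxA mulmxV // mulmx1.
pose tr := A 0 0 + A 1 1; pose dt := A 0 0 * A 1 1 - A 0 1 * A 1 0.
pose s := sqrtC (tr ^+ 2 - 4 * dt).
have sE : s ^+ 2 = tr ^+ 2 - 4 * dt by exact: sqrtCK.
pose x := (tr + s) / 2; pose y := (tr - s) / 2.
have xy1 : x + y = tr by rewrite /x /y; field.
have xy2 : x * y = dt.
  have : x * y = (tr ^+ 2 - s ^+ 2) / 4 by rewrite /x /y; field.
  by rewrite sE => ->; field.
(* Either A is diagonal or some row r = (p, q) is cyclic, that is, r and r A are independent. *)
have [p [q pq]] : exists p q : C, (p = 0 /\ q = 0 /\ A 0 1 = 0 /\ A 1 0 = 0) \/
    p * (p * A 0 1 + q * A 1 1) - q * (p * A 0 0 + q * A 1 0) != 0.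
  have [b0|b0] := eqVneq (A 0 1) 0; last first.
    by exists 1, 0; right; rewrite !mul0r !mul1r addr0 subr0.
  have [c0|c0] := eqVneq (A 1 0) 0; last first.
    by exists 0, 1; right; rewrite !mul0r !mul1r !add0r oppr_eq0.
  by exists 0, 0; left.
move: pq => [[_ [_ [b0 c0]]]|pq].
  apply: (conj 1%:M A); rewrite ?mul1mx ?mulmx1 ?mxE /= ?mulr1 ?mulr0 ?subr0 ?oner_eq0 //.
  by rewrite (mat2E A) b0 c0; apply: jordan_form_mat2; [|left].
(* By Cayley-Hamilton, r (A - w) is a row eigenvector for z. Distinct eigenvalues give two such
   rows; equal ones give the chain r, r (A - x). *)
have row z w : z + w = tr -> z * w = dt ->
    (p * A 0 0 + q * A 1 0 - w * p) * A 0 0 + (p * A 0 1 + q * A 1 1 - w * q) * A 1 0 =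
      z * (p * A 0 0 + q * A 1 0 - w * p) /\
    (p * A 0 0 + q * A 1 0 - w * p) * A 0 1 + (p * A 0 1 + q * A 1 1 - w * q) * A 1 1 =
      z * (p * A 0 1 + q * A 1 1 - w * q).
  rewrite /tr /dt; move: (A 0 0) (A 0 1) (A 1 0) (A 1 1) => a b c d zw1 zw2.
  have e1 : z = a + d - w by rewrite -zw1 addrK.
  have e2 : (a + d - w) * w = a * d - b * c by rewrite -e1.
  by rewrite e1; split; apply/eqP; rewrite -subr_eq0; apply/eqP;
    [rewrite -[RHS](mulr0 p)|rewrite -[RHS](mulr0 q)];
    rewrite -[in RHS](subrr (a * d - b * c)) -{1}e2; ring.
have [xy|xy] := eqVneq x y.
  apply: (conj (mat2 p q (p * A 0 0 + q * A 1 0 - x * p) (p * A 0 1 + q * A 1 1 - x * q))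
    (mat2 x 1 0 x)).
  - rewrite !mat2_ij (_ : _ - _ = p * (p * A 0 1 + q * A 1 1) - q * (p * A 0 0 + q * A 1 0)) //.
    by ring.
  - have x1 : x + x = tr := etrans (congr1 (GRing.add x) xy) xy1.
    have x2 : x * x = dt := etrans (congr1 (GRing.mul x) xy) xy2.
    have [h1 h2] := row x x x1 x2.
    apply: mat2P; rewrite !mat2M_ij !mat2_ij ?h1 ?h2; ring.
  - by apply: jordan_form_mat2; [|right].
have [h1 h2] := row x y xy1 xy2.
have [h3 h4] := row y x (etrans (addrC y x) xy1) (etrans (mulrC y x) xy2).
apply: (conj (mat2 (p * A 0 0 + q * A 1 0 - y * p) (p * A 0 1 + q * A 1 1 - y * q)
  (p * A 0 0 + q * A 1 0 - x * p) (p * A 0 1 + q * A 1 1 - x * q)) (mat2 x 0 0 y)).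
- rewrite !mat2_ij (_ : _ - _ = (x - y) * (p * (p * A 0 1 + q * A 1 1) - q * (p * A 0 0 + q * A 1 0))).
    by apply: mulf_neq0; [rewrite subr_eq0|].
  by ring.
- apply: mat2P; rewrite !mat2M_ij !mat2_ij ?h1 ?h2 ?h3 ?h4; ring.
- by apply: jordan_form_mat2; [|left].
Qed.

End JordanForm2.

(** * Sums, products and derivatives of vector-valued forms *)

Section VectorValuedForms.
Variable R : realType.
Local Notation C := R[i].
Local Notation H := (uhp R).
Local Notation ip := (two_pi_i R).
Implicit Types (t : H) (f : H -> C) (g h : 'M[int]_2) (k l : int) (mu lam : C).

(** Indexed by the eigenvalue, which determines the exponent within the strip. *)
Definition jqfpoly lam f := exists mu, [/\ strip mu, e2pi mu = lam & qfpoly mu f].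

Lemma jqfpolyD lam (f g : H -> C) : jqfpoly lam f -> jqfpoly lam g -> jqfpoly lam (fun t => f t + g t).
Proof.
move=> [mu [smu <- hf]] [nu [snu E hg]].
by exists mu; split=> //; apply: qfpolyD => //; rewrite -(strip_inj snu smu E).
Qed.

Lemma jqfpolyM lam (f g : H -> C) : qform 0 f -> jqfpoly lam g -> jqfpoly lam (fun t => f t * g t).
Proof. by move=> hf [mu [smu <- hg]]; exists mu; split=> //; exact: qfpolyM. Qed.

Lemma sderiv_qfpoly k mu f : qfpoly mu f -> qfpoly mu (sderiv k f).
Proof.
move=> hf; have [f' df hf'] := qfpoly_deriv hf; rewrite (sderivE k df).
have h := qfpolyM (qformZ (- (k%:~R / 12)) (qform_E2 R)) hf.
by apply: (qfpoly_ext (qfpolyD (qfpolyZ ip^-1 hf') h)) => t; rewrite !mulNr.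
Qed.

Lemma jqfpoly_sderiv k lam f : jqfpoly lam f -> jqfpoly lam (sderiv k f).
Proof. by move=> [mu [smu <- hf]]; exists mu; split=> //; exact: sderiv_qfpoly. Qed.

Lemma holomorphic_qfpoly mu f : qfpoly mu f -> holomorphic f.
Proof. by move=> /qfpoly_deriv[f' hf _]; exact: has_deriv_holomorphic hf. Qed.

Lemma sderiv_lincomb n k (c : 'I_n -> C) (f : 'I_n -> H -> C) : (forall i, holomorphic (f i)) ->
  sderiv k (fun t => \sum_i c i * f i t) = (fun t => \sum_i c i * sderiv k (f i) t).
Proof.
move=> hf; have h i := has_derivZ (c i) (holomorphic_has_deriv (hf i)).
rewrite (sderivE k (has_deriv_sum h)); apply/funext => t.
rewrite !mulr_sumr -sumrB; apply: eq_bigr => i _.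
rewrite (sderivE k (holomorphic_has_deriv (hf i))) [RHS]mulrBr.
by congr (_ - _); rewrite mulrCA.
Qed.

Section Forms.
Variables (n : nat) (rho : 'M[int]_2 -> 'M[C]_n).
Implicit Types (F G : H -> 'cV[C]_n) (P : 'M[C]_n).
Local Notation M := (vv_modular_form rho).

Lemma holomorphic_at_cuspsP k F : holomorphic_at_cusps rho k F <->
  forall g h P, SL2Z g -> Gamma0_2 h -> g * Tmx ^+ 2 = h * g -> P \in unitmx ->
    is_jordan_form (P *m rho h *m invmx P) ->
    forall i, jqfpoly ((P *m rho h *m invmx P) i i) (fun t => (P *m slash k g F t) i 0).
Proof.
split=> [hF g h P hg hh gh hP hJ i|hF g h N P hg /is_cusp_period2 -> hh gh hP hJ i].
  have [nu [d [c [<- hc fE]]]] := hF g h 2%N P hg ((is_cusp_period2 2).2 erefl) hh gh hP hJ i.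
  have [mu smu E] := e2pi_surj (e2pi_neq0 nu); exists mu; split=> //.
  apply/qfpolyP; exists d, c; split=> // j.
  have /has_expansionP[mu' [smu' E' hmu']] := hc j.
  by rewrite (strip_inj smu smu') // E E'.
have [mu [smu E /qfpolyP[d [c [hc fE]]]]] := hF g h P hg hh gh hP hJ i.
exists mu, d, c; split=> // j.
by apply/has_expansionP; exists mu.
Qed.

Lemma vvD k F G : M k F -> M k G -> M k (fun t => F t + G t).
Proof.
move=> [F1 F2 /holomorphic_at_cuspsP F3] [G1 G2 /holomorphic_at_cuspsP G3]; split.
- move=> i; have := holomorphicD (F1 i) (G1 i).
  by rewrite (_ : (fun t => _) = (fun t => (F t + G t) i 0)) //; apply/funext => t; rewrite mxE.
- by move=> g hg; rewrite slashD F2 // G2 //; apply/funext => t; rewrite mulmxDr.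
- apply/holomorphic_at_cuspsP => g h P hg hh gh hP hJ i.
  have := jqfpolyD (F3 g h P hg hh gh hP hJ i) (G3 g h P hg hh gh hP hJ i).
  rewrite (_ : (fun t => _) = (fun t => (P *m slash k g (fun t => F t + G t) t) i 0)) //.
  by apply/funext => t; rewrite slashD mulmxDr [in RHS]mxE.
Qed.

Lemma vvM l k f F : modular_form l f -> M k F -> M (l + k) (fun t => f t *: F t).
Proof.
move=> [f1 f2 f3] [F1 F2 /holomorphic_at_cuspsP F3]; split.
- move=> i; have := holomorphicM f1 (F1 i).
  by rewrite (_ : (fun t => _) = (fun t => (f t *: F t) i 0)) //; apply/funext => t; rewrite mxE.
- move=> g hg; rewrite slash_scale ?f2 ?F2 //; last exact: Gamma0_SL2Z.
  by apply/funext => t; rewrite scalemxAr.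
- apply/holomorphic_at_cuspsP => g h P hg hh gh hP hJ i.
  have /has_expansion0 qf := f3 g 2%N hg ((is_cusp_period2 2).2 erefl).
  have := jqfpolyM qf (F3 g h P hg hh gh hP hJ i).
  rewrite (_ : (fun t => _) = (fun t => (P *m slash (l + k) g (fun t => f t *: F t) t) i 0)) //.
  by apply/funext => t; rewrite slash_scale // -(scalemxAr (slash l g f t)) [RHS]mxE.
Qed.

Lemma vvZ k (c : C) F : M k F -> M k (fun t => c *: F t).
Proof. by move=> /(vvM (modular_form_cst c)); rewrite add0r. Qed.

Lemma vv0 k l F : M k F -> M l (fun=> 0).
Proof.
move=> /(vvM (modular_form0 R (l - k))); rewrite subrK.
by congr (M l _); apply/funext => t; rewrite scale0r.
Qed.

Lemma slash_entryE k g F i t : slash k g F t i 0 = slash k g (fun t => F t i 0) t.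
Proof. by rewrite !slashE mxE. Qed.

Lemma slash_modular_derivative k g F i t : SL2Z g -> (forall i, holomorphic (fun t => F t i 0)) ->
  slash (k + 2) g (modular_derivative k F) t i 0 = sderiv k (fun t => slash k g F t i 0) t.
Proof.
move=> hg hF; rewrite slash_entryE.
have -> : (fun t => slash k g F t i 0) = slash k g (fun t => F t i 0).
  by apply/funext => s; rewrite slash_entryE.
rewrite (sderiv_slash k hg (hF i)); congr (slash _ _ _ _).
by apply/funext => s; rewrite modular_derivativeE.
Qed.

Lemma holomorphic_slash_entry k g F i : SL2Z g -> (forall i, holomorphic (fun t => F t i 0)) ->
  holomorphic (fun t => slash k g F t i 0).
Proof.
move=> hg hF; have -> : (fun t => slash k g F t i 0) = slash k g (fun t => F t i 0).
  by apply/funext => s; rewrite slash_entryE.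
exact: holomorphic_slash (hF i).
Qed.

Lemma vv_derivative k F : M k F ->
  (exists2 P, P \in unitmx & is_jordan_form (P *m rho (Tmx ^+ 2) *m invmx P)) ->
  M (k + 2) (modular_derivative k F).
Proof.
move=> [F1 F2 /holomorphic_at_cuspsP F3] [P0 uP0 jP0].
have lin g P i t : SL2Z g -> (P *m slash (k + 2) g (modular_derivative k F) t) i 0 =
    sderiv k (fun t => (P *m slash k g F t) i 0) t.
  move=> hg; rewrite mxE.
  have -> : (fun t => (P *m slash k g F t) i 0) = (fun t => \sum_j P i j * slash k g F t j 0).
    by apply/funext => s; rewrite mxE.
  rewrite sderiv_lincomb; last by move=> j; exact: holomorphic_slash_entry.
  by apply: eq_bigr => j _; rewrite slash_modular_derivative.
split.
(* That the derivative is again holomorphic comes from the cusp oo: in Jordan coordinates the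
   entries of F are polynomials in t over power series, a class closed under differentiation. *)
- move=> i; have hy j : jqfpoly ((P0 *m rho (Tmx ^+ 2) *m invmx P0) j j) (fun t => (P0 *m F t) j 0).
    have := F3 1 (Tmx ^+ 2) P0 SL2Z1 _ _ uP0 jP0 j; rewrite slash1; apply.
      by split; [exact: SL2Z_TmxX|rewrite TmxX mx2_ij].
    by rewrite mul1r mulr1.
  have hy1 j : holomorphic (fun t => (P0 *m F t) j 0).
    by have [mu [_ _ /holomorphic_qfpoly]] := hy j.
  have hy2 j : holomorphic (sderiv k (fun t => (P0 *m F t) j 0)).
    by have [mu [_ _ /holomorphic_qfpoly]] := jqfpoly_sderiv k (hy j).
  have -> : (fun t => modular_derivative k F t i 0) =
      (fun t => \sum_j invmx P0 i j * sderiv k (fun t => (P0 *m F t) j 0) t).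
    rewrite -sderiv_lincomb //; apply/funext => t; rewrite modular_derivativeE.
    congr (sderiv k _ t); apply/funext => s.
    by rewrite -[F s in LHS](mulKmx uP0) mxE.
  have h j := has_derivZ (invmx P0 i j) (holomorphic_has_deriv (hy2 j)).
  exact: has_deriv_holomorphic (has_deriv_sum h).
- move=> g hg; have hg' := Gamma0_SL2Z hg; apply/funext => t; apply/matrixP => i j.
  rewrite ord1 slash_modular_derivative // F2 //.
  have := lin 1 (rho g) i t SL2Z1; rewrite !slash1 => ->.
  by [].
- apply/holomorphic_at_cuspsP => g h P hg hh gh hP hJ i.
  have := jqfpoly_sderiv k (F3 g h P hg hh gh hP hJ i).
  rewrite (_ : sderiv _ _ = (fun t => (P *m slash (k + 2) g (modular_derivative k F) t) i 0)) //.
  by apply/funext => t; rewrite lin.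
Qed.

End Forms.

End VectorValuedForms.

(** * Vanishing at the cusp 0 and division by D *)

Section CuspZero.
Variable R : realType.
Local Notation C := R[i].
Local Notation H := (uhp R).
Variable rho : 'M[int]_2 -> 'M[C]_2.
Implicit Types (t : H) (f : H -> C) (F G : H -> 'cV[C]_2) (P : 'M[C]_2) (k l : int).
Local Notation M := (vv_modular_form rho).

(* A generator, up to sign, of the stabilizer of the cusp 0 in Gamma_0(2). *)
Definition stab0 : 'M[int]_2 := Smx * Tmx ^+ 2 * inv2 Smx.

Lemma Gamma0_stab0 : Gamma0_2 stab0.
Proof.
have [_] := (T_power_in_conjugatesE 2).2 (conj isT isT).
by move=> /(_ _ SL2Z_Smx); rewrite invg2E //; exact: SL2Z_Smx.
Qed.

Lemma stab0_Smx : Smx * Tmx ^+ 2 = stab0 * Smx.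
Proof. by rewrite /stab0 -mulrA inv2_mul ?mulr1 //; exact: SL2Z_Smx. Qed.

Lemma grow_mulmx m (A : 'M[C]_(m, 2)) F : (forall i, grow (fun t => F t i 0)) ->
  forall i, grow (fun t => (A *m F t) i 0).
Proof.
move=> hF i; apply: (grow_ext (grow_sum (fun j => growZ (A i j) (hF j)))) => t.
by rewrite mxE.
Qed.

Lemma van_mulmx m (A : 'M[C]_(m, 2)) F : (forall i, van (fun t => F t i 0)) ->
  forall i, van (fun t => (A *m F t) i 0).
Proof.
move=> hF i; apply: (van_ext (van_sum (fun j => vanZ (A i j) (hF j)))) => t.
by rewrite mxE.
Qed.

Lemma grow_slash k G : M k G -> forall i, grow (fun t => slash k Smx G t i 0).
Proof.
move=> [_ _ /holomorphic_at_cuspsP hG].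
have [P uP jP] := jordan_form2_exists (rho stab0).
have h i : grow (fun t => (P *m slash k Smx G t) i 0).
  have [mu [smu _ hq]] := hG _ _ P SL2Z_Smx Gamma0_stab0 stab0_Smx uP jP i.
  exact: grow_qfpoly hq.
move=> i; apply: (grow_ext (grow_mulmx (invmx P) h i)) => t.
by rewrite mulKmx.
Qed.

Lemma slashV k g f t : slash (- k) g (fun t => (f t)^-1) t = (slash k g f t)^-1.
Proof. by rewrite !slashE !scalecE invfM invr_expz. Qed.

(* Vanishing at the cusp 0. *)
Definition vanish0 k G := forall i, van (fun t => slash k Smx G t i 0).

Lemma vanish0_0 k : vanish0 k (fun _ : H => 0 : 'cV[C]_2).
Proof.
move=> i; have -> : (fun t => slash k Smx (fun _ : H => 0 : 'cV[C]_2) t i 0) = (fun=> 0).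
  by apply/funext => t; rewrite slashE scaler0 mxE.
exact: van0.
Qed.

Section Division.
Variable D : H -> C.
Hypotheses (D0 : forall t, D t != 0) (D_form : modular_form 4 D)
  (D_inv : qform 0 (fun t => (D t)^-1))
  (D_zero_inv : qform 0 (fun t => e2pi (val t / 2) / slash 4 Smx D t)).

(** At oo the inverse of D is regular; at the cusp 0 its pole is simple and is cancelled by the
    factor exp(pi i t) that [qfpoly_van] extracts from G. *)
Lemma vv_divide k G : M k G -> vanish0 k G -> M (k - 4) (fun t => (D t)^-1 *: G t).
Proof.
have [D1 D2 D3] := D_form; rewrite addrC.
move=> [G1 G2 /holomorphic_at_cuspsP G3] vG; split.
- move=> i; have := holomorphicM (holomorphic_qform D_inv) (G1 i).
  rewrite (_ : (fun t => _) = (fun t => ((D t)^-1 *: G t) i 0)) //.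
  by apply/funext => t; rewrite mxE.
- move=> g hg; rewrite slash_scale; last exact: Gamma0_SL2Z.
  apply/funext => t; rewrite slashV D2 // G2 //.
  by rewrite scalemxAr.
- apply/holomorphic_at_cuspsP => g h P hg hh gh hP hJ i.
  have [mu [smu E hq]] := G3 g h P hg hh gh hP hJ i.
  have fE t : (P *m slash (- (4 : int) + k) g (fun t => (D t)^-1 *: G t) t) i 0 =
      (slash 4 g D t)^-1 * (P *m slash k g G t) i 0.
    by rewrite slash_scale // slashV -(scalemxAr (slash 4 g D t)^-1) [LHS]mxE.
  exists mu; split=> //.
  have [gG|[gamma hgamma [j gE]]] := Gamma0_cosets hg.
    apply: (qfpoly_ext (qfpolyM D_inv hq)) => t; rewrite fE.
    by rewrite D2.
  have Tj := qform_Tz j%:Z D_zero_inv.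
  have vq : van (fun t => (P *m slash k g G t) i 0).
    have v1 := van_mulmx (P *m rho gamma) vG.
    apply: (van_ext (van_Tz j%:Z (v1 i))) => t.
    rewrite gE slash_cosets // (G2 _ hgamma).
    by rewrite slash_mulmx mulmxA.
  have [f1 hf1 f1E] := qfpoly_van smu hq vq.
  (* The constant compensates the translation by j in the local parameter. *)
  apply: (qfpoly_ext (qfpolyZ (e2pi (- (j%:~R / 2))) (qfpolyM Tj hf1))) => t.
  rewrite fE f1E gE slash_cosets // (D2 _ hgamma) mobius_Tz.
  rewrite mulrDl e2piD e2piN.
  have cancel (a b c d : C) : b != 0 -> b^-1 * (a * b * c * d) = c * (a * d).
    by move=> b0; rewrite [a * b]mulrC -!mulrA mulKf // mulrCA.
  exact: cancel (e2pi_neq0 _).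
Qed.

Lemma modular_form_divide k f : modular_form k f -> van (slash k Smx f) ->
  modular_form (k - 4) (fun t => (D t)^-1 * f t).
Proof.
have [_ D2 _] := D_form; rewrite addrC.
move=> /modular_formP[f1 f2 f3 f4] vf; apply/modular_formP; split.
- exact: holomorphicM (holomorphic_qform D_inv) f1.
- move=> g hg; rewrite slash_mul; last exact: Gamma0_SL2Z.
  by apply/funext => t; rewrite slashV D2 // f2.
- exact: qformM.
- rewrite slash_mul; last exact: SL2Z_Smx.
  have [f0 hf0 f0E] := qform_van (strip0 R) f4 vf.
  apply: (qform_ext (qformM D_zero_inv hf0)) => t.
  by rewrite slashV f0E mulrA [_^-1 * _]mulrC.
Qed.

End Division.

(** The leading term at the cusp 0 in Jordan coordinates: one polynomial per component, up to
    functions vanishing there. *)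
Definition lead P k G (p : 'I_2 -> {poly C}) := forall i, exists mu, [/\ strip mu,
  e2pi mu = (P *m rho stab0 *m invmx P) i i &
  van (fun t => (P *m slash k Smx G t) i 0 - e2pi (mu * val t / 2) * (p i).[val t])].

Lemma lead_exists P k G : M k G -> P \in unitmx -> is_jordan_form (P *m rho stab0 *m invmx P) ->
  exists p, lead P k G p.
Proof.
move=> [_ _ /holomorphic_at_cuspsP hG] uP jP.
have h i : exists p : {poly C}, exists mu, [/\ strip mu,
  e2pi mu = (P *m rho stab0 *m invmx P) i i &
  van (fun t => (P *m slash k Smx G t) i 0 - e2pi (mu * val t / 2) * p.[val t])].
  have [mu [smu E /qfpoly_lead[p [f1 [hf1 fE]]]]] :=
    hG _ _ P SL2Z_Smx Gamma0_stab0 stab0_Smx uP jP i.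
  exists p, mu; split=> //.
  apply: (van_ext (van_e2piM (grow_qfpoly smu hf1))) => t.
  by rewrite fE addrAC subrr add0r.
have [p hp] := boolp.choice h.
by exists p.
Qed.

Lemma lead_sum n P k (G : 'I_n -> H -> 'cV[C]_2) (p : 'I_n -> 'I_2 -> {poly C}) (c : 'I_n -> C) :
  (0 < n)%N -> (forall j, lead P k (G j) (p j)) ->
  lead P k (fun t => \sum_j c j *: G j t) (fun i => \sum_j c j *: p j i).
Proof.
case: n G p c => // n G p c _ hp i.
have [mu [smu E _]] := hp ord0 i.
have h j : van (fun t => (P *m slash k Smx (G j) t) i 0 - e2pi (mu * val t / 2) * (p j i).[val t]).
  by have [nu [snu E' hnu]] := hp j i; rewrite (strip_inj smu snu) // E E'.
exists mu; split=> //.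
apply: (van_ext (van_sum (fun j => vanZ (c j) (h j)))) => t.
rewrite horner_sum mulr_sumr slashE scaler_sumr mulmx_sumr summxE -sumrB.
apply: eq_bigr => j _; rewrite hornerZ mulrBr [in X in _ - X = _]mulrCA; congr (_ - _).
by rewrite slashE [in RHS]scalerA [in RHS]mulrC -[in RHS]scalerA -(scalemxAr (c j)) [RHS]mxE.
Qed.

Lemma slash_Smx_T2 k G t : M k G ->
  slash k Smx G (mobius (mx2 1 2 0 1) t) = rho stab0 *m slash k Smx G t.
Proof.
move=> [_ G2 _].
have E : slash k (Smx * Tmx ^+ 2) G t = slash k Smx G (mobius (mx2 1 2 0 1) t).
  by rewrite slashM; [rewrite TmxX slash_Tz|exact: SL2Z_Smx|exact: SL2Z_TmxX].
rewrite -E stab0_Smx slashM; [|exact: Gamma0_SL2Z Gamma0_stab0|exact: SL2Z_Smx].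
by rewrite G2 ?slash_mulmx //; exact: Gamma0_stab0.
Qed.

Lemma poly_even_nat_roots (p : {poly C}) : (forall n : nat, p.[(2 * n)%:R] = 0) -> p = 0.
Proof.
move=> hp; pose rs := [seq (2 * n)%:R : C | n <- iota 0 (size p)].
apply: (@roots_geq_poly_eq0 _ p rs).
- by apply/allP => x /mapP[n _ ->]; rewrite rootE hp.
- rewrite map_inj_uniq ?iota_uniq // => m n /eqP; rewrite eqr_nat eqn_pmul2l //.
  by move=> /eqP.
- by rewrite size_map size_iota.
Qed.

(* The translation by 2 acts on the leading polynomials through the Jordan form
   with the scalars [e2pi mu] divided out, so they vanish at 2n as soon as they
   vanish at 0. *)
Lemma lead_zero P k G p : M k G -> P \in unitmx ->
  is_jordan_form (P *m rho stab0 *m invmx P) -> lead P k G p ->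
  (forall i, (p i).[0] = 0) -> vanish0 k G.
Proof.
move=> hG uP jP hp p0.
set J := P *m rho stab0 *m invmx P in jP.
(* A Jordan matrix couples only components with the same eigenvalue, hence the same exponent, so the
   exponentials can be divided out. *)
have JE i m : J i m = 0 \/ J i i = J m m.
  have [->|mi] := eqVneq m i; first by right.
  have [mi1|mi1] := eqVneq (m : nat) i.+1; last by left; exact: jP.1.
  by have [h|[_ h]] := jP.2 i m mi1; [left|right].
have [mu hmu] := boolp.choice hp.
have step i (n : nat) : J i i * (p i).[(2 * n.+1)%:R] = \sum_m J i m * (p m).[(2 * n)%:R].
  have [smu E v] := hmu i.
  (* The leading terms of both sides of [slash_Smx_T2]; the factor J i i is what e2pi(mu t / 2)
     gains under t |-> t + 2. *)
  pose q := J i i *: (p i \Po ('X + 2%:P)) - \sum_m J i m *: p m.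
  suff q0 : q = 0.
    have := congr1 (fun r => r.[(2 * n)%:R]) q0.
    rewrite /q horner0 hornerD hornerN hornerZ horner_comp hornerD hornerX hornerC horner_sum.
    have -> : (2 * n)%:R + 2 = (2 * n.+1)%:R :> C by rewrite mulnS addnC natrD.
    move=> /eqP; rewrite subr_eq0 => /eqP ->; apply: eq_bigr => m _.
    by rewrite hornerZ.
  apply: (van_poly0 smu).
  have v1 := vanZ (-1) (van_Tz 2 v).
  have v2 := van_sum (fun m => vanZ (J i m) (let: And3 _ _ h := hmu m in h)).
  apply: (van_ext (vanD v1 v2)) => t.
  have PE : (P *m slash k Smx G (mobius (mx2 1 2 0 1) t)) i 0 =
      \sum_m J i m * (P *m slash k Smx G t) m 0.
    by rewrite slash_Smx_T2 // mulmxA -[P *m rho _](mulmxKV uP) -/J -mulmxA mxE.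
  rewrite PE mobius_Tz.
  have -> : \sum_m J i m * ((P *m slash k Smx G t) m 0 - e2pi (mu m * val t / 2) * (p m).[val t]) =
      \sum_m J i m * (P *m slash k Smx G t) m 0 -
      \sum_m J i m * (e2pi (mu i * val t / 2) * (p m).[val t]).
    rewrite -sumrB; apply: eq_bigr => m _; rewrite mulrBr.
    have [->|Jim] := JE i m; first by rewrite !mul0r.
    have [smu' E' _] := hmu m.
    by rewrite (strip_inj smu smu') // E E'.
  rewrite mulN1r opprB addrA subrK.
  rewrite /q hornerD hornerN hornerZ horner_comp hornerD hornerX hornerC horner_sum mulrBr.
  congr (_ - _).
    rewrite -E mulrDr mulrDl e2piD (_ : mu i * 2%:~R / 2 = mu i) ?mulrA //.
    by rewrite -mulrA divff ?mulr1 // pnatr_eq0.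
  by rewrite mulr_sumr; apply: eq_bigr => m _; rewrite hornerZ mulrCA.
have all0 (n : nat) : forall i, (p i).[(2 * n)%:R] = 0.
  elim: n => [|n IHn] i; first by rewrite muln0 p0.
  have [_ E _] := hmu i.
  apply: (mulfI (_ : J i i != 0)); first by rewrite -E e2pi_neq0.
  by rewrite step mulr0 big1 // => m _; rewrite IHn mulr0.
have pz i : p i = 0 by apply: poly_even_nat_roots => n; exact: all0.
have vP i : van (fun t => (P *m slash k Smx G t) i 0).
  have [_ _ v] := hmu i; apply: (van_ext v) => t.
  by rewrite pz horner0 mulr0 subr0.
move=> i; apply: (van_ext (van_mulmx (invmx P) vP i)) => t.
by rewrite mulKmx.
Qed.

Lemma vanishing_combination k G1 G2 G3 : M k G1 -> M k G2 -> M k G3 ->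
  exists a b c : C, ~ (a = 0 /\ b = 0 /\ c = 0) /\
    vanish0 k (fun t => a *: G1 t + b *: G2 t + c *: G3 t).
Proof.
move=> h1 h2 h3; pose G (j : 'I_3) := nth (fun=> 0) [:: G1; G2; G3] j.
have hG j : M k (G j) by case: j => -[|[|[|//]]] hj.
have [P uP jP] := jordan_form2_exists (rho stab0).
have [p hp] := boolp.choice (fun j => lead_exists (hG j) uP jP).
(* By [lead_zero] only these two values per form matter, and three rows in a plane are dependent. *)
pose A : 'M[C]_(3, 2) := \matrix_(j, i) (p j i).[0].
have kA : kermx A != 0.
  rewrite -mxrank_eq0 mxrank_ker subn_eq0 -ltnNge.
  exact: leq_ltn_trans (rank_leq_col A) _.
have /rowV0Pn[c /sub_kermxP cA c0] := kA.
have comb : M k (fun t => \sum_j c 0 j *: G j t).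
  have h n (e : 'I_n -> C) (E : 'I_n -> H -> 'cV[C]_2) : (forall j, M k (E j)) ->
      M k (fun t => \sum_j e j *: E j t).
    elim: n e E => [|n IHn] e E hE.
      have := vv0 k h1; congr (M k _); apply/funext => t; by rewrite big_ord0.
    have := vvD (vvZ (e ord0) (hE ord0)) (IHn (fun j => e (lift ord0 j)) _ (fun j => hE (lift ord0 j))).
    by congr (M k _); apply/funext => t; rewrite big_ord_recl.
  exact: h.
have v := lead_zero comb uP jP (lead_sum (fun j => c 0 j) (isT : (0 < 3)%N) hp) _.
pose j1 : 'I_3 := lift ord0 ord0; pose j2 : 'I_3 := lift ord0 (lift ord0 ord0).
exists (c 0 ord0), (c 0 j1), (c 0 j2); split.
  move=> [z0 [z1 z2]]; move/eqP: c0; apply; apply/rowP => j; rewrite mxE.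
  case: j => -[|[|[|//]]] hj.
  - by rewrite -[RHS]z0; congr (c _ _); exact: val_inj.
  - by rewrite -[RHS]z1; congr (c _ _); exact: val_inj.
  - by rewrite -[RHS]z2; congr (c _ _); exact: val_inj.
have -> : (fun t => c 0 ord0 *: G1 t + c 0 j1 *: G2 t + c 0 j2 *: G3 t) =
    (fun t => \sum_j c 0 j *: G j t).
  apply/funext => t; rewrite !big_ord_recl big_ord0 addr0 addrA.
  by [].
apply: v => i; rewrite horner_sum.
have := congr1 (fun r : 'rV[C]_2 => r 0 i) cA; rewrite !mxE => E.
rewrite -[RHS]E; apply: eq_bigr => j _; rewrite hornerZ mxE.
by [].
Qed.

End CuspZero.

(** * Forms of minimal weight *)

Section MinimalWeight.
Variable R : realType.
Local Notation C := R[i].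
Local Notation H := (uhp R).
Local Notation ip := (two_pi_i R).
Variable rho : 'M[int]_2 -> 'M[C]_2.
Hypotheses (rho_rep : representation rho) (rho_irr : irreducible rho).
Implicit Types (t : H) (f : H -> C) (X Y G : H -> 'cV[C]_2) (k l : int).
Local Notation M := (vv_modular_form rho).
Local Notation A := (@eisA R).

Lemma vvX k G n : M k G -> M (2 *+ n + k) (fun t => A t ^+ n *: G t).
Proof. exact: vvM (modular_formX n (modular_form_eisA R)). Qed.

Lemma vvA k G : M k G -> M (k + 2) (fun t => A t *: G t).
Proof. by rewrite addrC; exact: vvM (modular_form_eisA R). Qed.

Lemma vvDeriv k G : M k G -> M (k + 2) (modular_derivative k G).
Proof. by move=> hG; apply: vv_derivative hG (jordan_form2_exists _). Qed.

(** At the cusp 0 the form - 2 A tends to 1, so G and - 2 A G differ by something vanishing. *)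
Lemma vanish0_A k G : M k G -> vanish0 (2 + k) (fun t => A t *: G t) -> vanish0 k G.
Proof.
move=> hG v i.
have v1 := vanM (grow_slash hG i) (@van_eisA_Smx R).
apply: (van_ext (vanD (vanZ (-2) (v i)) (vanZ (-1) v1))) => t.
rewrite slash_scale; last exact: SL2Z_Smx.
by rewrite [((_ *: _ : 'cV[C]_2) i 0)]mxE; ring.
Qed.

Lemma vanish0_AX k G n : M k G -> vanish0 (2 *+ n + k) (fun t => A t ^+ n *: G t) -> vanish0 k G.
Proof.
move=> hG; elim: n => [|n IHn].
  rewrite add0r; congr (vanish0 k _); apply/funext => t.
  by rewrite expr0 scale1r.
rewrite mulrS -addrA => v; apply: IHn; apply: (vanish0_A (vvX n hG)).
move: v; congr (vanish0 _ _); apply/funext => t.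
by rewrite exprS scalerA.
Qed.

Lemma mulmx_line_invariant (v : 'cV[C]_2) : v != 0 ->
  (forall g, Gamma0_2 g -> exists c : C, rho g *m v = c *: v) -> False.
Proof.
move=> v0 hv; have [_ irr] := rho_irr.
have [] := irr <[v]>%VS.
- move=> g w hg /vlineP[a ->]; have [c hc] := hv g hg.
  by rewrite -scalemxAr hc scalerA; apply/vlineP; exists (a * c).
- by move/eqP; rewrite -dimv_eq0 dim_vline v0.
- move=> h; have := congr1 (fun U : {vspace 'cV[C]_2} => \dim U) h.
  by rewrite dim_vline v0 dimvf dim_matrix.
Qed.

(* An equation [D X = c A X] determines [X] up to a constant vector, which then
   spans an invariant line. *)
Lemma deriv_eigenform k X (c : C) : M k X ->
  (forall t, modular_derivative k X t = c *: (A t *: X t)) -> X = fun=> 0.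
Proof.
move=> [X1 X2 _] hX.
pose w t := c * A t + k%:~R / 12 * E2 t.
have /qform0P[b sb bE] : qform 0 w.
  by apply: qformD; [exact: qformZ (qform_eisA R)|exact: qformZ (qform_E2 R)].
have [e [e' [se se' _ ee' he]]] := psum_exp sb.
pose r t : C := e2pi (b 0%N * val t) * psum e (qexp 2 t).
have r0 t : r t != 0.
  rewrite mulf_neq0 ?e2pi_neq0 //; apply/eqP => e0.
  by have := ee' t; rewrite e0 mul0r => /esym/eqP; rewrite oner_eq0.
have hr : has_deriv r (fun t => ip * w t * r t).
  by apply: (has_deriv_eq he) => // t; rewrite -bE.
have hXi i : exists v : C, forall t, X t i 0 = v * r t.
  apply: (ode_unique r0 _ hr).
  apply: (has_deriv_eq (has_deriv_sderiv k (X1 i))) => // t.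
  rewrite -modular_derivativeE hX !mxE /w.
  by move: (X t i 0) (A t) (E2 t) (k%:~R : C) ip => *; ring.
have [v hv] := boolp.choice hXi.
pose V : 'cV[C]_2 := \col_i v i.
have XE t : X t = r t *: V by apply/matrixP => i j; rewrite ord1 hv !mxE mulrC.
have [V0|V0] := eqVneq V 0.
  by apply/funext => t; rewrite XE V0 scaler0.
exfalso; apply: (mulmx_line_invariant V0) => g hg.
have z0 : 0 < complex.Im ('i : C) by rewrite /= ltr01.
pose s := mkuhp z0; exists ((r s)^-1 * (slash k g r s)).
have := congr1 (fun Y : H -> 'cV[C]_2 => Y s) (X2 g hg).
rewrite slashE !XE -scalemxAr scalerA => E.
by rewrite -scalerA slashE scalecE E scalerA mulVf ?scale1r.
Qed.

Lemma modular_derivativeD k X Y : M k X -> M k Y ->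
  modular_derivative k (fun t => X t + Y t) =
  (fun t => modular_derivative k X t + modular_derivative k Y t).
Proof.
move=> [X1 _ _] [Y1 _ _]; apply/funext => t; apply/matrixP => i j; rewrite ord1 !modular_derivativeE.
rewrite [RHS]mxE !modular_derivativeE.
have [f hX] : exists f, has_deriv (fun t => X t i 0) f := ex_intro _ _ (holomorphic_has_deriv (X1 i)).
have [g hY] : exists g, has_deriv (fun t => Y t i 0) g := ex_intro _ _ (holomorphic_has_deriv (Y1 i)).
have -> : (fun t => (X t + Y t) i 0) = (fun t => X t i 0 + Y t i 0).
  by apply/funext => s; rewrite mxE.
rewrite (sderivE k (has_derivD hX hY)) (sderivE k hX) (sderivE k hY).
by move: (f t) (g t) (X t i 0) (Y t i 0) (E2 t) (k%:~R : C) ip => *; ring.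
Qed.

Lemma modular_derivativeZ k (c : C) X : M k X ->
  modular_derivative k (fun t => c *: X t) = (fun t => c *: modular_derivative k X t).
Proof.
move=> [X1 _ _]; apply/funext => t; apply/matrixP => i j; rewrite ord1 !modular_derivativeE.
rewrite [RHS]mxE !modular_derivativeE.
have [f hX] : exists f, has_deriv (fun t => X t i 0) f := ex_intro _ _ (holomorphic_has_deriv (X1 i)).
have -> : (fun t => (c *: X t) i 0) = (fun t => c * X t i 0).
  by apply/funext => s; rewrite mxE.
rewrite (sderivE k (has_derivZ c hX)) (sderivE k hX).
by move: (f t) (X t i 0) (E2 t) (k%:~R : C) ip => *; ring.
Qed.

Lemma mul_opp1_central g : g * mx2 (-1) 0 0 (-1) = mx2 (-1) 0 0 (-1) * g.
Proof. by apply: mx2P; rewrite !mx2M_ij !mx2_ij; split; ring. Qed.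

Lemma Gamma0_opp1 : Gamma0_2 (mx2 (-1) 0 0 (-1)).
Proof. by split; [rewrite SL2Z_mx2|rewrite mx2_ij]. Qed.

(** Values of X are eigenvectors of the central element rho(-1). The eigenspace is invariant and
    nonzero, hence everything, and it contains a nonzero value of Y. *)
Lemma weight_parity k l X Y : M k X -> M l Y -> X <> (fun=> 0) -> Y <> (fun=> 0) ->
  (-1) ^ (- k) = (-1) ^ (- l) :> C.
Proof.
move=> [_ X2 _] [_ Y2 _] X0 Y0.
have nz (Z : H -> 'cV[C]_2) : Z <> (fun=> 0) -> exists t, Z t != 0.
  move=> Z0; apply: boolp.contrapT => h; apply: Z0; apply/funext => t.
  by apply/eqP/negPn/negP => Zt; apply: h; exists t.
have [t Xt] := nz X X0; have [s Ys] := nz Y Y0.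
set N := mx2 (-1) 0 0 (-1).
have EX := congr1 (fun Z : H -> 'cV[C]_2 => Z t) (X2 N Gamma0_opp1).
have EY := congr1 (fun Z : H -> 'cV[C]_2 => Z s) (Y2 N Gamma0_opp1).
rewrite !slash_opp1 in EX EY.
set a := (-1) ^ (- k) in EX *; set b := (-1) ^ (- l) in EY *.
pose phi : 'End('cV[C]_2) := linfun (mulmx (rho N - a%:M)).
have [_ irr] := rho_irr; have [_ _ rhoM] := rho_rep.
have phiE v : phi v = rho N *m v - a *: v by rewrite lfunE /= mulmxBl mul_scalar_mx.
have [] := irr (lker phi).
- move=> g v hg; rewrite !memv_ker !phiE !subr_eq0 => /eqP E.
  have comm : rho N *m rho g = rho g *m rho N.
    by rewrite -(rhoM _ _ Gamma0_opp1 hg) -(rhoM _ _ hg Gamma0_opp1) mul_opp1_central.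
  by rewrite mulmxA comm -mulmxA E scalemxAr.
- move=> h; have : X t \in lker phi by rewrite memv_ker phiE EX subrr.
  by rewrite h memv0 (negPf Xt).
move=> h; have : Y s \in lker phi by rewrite h memvf.
rewrite memv_ker phiE -EY -scalerBl scaler_eq0 (negPf Ys) orbF subr_eq0 eq_sym.
by move/eqP.
Qed.

Lemma opp1_expz_parity k l : (-1) ^ (- k) = (-1) ^ (- l) :> C -> (2 %| k - l)%Z.
Proof.
move=> E; have E1 : (-1) ^ (k - l) = 1 :> C.
  have u : (-1 : C) != 0 by rewrite oppr_eq0 oner_eq0.
  rewrite expfzDr // -E -expfzDr // subrr expr0z.
  by [].
have even n : (-1) ^+ n = 1 :> C -> ~~ odd n.
  rewrite -signr_odd; case: (odd n) => //= /eqP; rewrite expr1 eq_sym -subr_eq0 opprK.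
  by rewrite -(natrD C 1 1) pnatr_eq0.
rewrite dvdzE dvdn2; move: E1; case: (k - l) => n E1; first exact: even.
by apply: (even n.+1); apply: invr_inj; rewrite invr1.
Qed.

Lemma scale_solve (U : lmodType C) (c : C) (u v : U) : c != 0 ->
  u + c *: v = 0 -> v = - c^-1 *: u.
Proof.
move=> c0 /eqP; rewrite addr_eq0 => /eqP ->.
by rewrite scalerN scaleNr opprK scalerA mulVf // scale1r.
Qed.

Variable D : H -> C.
Hypotheses (D0 : forall t, D t != 0) (D_form : modular_form 4 D)
  (D_inv : qform 0 (fun t => (D t)^-1))
  (D_zero : qform 0 (fun t => e2pi (- (val t / 2)) * slash 4 Smx D t))
  (D_zero_inv : qform 0 (fun t => e2pi (val t / 2) / slash 4 Smx D t)).
Variable k0 : int.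
Hypothesis k0_minimal : forall k, k < k0 -> forall G, M k G -> G = fun=> 0.
Variable F : H -> 'cV[C]_2.
Hypotheses (hF : M k0 F) (F0 : F <> fun=> 0).
Local Notation DF := (modular_derivative k0 F).

Lemma vanish0_small k G : k < k0 + 4 -> M k G -> vanish0 k G -> G = fun=> 0.
Proof.
move=> kk hG vG; have h := vv_divide D_form D_inv D_zero_inv hG vG.
have k4 : k - 4 < k0 by rewrite ltrBlDr.
have E := k0_minimal k4 h; apply/funext => t.
have := congr1 (fun Y : H -> 'cV[C]_2 => D t *: Y t) E.
by rewrite /= scalerA divff // scale1r scaler0.
Qed.

(** A is cancelled at the cusp 0, so its zeros in the upper half-plane do not matter. *)
Lemma A_scale_eq0 G : M k0 G -> (forall t, A t *: G t = 0) -> G = fun=> 0.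
Proof.
move=> hG h; apply: (vanish0_small _ hG); first by rewrite ltrDl.
apply: (vanish0_A hG); rewrite (_ : (fun t => _) = (fun=> 0)); first exact: vanish0_0.
by apply/funext.
Qed.

Lemma deriv_independent (a b : C) : (forall t, a *: (A t *: F t) + b *: DF t = 0) -> a = 0 /\ b = 0.
Proof.
move=> h; have [b0|b0] := eqVneq b 0.
  split=> //; apply/eqP/negPn/negP => a0; apply: F0; apply: A_scale_eq0 => // t.
  have := h t; rewrite b0 scale0r addr0 => /eqP; rewrite scaler_eq0 (negPf a0) /=.
  by move/eqP.
exfalso; apply: F0; apply: (@deriv_eigenform k0 F (- b^-1 * a) hF) => t.
by rewrite -scalerA; exact: scale_solve b0 (h t).
Qed.

Lemma minimal_weight_relation G : M k0 G -> exists a b c : C, ~ (a = 0 /\ b = 0 /\ c = 0) /\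
  forall t, a *: (A t *: F t) + b *: (A t *: G t) + c *: DF t = 0.
Proof.
move=> hG; have h1 := vvA hF; have h2 := vvA hG; have h3 := vvDeriv hF.
have [a [b [c [abc v]]]] := vanishing_combination h1 h2 h3.
exists a, b, c; split=> // t.
have hc : M (k0 + 2) (fun t => a *: (A t *: F t) + b *: (A t *: G t) + c *: DF t).
  exact: vvD (vvD (vvZ a h1) (vvZ b h2)) (vvZ c h3).
have k2 : k0 + 2 < k0 + 4 by rewrite ltrD2l.
exact: (congr1 (fun Y : H -> 'cV[C]_2 => Y t) (vanish0_small k2 hc v)).
Qed.

(** Since X is no multiple of F, the relation among A F, A X and the derivative of X involves the
    latter. So the derivative maps the span of F and X into A times itself, and an eigenvector
    contradicts [deriv_eigenform]. *)
Lemma no_deriv_in_A X : M k0 X -> (forall t, DF t = A t *: X t) -> False.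
Proof.
move=> hX DFX.
have notcF (c : C) : ~ (forall t, X t = c *: F t).
  move=> h; have [] := @deriv_independent (- c) 1; last first.
    by move=> _ /eqP; rewrite oner_eq0.
  move=> t; rewrite DFX h scale1r scaleNr !scalerA [A t * _]mulrC.
  by rewrite addNr.
have h1 := vvA hF; have h2 := vvA hX; have h3 := vvDeriv hX.
have [a [b [c [abc v]]]] := vanishing_combination h1 h2 h3.
have hc : M (k0 + 2) (fun t => a *: (A t *: F t) + b *: (A t *: X t) + c *: modular_derivative k0 X t).
  exact: vvD (vvD (vvZ a h1) (vvZ b h2)) (vvZ c h3).
have k2 : k0 + 2 < k0 + 4 by rewrite ltrD2l.
have rel t : a *: (A t *: F t) + b *: (A t *: X t) + c *: modular_derivative k0 X t = 0.
  exact: (congr1 (fun Y : H -> 'cV[C]_2 => Y t) (vanish0_small k2 hc v)).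
have [c0|c0] := eqVneq c 0.
  apply: abc; have [] := @deriv_independent a b; last by [].
  by move=> t; have := rel t; rewrite c0 scale0r addr0 DFX.
pose a1 := - c^-1 * a; pose b1 := - c^-1 * b.
have DX t : modular_derivative k0 X t = a1 *: (A t *: F t) + b1 *: (A t *: X t).
  by rewrite (scale_solve c0 (rel t)) scalerDr [X in X + _]scalerA [X in _ + X]scalerA.
(* The root u of u (u + b1) = a1 makes Y = u F + X an eigenvector with eigenvalue u + b1. *)
pose s := sqrtC (b1 ^+ 2 + 4 * a1).
have sE : s ^+ 2 = b1 ^+ 2 + 4 * a1 by exact: sqrtCK.
pose u := (- b1 + s) / 2.
have uE : u * (u + b1) = a1.
  have -> : u * (u + b1) = (s ^+ 2 - b1 ^+ 2) / 4 by rewrite /u; field.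
  by rewrite sE; field.
pose Y t := u *: F t + X t.
have hY : M k0 Y by exact: vvD (vvZ u hF) hX.
have Y0 : Y = fun=> 0.
  apply: (@deriv_eigenform k0 Y (u + b1) hY) => t.
  rewrite /Y (modular_derivativeD (vvZ u hF) hX) (modular_derivativeZ u hF).
  rewrite DX DFX -uE; move: (F t) (X t) (A t) => f x z.
  by apply/matrixP => i j; rewrite !mxE; ring.
apply: (notcF (- u)) => t.
have := congr1 (fun Z : H -> 'cV[C]_2 => Z t) Y0; rewrite /Y => /eqP.
by rewrite addrC addr_eq0 scaleNr => /eqP.
Qed.

Lemma minimal_weight_line G : M k0 G -> exists c : C, forall t, G t = c *: F t.
Proof.
move=> hG; have [a [b [c [abc rel]]]] := minimal_weight_relation hG.
have [c0|c0] := eqVneq c 0.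
  have hX : M k0 (fun t => a *: F t + b *: G t) by exact: vvD (vvZ a hF) (vvZ b hG).
  have X0 : (fun t => a *: F t + b *: G t) = fun=> 0.
    apply: A_scale_eq0 hX _ => t; rewrite -[RHS](rel t) c0 scale0r addr0.
    by rewrite scalerDr !scalerA ![A t * _]mulrC.
  have X0t t : a *: F t + b *: G t = 0 := congr1 (fun Z : H -> 'cV[C]_2 => Z t) X0.
  have [b0|b0] := eqVneq b 0.
    have [] := @deriv_independent a 0; last by move=> a0 _; case: abc.
    by move=> t; rewrite scale0r addr0 scalerA mulrC -scalerA; have := X0t t; rewrite b0 scale0r addr0 => ->; rewrite scaler0.
  by exists (- b^-1 * a) => t; rewrite (scale_solve b0 (X0t t)) scalerA.
exfalso; apply: (@no_deriv_in_A (fun t => (- c^-1 * a) *: F t + (- c^-1 * b) *: G t)).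
  exact: vvD (vvZ _ hF) (vvZ _ hG).
move=> t; rewrite (scale_solve c0 (rel t)); move: (F t) (G t) (A t) => f x z.
by apply/matrixP => i j; rewrite !mxE; ring.
Qed.

End MinimalWeight.

Lemma graded_scale_homogeneous (R : realType) (V : lmodType R[i]) (c : int -> uhp R -> R[i])
    (l k : int) (G : uhp R -> V) t :
  graded_scale c (homogeneous l G) k t = c (k - l) t *: G t.
Proof.
rewrite /graded_scale -(fsbig_widen [set k - l] setT) //; last first.
  move=> i [_ /= il]; rewrite /homogeneous; case: eqVneq => [E|_]; last by rewrite scaler0.
  by case: il; rewrite -E opprB addrC subrK.
have kl : k - (k - l) = l by rewrite opprB addrC subrK.
by rewrite fsbig_set1 /homogeneous kl eqxx.
Qed.

Lemma lincomb_entry (R : realType) (a b : R[i]) (u v : 'cV[R[i]]_2) i :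
  (a *: u + b *: v) i 0 = a * u i 0 + b * v i 0.
Proof. by rewrite !mxE. Qed.

(** * The basis of the module *)

Section FreeBasis.
Variable R : realType.
Local Notation C := R[i].
Local Notation H := (uhp R).
Variable rho : 'M[int]_2 -> 'M[C]_2.
Hypotheses (rho_rep : representation rho) (rho_irr : irreducible rho).
Implicit Types (t : H) (x y : H -> C) (X Y G : H -> 'cV[C]_2) (k l : int).
Local Notation M := (vv_modular_form rho).
Local Notation A := (@eisA R).
Variable D : H -> C.
Hypotheses (D0 : forall t, D t != 0) (D_form : modular_form 4 D)
  (D_inv : qform 0 (fun t => (D t)^-1))
  (D_zero : qform 0 (fun t => e2pi (- (val t / 2)) * slash 4 Smx D t))
  (D_zero_inv : qform 0 (fun t => e2pi (val t / 2) / slash 4 Smx D t)).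
Variable k0 : int.
Hypothesis k0_minimal : forall k, k < k0 -> forall G, M k G -> G = fun=> 0.
Variable F : H -> 'cV[C]_2.
Hypotheses (hF : M k0 F) (F0 : F <> fun=> 0).
Local Notation DF := (modular_derivative k0 F).

Definition spanned k G := exists x y,
  [/\ modular_form (k - k0) x, modular_form (k - (k0 + 2)) y &
      forall t, G t = x t *: F t + y t *: DF t].

Lemma spanned0 k : spanned k (fun=> 0).
Proof.
exists (fun=> 0), (fun=> 0); split=> [||t]; [exact: modular_form0|exact: modular_form0|].
by rewrite !scale0r addr0.
Qed.

Lemma spannedD k X Y : spanned k X -> spanned k Y -> spanned k (fun t => X t + Y t).
Proof.
move=> [x [y [hx hy XE]]] [x' [y' [hx' hy' YE]]].
exists (fun t => x t + x' t), (fun t => y t + y' t); split.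
- exact: modular_formD.
- exact: modular_formD.
- by move=> t; rewrite XE YE !scalerDl addrACA.
Qed.

Lemma spannedM l k x X : modular_form l x -> spanned k X -> spanned (l + k) (fun t => x t *: X t).
Proof.
move=> hl [x' [y' [hx' hy' XE]]].
exists (fun t => x t * x' t), (fun t => x t * y' t); split.
- by rewrite -addrA; exact: modular_formM.
- by rewrite -addrA; exact: modular_formM.
- by move=> t; rewrite XE scalerDr !scalerA.
Qed.

Lemma spannedZ k (c : C) X : spanned k X -> spanned k (fun t => c *: X t).
Proof. by move=> /(spannedM (modular_form_cst c)); rewrite add0r. Qed.

Lemma spannedF : spanned k0 F.
Proof.
exists (fun=> 1), (fun=> 0); split=> [||t].
- by rewrite subrr; exact: modular_form_cst.
- exact: modular_form0.
- by rewrite scale1r scale0r addr0.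
Qed.

Lemma spannedDF : spanned (k0 + 2) DF.
Proof.
exists (fun=> 0), (fun=> 1); split=> [||t].
- exact: modular_form0.
- by rewrite subrr; exact: modular_form_cst.
- by rewrite scale1r scale0r add0r.
Qed.

Lemma spanned_step m G : (forall G', M (2 *+ m.+1 + k0 - 4) G' -> spanned (2 *+ m.+1 + k0 - 4) G') ->
  M (2 *+ m.+1 + k0) G -> spanned (2 *+ m.+1 + k0) G.
Proof.
move=> IH hG.
have w2 : 2 *+ m + (k0 + 2) = 2 *+ m.+1 + k0 by rewrite mulrSr; ring.
have h1 := vvX m.+1 hF; have h2 := vvX m (vvDeriv hF); rewrite w2 in h2.
have [a [b [c [abc v]]]] := vanishing_combination h1 h2 hG.
(* Without G in the relation, A^m cancels at the cusp 0 and a relation in weight k0 + 2 remains,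
   which is excluded. *)
have [c0|c0] := eqVneq c 0.
  exfalso; apply: abc.
  have hU : M (k0 + 2) (fun t => a *: (A t *: F t) + b *: DF t).
    exact: vvD (vvZ a (vvA hF)) (vvZ b (vvDeriv hF)).
  have vU : vanish0 (k0 + 2) (fun t => a *: (A t *: F t) + b *: DF t).
    apply: (@vanish0_AX _ _ _ _ m hU); rewrite w2.
    move: v; congr (vanish0 _ _); apply/funext => t.
    rewrite c0 scale0r addr0 exprSr; move: (F t) (DF t) (A t) => f f' z.
    by apply/matrixP => i j; rewrite !mxE; ring.
  have k2 : k0 + 2 < k0 + 4 by rewrite ltrD2l.
  have U0 := vanish0_small D0 D_form D_inv D_zero_inv k0_minimal k2 hU vU.
  have [] := @deriv_independent _ _ rho_irr _ D0 D_form D_inv D_zero_inv _ k0_minimal _ hF F0 a b.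
    by move=> t; exact: (congr1 (fun Z : H -> 'cV[C]_2 => Z t) U0).
  by move=> -> ->.
have hY := vvD (vvD (vvZ a h1) (vvZ b h2)) (vvZ c hG).
have sQ := IH _ (vv_divide D_form D_inv D_zero_inv hY v).
have s1 : spanned (2 *+ m.+1 + k0) (fun t => A t ^+ m.+1 *: F t).
  exact: spannedM (modular_formX m.+1 (modular_form_eisA R)) spannedF.
have s2 : spanned (2 *+ m.+1 + k0) (fun t => A t ^+ m *: DF t).
  by rewrite -w2; exact: spannedM (modular_formX m (modular_form_eisA R)) spannedDF.
have sY := spannedM D_form sQ.
have w4 : 4 + (2 *+ m.+1 + k0 - 4) = 2 *+ m.+1 + k0 by rewrite addrC subrK.
rewrite w4 in sY.
have := spannedZ c^-1 (spannedD sY (spannedD (spannedZ (- a) s1) (spannedZ (- b) s2))).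
congr (spanned _ _); apply/funext => t.
have DK (u : 'cV[C]_2) : D t *: ((D t)^-1 *: u) = u by rewrite scalerA divff // scale1r.
rewrite DK !scaleNr.
have -> (p q r : 'cV[C]_2) : p + q + c *: r + (- p + - q) = c *: r.
  by rewrite addrAC -opprD subrr add0r.
by rewrite scalerA mulVf // scale1r.
Qed.

Lemma all_spanned k G : M k G -> spanned k G.
Proof.
have [m hm] : exists m : nat, k < k0 + m%:Z by exists `|k - k0|.+1; lia.
(* Induction over a bound for the weight, since a step lowers it by 4; from k0 + 2 it lands below
   k0, where all forms are zero. *)
elim: m {-2}m (leqnn m) k G hm => [|n IHn] m mn k G hm hG.
  rewrite (k0_minimal _ hG); first exact: spanned0.
  by move: mn; rewrite leqn0 => /eqP m0; move: hm; rewrite m0 addr0.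
have [G0|G0] := pselect (G = fun=> 0); first by rewrite G0; exact: spanned0.
have [kk|kk] := ltP k k0; first by rewrite (k0_minimal kk hG); exact: spanned0.
have par : (2 %| k - k0)%Z := opp1_expz_parity (weight_parity rho_rep rho_irr hG hF G0 F0).
have [p kE] : exists p : nat, k = 2 *+ p + k0.
  by case/dvdzP: par => q E; exists `|q|%N; rewrite -mulr_natr natz; lia.
case: p kE => [|p] kE.
  rewrite add0r in kE; rewrite kE in hG *.
  have [c cE] := @minimal_weight_line _ _ rho_irr _ D0 D_form D_inv D_zero_inv _ k0_minimal _ hF F0 _ hG.
  have := spannedZ c spannedF; congr (spanned _ _); apply/funext => t.
  by rewrite cE.
rewrite kE in hG *; apply: spanned_step hG => G' hG'.
apply: (IHn (m - 1)%N) hG'; first by lia.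
by rewrite -kE; lia.
Qed.

(** The weight l is generalized because each step divides the relation by D. If a and b are the
    values of x and y at the cusp 0, then - 2 a A F + b D_k0 F vanishes there, hence a = b = 0. *)
Lemma independent_flat n l x y : modular_form l x -> modular_form (l - 2) y ->
  (forall t, x t *: F t + y t *: DF t = 0) ->
  qform 0 (fun t => slash l Smx x t * qexp 2 t ^- n) /\
  qform 0 (fun t => slash (l - 2) Smx y t * qexp 2 t ^- n).
Proof.
have hS := SL2Z_Smx.
elim: n l x y => [|n IHn] l x y hx hy rel.
  have /modular_formP[_ _ _ qx] := hx; have /modular_formP[_ _ _ qy] := hy.
  by split; [apply: (qform_ext qx)|apply: (qform_ext qy)] => t; rewrite expr0 invr1 mulr1.
have /modular_formP[_ _ _ qx] := hx; have /modular_formP[_ _ _ qy] := hy.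
have [a va] := qform0_limit qx; have [b vb] := qform0_limit qy.
have hDF := vvDeriv hF.
have relS t : slash l Smx x t *: slash k0 Smx F t + slash (l - 2) Smx y t *: slash (k0 + 2) Smx DF t = 0.
  have e1 := congr1 (fun Z : H -> 'cV[C]_2 => Z t) (slash_scale l k0 x F hS).
  have e2 := congr1 (fun Z : H -> 'cV[C]_2 => Z t) (slash_scale (l - 2) (k0 + 2) y DF hS).
  rewrite /= in e1 e2; rewrite -e1 -e2.
  have -> : l - 2 + (k0 + 2) = l + k0 by rewrite addrACA addNr addr0.
  by rewrite !slashE -scalerDr rel scaler0.
(* The constant a is replaced by - 2 a A, of value a at the cusp 0, to make the weights equal. *)
have hU : M (k0 + 2) (fun t => (-2 * a) *: (A t *: F t) + b *: DF t).
  exact: vvD (vvZ _ (vvA hF)) (vvZ b hDF).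
have vU : vanish0 (k0 + 2) (fun t => (-2 * a) *: (A t *: F t) + b *: DF t).
  move=> i.
  have gF := grow_slash hF i; have gDF := grow_slash hDF i.
  have v1 := vanM gF va; have v2 := vanM gDF vb; have v3 := vanM gF (@van_eisA_Smx R).
  apply: (van_ext (vanD (vanZ a v3) (vanZ (-1) (vanD v1 v2)))) => t.
  have r0 := congr1 (fun u : 'cV[C]_2 => u i 0) (relS t); rewrite /= lincomb_entry [RHS]mxE in r0.
  have e3 : slash (k0 + 2) Smx (fun t => (-2 * a) *: (A t *: F t) + b *: DF t) t i 0 =
      -2 * a * (slash 2 Smx A t * slash k0 Smx F t i 0) + b * slash (k0 + 2) Smx DF t i 0.
    rewrite slashD !slashZ [X in slash X Smx (fun t => A t *: F t)]addrC.
    by rewrite slash_scale // !mxE.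
  rewrite e3; move: r0.
  move: (slash l Smx x t) (slash (l - 2) Smx y t) (slash 2 Smx A t) (slash k0 Smx F t i 0)
    (slash (k0 + 2) Smx DF t i 0) => sx sy sA sF sDF r0.
  have -> : -2 * a * (sA * sF) + b * sDF = a * (sF * (-2 * sA - 1)) + -1 * (sF * (sx - a) + sDF * (sy - b)) + (sx * sF + sy * sDF).
    by ring.
  by rewrite r0 addr0.
have k2 : k0 + 2 < k0 + 4 by rewrite ltrD2l.
have U0 := vanish0_small D0 D_form D_inv D_zero_inv k0_minimal k2 hU vU.
have [a0 b0] : -2 * a = 0 /\ b = 0.
  apply: (@deriv_independent _ _ rho_irr _ D0 D_form D_inv D_zero_inv _ k0_minimal _ hF F0) => t.
  exact: (congr1 (fun Z : H -> 'cV[C]_2 => Z t) U0).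
have {}a0 : a = 0.
  by move/eqP: a0; rewrite mulf_eq0 oppr_eq0 pnatr_eq0 /= => /eqP.
have vx : van (slash l Smx x) by apply: (van_ext va) => t; rewrite a0 subr0.
have vy : van (slash (l - 2) Smx y) by apply: (van_ext vb) => t; rewrite b0 subr0.
have hx1 := modular_form_divide D_form D_inv D_zero_inv hx vx.
have hy1 := modular_form_divide D_form D_inv D_zero_inv hy vy.
rewrite [l - 2 - 4]addrAC in hy1.
have [] := IHn _ _ _ hx1 hy1.
  by move=> t; rewrite -!scalerA -scalerDr rel scaler0.
(* The simple zero of D turns one division by D into one more power of the local parameter. *)
have up m (z : H -> C) : qform 0 (fun t => slash (m - 4) Smx (fun t => (D t)^-1 * z t) t * qexp 2 t ^- n) ->
    qform 0 (fun t => slash m Smx z t * qexp 2 t ^- n.+1).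
  move=> qz; apply: (qform_ext (qformM D_zero qz)) => t.
  rewrite [m - 4]addrC slash_mul // slashV.
  have s0 : slash 4 Smx D t != 0.
    by rewrite slashE scaler_eq0 negb_or D0 andbT expfz_neq0 // jf_neq0.
  have qE : e2pi (- (val t / 2)) = (qexp 2 t)^-1 by rewrite e2piN.
  move: (slash m Smx z t) (slash 4 Smx D t) s0 => sz d d0.
  by rewrite qE exprS invfM; move: (qexp 2 t)^-1 (qexp 2 t ^- n) => u w; field.
move=> qx1 qy1; split; first exact: up.
by apply: up; rewrite addrAC.
Qed.

Lemma independent_over_forms l x y : modular_form l x -> modular_form (l - 2) y ->
  (forall t, x t *: F t + y t *: DF t = 0) -> x = (fun=> 0) /\ y = fun=> 0.
Proof.
move=> hx hy rel.
have /modular_formP[_ _ _ qx] := hx; have /modular_formP[_ _ _ qy] := hy.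
have h n := independent_flat n hx hy rel.
split.
  apply: (slash_eq0 (k := l) SL2Z_Smx); apply: (qform0_flat qx) => n.
  by have [] := h n.
apply: (slash_eq0 (k := l - 2) SL2Z_Smx); apply: (qform0_flat qy) => n.
by have [] := h n.
Qed.

Lemma homogeneous_graded l G : M l G -> graded_vv_modular_forms rho (homogeneous l G).
Proof.
move=> hG; split=> [k|].
  by rewrite /homogeneous; case: eqVneq => [->|_]; [exact: hG|exact (vv0 k hG)].
apply: (sub_finite_set _ (finite_set1 l)) => k /=.
by rewrite /homogeneous; case: eqVneq.
Qed.

End FreeBasis.

Theorem theorem1p4 (R : realType) (rho : 'M[int]_2 -> 'M[R[i]]_2)
    (rho_rep : representation rho) (rho_irr : irreducible rho)
    (k0 : int)
    (k0_nonzero : exists G, vv_modular_form rho k0 G /\ G <> 0)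
    (k0_minimal : forall k, k < k0 ->
       forall G, vv_modular_form rho k G -> G = 0)
    (F : uhp R -> 'cV[R[i]]_2)
    (F_form : vv_modular_form rho k0 F) (F_nonzero : F <> 0) :
  is_basis rho [tuple homogeneous k0 F;
                      homogeneous (k0 + 2) (modular_derivative k0 F)].
Proof.
have [D [D0 D_form D_inv D_zero D_zero_inv]] := cusp_form_exists R.
have hDF := vvDeriv F_form.
set DF := modular_derivative k0 F in hDF *.
pose B := [tuple homogeneous k0 F; homogeneous (k0 + 2) DF].
have scaleE (c : 'I_2 -> int -> uhp R -> R[i]) k t :
    (\sum_(i < 2) graded_scale (c i) (tnth B i)) k t =
    c ord0 (k - k0) t *: F t + c ord_max (k - (k0 + 2)) t *: DF t.
  rewrite big_ord_recl big_ord1 -[LHS]/(graded_scale _ _ k t + graded_scale _ _ k t).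
  by rewrite (tnth_nth 0) (tnth_nth 0) /= !graded_scale_homogeneous; congr (_ + c _ _ _ *: _); exact: val_inj.
split.
- by case=> -[|[|//]] hi; rewrite (tnth_nth 0) /=; exact: homogeneous_graded.
- move=> G [G_form G_fin].
  (* Zero coefficients are prescribed where G k = 0, so that the chosen families have finite
     support. *)
  have hs k : exists xy : (uhp R -> R[i]) * (uhp R -> R[i]),
      [/\ modular_form (k - k0) xy.1, modular_form (k - (k0 + 2)) xy.2,
          forall t, G k t = xy.1 t *: F t + xy.2 t *: DF t & G k = 0 -> xy = (0, 0)].
    have [Gk|Gk] := pselect (G k = 0).
      exists (0, 0); split=> //; [exact: modular_form0|exact: modular_form0|].
      by move=> t; rewrite Gk /= !scale0r addr0.
    have [x [y [hx hy E]]] := all_spanned rho_rep rho_irr D0 D_form D_inv D_zero_inv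
      k0_minimal F_form F_nonzero (G_form k).
    by exists (x, y).
  have [xy hxy] := boolp.choice hs.
  (* A coefficient of degree j belongs to degree j + k0 or j + k0 + 2 of G, the basis elements
     having degrees k0 and k0 + 2. *)
  exists (fun i j => if i == ord0 then (xy (j + k0)).1 else (xy (j + (k0 + 2))).2); split.
    have fin (a : int) : finite_set [set j | G (j + a) <> 0].
      have := finite_image (fun k => k - a) G_fin; apply: sub_finite_set => j Gj.
      by exists (j + a); rewrite ?addrK.
    case=> -[|[|//]] hi; split=> [j|] /=.
    + by have [h _ _ _] := hxy (j + k0); rewrite addrK in h.
    + apply: (sub_finite_set _ (fin k0)) => j /= h Gj; apply: h.
      by have [_ _ _ /(_ Gj) ->] := hxy (j + k0).
    + by have [_ h _ _] := hxy (j + (k0 + 2)); rewrite addrK in h.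
    + apply: (sub_finite_set _ (fin (k0 + 2))) => j /= h Gj; apply: h.
      by have [_ _ _ /(_ Gj) ->] := hxy (j + (k0 + 2)).
  apply/funext => k; apply/funext => t; rewrite scaleE /= !subrK.
  by have [_ _ -> _] := hxy k.
- move=> c hc E.
  have rel k t : c ord0 (k - k0) t *: F t + c ord_max (k - (k0 + 2)) t *: DF t = 0.
    by rewrite -scaleE E.
  have ind (j : int) := independent_over_forms rho_irr D0 D_form D_inv D_zero D_zero_inv
      k0_minimal F_form F_nonzero ((hc ord0).1 j) ((hc ord_max).1 (j - 2)).
  have c0 j : c ord0 j = 0 /\ c ord_max (j - 2) = 0.
    apply: ind => t; have := rel (j + k0) t; rewrite addrK.
    by rewrite (_ : j + k0 - (k0 + 2) = j - 2) //; lia.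
  case=> -[|[|//]] hi; apply/funext => j.
    by have [h _] := c0 j; rewrite -[RHS]h; congr (c _ _); exact: val_inj.
  have [_ h] := c0 (j + 2); rewrite addrK in h.
  by rewrite -[RHS]h; congr (c _ _); exact: val_inj.
Qed.
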